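(* For $g\geqslant2$, let $c_1,\dots,c_{g+1}\in\mathbb{S}^1$ be distinct points and $k_1,\dots,k_{g+1}\geqslant1$ any integers. For $z\in\mathbb{R}\setminus\{0\}$ small enough, let $\Gamma_z$ denote the Schottky reflection group associated to $\underline c=(c_1,\dots,c_{g+1})$ and $\underline k=(k_1,\dots,k_{g+1})$, with generators $\gamma_{1,z},\dots,\gamma_{g,z}$. Then: \begin{enumerate} \item[(i)] The family $\Gamma_z$ is induced by an admissible function: there is an admissible function $p$ such that, for all $z\in\mathbb{R}\setminus\{0\}$ with $|z|$ small enough, the Schottky group with generators of Koebe coordinates $(\alpha_i(z),\beta_i(z),y_i(z))$, $i=1,\dots,g$, determined by $p(z)$ is, together with these generators, conjugate in $\mathrm{PGL}_2(\mathbb{C})$ to $(\Gamma_z;\gamma_{1,z},\dots,\gamma_{g,z})$. \item[(ii)] If $k_i=k$ for all $i\leqslant g$, then the Hausdorff dimension $s(z)$ of the limit set of $\Gamma_z$ satisfies $$s(z)\sim\frac{-\log u}{2\log|z^{-1}|}$$ as $z\to0$, where $u$ is the largest (real) root of $X^{k+k_{g+1}}+(1-1/g)X^k-1/g$. \item[(iii)] If $k_i=1$ for all $i\leqslant g+1$, then the Hausdorff dimension $s(z)$ of the limit set of $\Gamma_z$ satisfies $$s(z)\sim\frac{\log g}{2\log|z^{-1}|}$$ as $z\to0$. \end{enumerate}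
   Context: Schottky reflection groups. For $z\in\mathbb{R}\setminus\{0\}$ small and $j=1,\dots,g+1$, let $D_{j,z}$ be the disk bounded by the circle orthogonal to the unit circle $\mathbb{S}^1$ at the two points $c_j\exp(iz^{k_j}/2)$ and $c_j\exp(-iz^{k_j}/2)$. Let $\sigma_j$ be the reflection (inversion) with respect to the boundary of $D_{j,z}$, and set $\gamma_{j,z}:=\sigma_j\sigma_{g+1}$ for $j=1,\dots,g$. $\Gamma_z$ is the group generated by $\gamma_{1,z},\dots,\gamma_{g,z}$; for $|z|$ small it is a Schottky group over $\mathbb{C}$ (the disks $D_{j,z},\sigma_{g+1}(D_{j,z})$, $1\leqslant j\leqslant g$, are disjoint). Its limit set is the set of accumulation points of its orbits in $\mathbb{P}^1(\mathbb{C})$, and Hausdorff dimension is for the spherical metric. Koebe coordinates. A loxodromic $\gamma\in\mathrm{PGL}_2(\mathbb{C})$ (eigenvalues of different absolute values) is determined by its Koebe coordinates $(\alpha,\beta,y)$: attracting fixed point $\alpha$, repelling fixed point $\beta$, and multiplier $y$, $0<|y|<1$ (ratio of the eigenvalue of smaller absolute value to the other). Admissible functions. Let $D$ be the open unit disk in $\mathbb{C}$. Call $p=(\alpha_3,\dots,\alpha_g,\beta_2,\dots,\beta_g,y_1,\dots,y_g):D\to\mathbb{C}^{3g-3}$ admissible if for some $0<r'\leqslant 1/e$ it is continuous on $\{0<|z|\leqslant r'\}$, holomorphic on $\{0<|z|<r'\}$, meromorphic at $0$, and, with $\alpha_1:=0$, $\beta_1:=\infty$, $\alpha_2:=1$,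 for every $i=1,\dots,g$: (a) $y_i$ is not constant and $y_i(0)=0$; (b) for all $u,v\in\{\alpha_1,\beta_1,\dots,\alpha_g,\beta_g\}\setminus\{\alpha_i,\beta_i\}$, $\mathrm{ord}_0(y_i\cdot[u,v;\alpha_i,\beta_i])>0$, where $[a,b;c,d]=\frac{(a-c)(b-d)}{(a-d)(b-c)}$ is the cross-ratio; (c) the functions $\alpha_i,\beta_i$, $i=1,\dots,g$, are all different. *)

(* Defs.v *)
From HB Require Import structures.
From mathcomp Require Import all_boot all_order all_algebra.
From mathcomp Require Import complex ring.
From mathcomp Require Import all_classical all_reals all_analysis.

Set Implicit Arguments.
Unset Strict Implicit.
Unset Printing Implicit Defensive.

Import Order.TTheory GRing.Theory Num.Theory.
Import numFieldNormedType.Exports.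

Local Notation normc := Normc.normc.

Local Open Scope classical_set_scope.
Local Open Scope ring_scope.

(** * Hausdorff dimension of a subset of a set [T] with a distance *)

Section Hausdorff.
Context (R : realType) (T : Type) (dist : T -> T -> R).
Implicit Types (d delta : R) (E U : set T).

(* The point 0 is added so that the empty set has diameter 0. *)
Definition diameter U : \bar R :=
  ereal_sup (0%E |` [set (dist x.1 x.2)%:E | x in U `*` U]).

Definition hausdorff_content d delta E : \bar R :=
  ereal_inf [set (\sum_(0 <= n <oo) poweR (diameter (V n)) d)%E | V in
    [set V : nat -> set T | E `<=` \bigcup_n V n /\
                            forall n, (diameter (V n) <= delta%:E)%E]].

Definition hausdorff_measure d E : \bar R :=
  ereal_sup [set hausdorff_content d delta E | delta in [set delta | 0 < delta]].

(* Only exponents [d > 0] are used, so the value of [0 `^ 0] is irrelevant. *)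
Definition hausdorff_dim E : \bar R :=
  ereal_inf [set d%:E | d in [set d : R | 0 < d /\ hausdorff_measure d E = 0%E]].

End Hausdorff.

(** * The complex projective line *)

Section ProjectiveLine.
Context (R : realType).
Local Notation C := R[i].

(* [None] is the point at infinity. *)
Definition P1 : Type := option C.
Implicit Types (x y u v : P1) (M N : 'M[C]_2).

(* Homogeneous coordinates: [z : 1] for [z] in C, and [1 : 0] at infinity. *)
Definition hx x : C := if x is Some z then z else 1.
Definition hy x : C := if x is Some _ then 1 else 0.
Definition hvec x : 'cV[C]_2 := \col_i (if i == ord0 then hx x else hy x).

(* This is [x - y] when both points are finite. *)
Definition hdet x y : C := hx x * hy y - hx y * hy x.

(* [(a-c)(b-d) / ((a-d)(b-c))]; a point at infinity occurs once in the numerator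
   and once in the denominator, with the same sign, so this is the usual
   extension of the cross-ratio to the projective line. *)
Definition cross_ratio u v x y : C :=
  (hdet u x * hdet v y) / (hdet u y * hdet v x).

(* Great-circle distance on the unit sphere, for the Riemannian metric
   [2 |dz| / (1 + |z|^2)]: the chordal distance is [2 sin (sdist / 2)]. *)
Definition hnorm x : R := Num.sqrt (normc (hx x) ^+ 2 + normc (hy x) ^+ 2).
Definition sdist x y : R :=
  2 * asin (normc (hdet x y) / (hnorm x * hnorm y)).

Definition mobius M x : P1 :=
  let v := M *m hvec x in
  if v ord_max ord0 == 0 then None else Some (v ord0 ord0 / v ord_max ord0).

(* [M] is loxodromic, and its class in PGL_2 has Koebe coordinates
   [(alpha, beta, y)]: the attracting (resp. repelling) fixed point is the
   eigenline of the eigenvalue of larger (resp. smaller) absolute value. *)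
Definition koebe_coordinates M (alpha beta : P1) (y : C) : Prop :=
  M \in unitmx /\
  exists lambda mu : C,
    [/\ M *m hvec alpha = lambda *: hvec alpha,
        M *m hvec beta = mu *: hvec beta,
        0 < normc mu < normc lambda & y = mu / lambda].

(* The group generated by a set of bijections. *)
Inductive generated (S : set (P1 -> P1)) : (P1 -> P1) -> Prop :=
| generated_id : generated S id
| generated_mem f : S f -> generated S f
| generated_comp f h : generated S f -> generated S h -> generated S (f \o h)
| generated_inv f f' : generated S f -> cancel f f' -> cancel f' f ->
    generated S f'.

Definition orbit (G : set (P1 -> P1)) x : set P1 := [set f x | f in G].

Definition accumulation_point (E : set P1) x : Prop :=
  forall eps : R, 0 < eps -> exists y, [/\ E y, y <> x & sdist y x < eps].

Definition limit_set (G : set (P1 -> P1)) : set P1 :=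
  [set x | exists w, accumulation_point (orbit G w) x].

Definition closed_disk N : set P1 :=
  mobius N @` [set Some z | z in [set z : C | normc z <= 1]].
Definition open_disk N : set P1 :=
  mobius N @` [set Some z | z in [set z : C | normc z < 1]].

(* [gam] freely generates a Schottky group: there are pairwise disjoint closed
   disks [B_i], [B'_i] such that [gam_i] maps the exterior of [B'_i] onto the
   interior of [B_i]. *)
Definition schottky_generators g (gam : 'I_g -> P1 -> P1) : Prop :=
  exists N : 'I_g * bool -> 'M[C]_2,
  [/\ forall e, N e \in unitmx,
      forall e e', e != e' -> closed_disk (N e) `&` closed_disk (N e') = set0 &
      forall i, gam i @` (~` closed_disk (N (i, false))) = open_disk (N (i, true))].

End ProjectiveLine.

(** * Germs of meromorphic functions at 0 *)

Section Meromorphic.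
Context (R : realType).
Local Notation C := R[i].
Local Notation Co := (R[i])^o.

Definition holomorphic_at (f : C -> C) (z : C) : Prop :=
  \forall w \near (z : Co), derivable (f : Co -> Co) w 1.

Definition meromorphic_at0 (f : C -> C) : Prop :=
  exists (n : nat) (h : C -> C), holomorphic_at h 0 /\
    \forall z \near (0 : Co)^', z ^+ n * f z = h z.

Definition order_at0 (f : C -> C) (m : int) : Prop :=
  exists h : C -> C, [/\ holomorphic_at h 0, h 0 != 0 &
    \forall z \near (0 : Co)^', f z = z ^ m * h z].

(* The zero germ has order [+oo]. *)
Definition order_gt0_at0 (f : C -> C) : Prop :=
  (\forall z \near (0 : Co)^', f z = 0) \/
  exists2 m : int, 0 < m & order_at0 f m.

End Meromorphic.

(** * Admissible functions *)

Section Admissible.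
Context (R : realType) (g : nat).
Local Notation C := R[i].
Local Notation Co := (R[i])^o.

(* Indices start at 0. The components [kalpha 0], [kalpha 1] and [kbeta 0] are
   not part of the data and are never used; what remains is a function with
   values in C^(3g-3). It is extended arbitrarily outside the unit disk:
   admissibility only involves its values on [|z| <= r' < 1]. *)
Record koebe_family := KoebeFamily {
  kalpha : 'I_g -> C -> C;
  kbeta : 'I_g -> C -> C;
  kmult : 'I_g -> C -> C }.

Implicit Type p : koebe_family.

Definition attracting p (i : 'I_g) (z : C) : P1 R :=
  if val i == 0%N then Some 0
  else if val i == 1%N then Some 1
  else Some (kalpha p i z).

Definition repelling p (i : 'I_g) (z : C) : P1 R :=
  if val i == 0%N then None else Some (kbeta p i z).

Definition fixed_point p (e : 'I_g * bool) : C -> P1 R :=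
  if e.2 then attracting p e.1 else repelling p e.1.

Definition is_component p (f : C -> C) : Prop :=
  exists i : 'I_g, [\/ (2 <= i)%N /\ f = kalpha p i,
                       (1 <= i)%N /\ f = kbeta p i |
                       f = kmult p i].

Definition admissible p : Prop :=
  exists2 r' : R, 0 < r' <= (expR 1)^-1 &
  let D' := [set z : C | 0 < normc z < r'] in
  (forall f, is_component p f ->
     [/\ {within ([set z : C | 0 < normc z <= r'] : set Co),
            continuous (f : Co -> Co)},
         (forall z, D' z -> holomorphic_at f z) &
         meromorphic_at0 f]) /\
  [/\ forall i : 'I_g,
        [/\ exists z w : C, [/\ D' z, D' w & kmult p i z <> kmult p i w],
            kmult p i 0 = 0 &
            (kmult p i : Co -> Co) @ (0 : Co) --> (0 : Co)],
      forall (i : 'I_g) (e e' : 'I_g * bool), e.1 != i -> e'.1 != i ->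
        order_gt0_at0 (fun z => kmult p i z *
          cross_ratio (fixed_point p e z) (fixed_point p e' z)
                      (attracting p i z) (repelling p i z)) &
      forall e e' : 'I_g * bool, e != e' ->
        exists2 z, D' z & fixed_point p e z <> fixed_point p e' z].

End Admissible.

(** * Schottky reflection groups *)

Section Reflection.
Context (R : realType).
Local Notation C := R[i].

Definition expi (t : R) : C := Complex (cos t) (sin t).

(* The circle of centre [a] and radius [r] passes through the points [p] and [q]
   of the unit circle and is orthogonal to the unit circle there, that is, its
   radii at [p] and [q] are orthogonal to those of the unit circle. *)
Definition is_orthogonal_circle (p q a : C) (r : R) : Prop :=
  [/\ 0 < r, normc (p - a) = r, normc (q - a) = r,
      complex.Re ((p - a) * conjc p) = 0 & complex.Re ((q - a) * conjc q) = 0].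

(* Centre and radius of that circle; see [orthogonal_circleP] and
   [is_orthogonal_circle_unique]. *)
Definition orthogonal_circle (p q : C) : C * R :=
  xget (0, 0) [set ar : C * R | is_orthogonal_circle p q ar.1 ar.2].

Definition inversion (a : C) (r : R) (x : P1 R) : P1 R :=
  if x is Some z then
    if z == a then None else Some (a + real_complex R (r ^+ 2) / conjc (z - a))
  else Some a.

Context (g : nat) (c : 'I_g.+1 -> C) (k : 'I_g.+1 -> nat).

Definition sigma (z : R) (j : 'I_g.+1) : P1 R -> P1 R :=
  let ar := orthogonal_circle (c j * expi (z ^+ k j / 2))
                              (c j * expi (- (z ^+ k j / 2))) in
  inversion ar.1 ar.2.

Definition gamma (z : R) (j : 'I_g) : P1 R -> P1 R :=
  sigma z (widen_ord (leqnSn g) j) \o sigma z ord_max.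

Definition Gamma (z : R) : set (P1 R -> P1 R) := generated (range (gamma z)).

End Reflection.

Section OrthogonalCircle.
Context (R : realType).
Local Notation C := R[i].
Implicit Types (p q a : C) (r : R).

Let normc_eq1 p : normc p = 1 -> complex.Re p ^+ 2 + complex.Im p ^+ 2 = 1.
Proof.
case: p => p1 p2 /= h.
by rewrite -(sqr_sqrtr (addr_ge0 (sqr_ge0 p1) (sqr_ge0 p2))) h expr1n.
Qed.

Let det_neq0 (p1 p2 q1 q2 : R) :
  p1 ^+ 2 + p2 ^+ 2 = 1 -> q1 ^+ 2 + q2 ^+ 2 = 1 ->
  Complex p1 p2 != Complex q1 q2 -> Complex p1 p2 + Complex q1 q2 != 0 ->
  p1 * q2 - p2 * q1 != 0.
Proof.
move=> hp hq pq pq'; apply/eqP => D0.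
have : (p1 * q1 + p2 * q2) ^+ 2 = 1.
  rewrite (_ : _ ^+ 2 = (p1 ^+ 2 + p2 ^+ 2) * (q1 ^+ 2 + q2 ^+ 2) -
    (p1 * q2 - p2 * q1) ^+ 2); last by ring.
  by rewrite hp hq D0 expr0n /= subr0 mulr1.
move/eqP; rewrite sqrf_eq1 => /orP[] /eqP E.
- have : (p1 - q1) ^+ 2 + (p2 - q2) ^+ 2 == 0.
    apply/eqP; rewrite (_ : _ + _ = (p1 ^+ 2 + p2 ^+ 2) + (q1 ^+ 2 + q2 ^+ 2) -
      2 * (p1 * q1 + p2 * q2)); last by ring.
    by rewrite hp hq E; ring.
  rewrite paddr_eq0 ?sqr_ge0// !sqrf_eq0 !subr_eq0 => /andP[/eqP e1 /eqP e2].
  by move: pq; rewrite e1 e2 eqxx.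
- have : (p1 + q1) ^+ 2 + (p2 + q2) ^+ 2 == 0.
    apply/eqP; rewrite (_ : _ + _ = (p1 ^+ 2 + p2 ^+ 2) + (q1 ^+ 2 + q2 ^+ 2) +
      2 * (p1 * q1 + p2 * q2)); last by ring.
    by rewrite hp hq E; ring.
  rewrite paddr_eq0 ?sqr_ge0// !sqrf_eq0 => /andP[/eqP e1 /eqP e2].
  by move: pq'; rewrite eq_complex /= e1 e2 eqxx.
Qed.

Lemma is_orthogonal_circle_unique p q a a' r r' :
  normc p = 1 -> normc q = 1 -> p != q -> p + q != 0 ->
  is_orthogonal_circle p q a r -> is_orthogonal_circle p q a' r' ->
  (a, r) = (a', r').
Proof.
move=> /normc_eq1 + /normc_eq1.
case: p q a a' => [p1 p2] [q1 q2] [a1 a2] [b1 b2].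
rewrite [complex.Re _]/= [complex.Im _]/= [complex.Re (Complex q1 _)]/=
  [complex.Im (Complex q1 _)]/= => hp hq pq pq'.
have D0 := det_neq0 hp hq pq pq'.
move=> [_ ra _ /= ea1 ea2] [_ rb _ /= eb1 eb2].
have hap : a1 * p1 + a2 * p2 = b1 * p1 + b2 * p2.
  by apply/eqP; rewrite -subr_eq0; apply/eqP; rewrite -[RHS](subrr 0)
    -{1}eb1 -ea1; ring.
have haq : a1 * q1 + a2 * q2 = b1 * q1 + b2 * q2.
  by apply/eqP; rewrite -subr_eq0; apply/eqP; rewrite -[RHS](subrr 0)
    -{1}eb2 -ea2; ring.
have e1 : a1 = b1.
  apply: (mulfI D0).
  transitivity (q2 * (a1 * p1 + a2 * p2) - p2 * (a1 * q1 + a2 * q2)); first by ring.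
  by rewrite hap haq; ring.
have e2 : a2 = b2.
  apply: (mulfI D0).
  transitivity (p1 * (a1 * q1 + a2 * q2) - q1 * (a1 * p1 + a2 * p2)); first by ring.
  by rewrite hap haq; ring.
by rewrite -ra -rb e1 e2.
Qed.

Lemma orthogonal_circleP p q :
  normc p = 1 -> normc q = 1 -> p != q -> p + q != 0 ->
  is_orthogonal_circle p q (orthogonal_circle p q).1 (orthogonal_circle p q).2.
Proof.
move=> np nq pq pq'.
suff [a [r h]] : exists a r, is_orthogonal_circle p q a r.
  rewrite /orthogonal_circle; case: xgetP => [ar -> //|/(_ (a, r))].
  by case.
move: np nq pq pq' => /normc_eq1 + /normc_eq1.
case: p q => [p1 p2] [q1 q2].
rewrite [complex.Re _]/= [complex.Im _]/= [complex.Re (Complex q1 _)]/=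
  [complex.Im (Complex q1 _)]/= => hp hq pq pq'.
have D0 := det_neq0 hp hq pq pq'.
set D := _ - _ in D0.
pose a1 := (q2 - p2) / D; pose a2 := (p1 - q1) / D.
have hpa : a1 * p1 + a2 * p2 = 1 by rewrite /a1 /a2 /D; field.
have hqa : a1 * q1 + a2 * q2 = 1 by rewrite /a1 /a2 /D; field.
exists (Complex a1 a2), (normc (Complex p1 p2 - Complex a1 a2)).
have sqp : (p1 - a1) ^+ 2 + (p2 - a2) ^+ 2 = a1 ^+ 2 + a2 ^+ 2 - 1.
  have -> : (p1 - a1) ^+ 2 + (p2 - a2) ^+ 2 = (p1 ^+ 2 + p2 ^+ 2) +
    (a1 ^+ 2 + a2 ^+ 2) - 2 * (a1 * p1 + a2 * p2) by ring.
  by rewrite hp hpa; ring.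
have sqq : (q1 - a1) ^+ 2 + (q2 - a2) ^+ 2 = a1 ^+ 2 + a2 ^+ 2 - 1.
  have -> : (q1 - a1) ^+ 2 + (q2 - a2) ^+ 2 = (q1 ^+ 2 + q2 ^+ 2) +
    (a1 ^+ 2 + a2 ^+ 2) - 2 * (a1 * q1 + a2 * q2) by ring.
  by rewrite hq hqa; ring.
split=> //=.
- rewrite sqrtr_gt0 lt0r addr_ge0 ?sqr_ge0// andbT.
  apply: contra_neq pq => /eqP.
  rewrite paddr_eq0 ?sqr_ge0// !sqrf_eq0 !subr_eq0 => /andP[/eqP e1 /eqP e2].
  have : (p1 - q1) ^+ 2 + (p2 - q2) ^+ 2 == 0.
    apply/eqP; rewrite (_ : _ + _ = (p1 ^+ 2 + p2 ^+ 2) + (q1 ^+ 2 + q2 ^+ 2) -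
      2 * (p1 * q1 + p2 * q2)); last by ring.
    by rewrite hp hq e1 e2 hqa; ring.
  rewrite paddr_eq0 ?sqr_ge0// !sqrf_eq0 !subr_eq0 => /andP[/eqP -> /eqP ->].
  by [].
- by rewrite sqq sqp.
- rewrite mulrN opprK.
  have -> : (p1 - a1) * p1 + (p2 - a2) * p2 = (p1 ^+ 2 + p2 ^+ 2) -
    (a1 * p1 + a2 * p2) by ring.
  by rewrite hp hpa subrr.
- rewrite mulrN opprK.
  have -> : (q1 - a1) * q1 + (q2 - a2) * q2 = (q1 ^+ 2 + q2 ^+ 2) -
    (a1 * q1 + a2 * q2) by ring.
  by rewrite hq hqa subrr.
Qed.

End OrthogonalCircle.

(* Main.v *)
Require Import Defs.
From HB Require Import structures.
From mathcomp Require Import all_boot all_order all_algebra.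
From mathcomp Require Import complex ring lra.
From mathcomp Require Import all_classical all_reals all_analysis.

Set Implicit Arguments.
Unset Strict Implicit.
Unset Printing Implicit Defensive.

Import Order.TTheory GRing.Theory Num.Theory.
Import numFieldNormedType.Exports.

Local Notation normc := Normc.normc.

Local Open Scope classical_set_scope.
Local Open Scope ring_scope.

(** Inversions satisfy the exact formula
    |s x - s y| = r^2 |x - y| / (|x - a| |y - a|),
    so the reflections act on each other's disks as contractions of ratio
    comparable to r_j^2, that is to |z|^(2 k_j), with constants independent of
    z. The limit set of Gamma_z is that of the free product of the g + 1
    reflections, and is coded by the infinite words without repeated letters.
    The transfer matrix with entries x_j for i <> j and 0 on the diagonal has
    eigenvalue 1 exactly when sum_j x_j / (1 + x_j) = 1, with eigenvector
    1 / (1 + x_i); covering by cylinders and distributing mass along cylinders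
    compare the dimension d with the solution of this equation for
    x_j = |z|^(2 d k_j), and the constants, raised to a power d that tends to 0,
    disappear in the limit. For k_j = k (j <= g) the equation for X = |z|^(2 d) is
    the polynomial equation of the statement.

    For the first part, sigma_j sigma_(g+1) is represented by a matrix whose
    entries are entire functions of z (cosines of z^k / 2). Its trace does not
    vanish at 0 and its determinant is sin^2 sin^2, so eigenvalues and fixed
    points are holomorphic near 0. The attracting points tend to c_i, while all
    repelling points tend to c_(g+1), with differences of order exactly
    2 k_(g+1), smaller than the order 2 k_i + 2 k_(g+1) of the multiplier. *)

(** * Hausdorff measure and reduced words *)

(** No measure on the limit set is constructed. The lower bound only needs that cylinders of small
    total weight cannot cover all infinite reduced words, and this follows by descending the tree of
    words greedily, guided by a set function that is subadditive over children. Nor is the dimension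
    at a fixed [z] ever computed: a ratio [C |z|^(2 k_j)] raised to the power [d] is compared with
    [u^(k_j)], and [C^d] tends to 1 because [d] has the size of [1 / log |1/z|]. [Gamma_z] consists
    of the words of even length in the reflections; hence the upper bound may allow all words, while
    the lower bound must approach each coded point along even words only.

    In the first part the matrix is not scaled to determinant 1, since dividing by the sines would
    create a pole at 0. The delicate point is the collision of the repelling points: the order of
    their differences must be known exactly, because they stand in denominators of cross-ratios.
    Therefore the repelling point is written with the factor [sin^2] of index [g + 1] split off. *)

Section HausdorffFacts.
Context (R : realType) (T : Type) (dist : T -> T -> R).
Implicit Types (d : R) (E U : set T).
Local Notation diameter := (diameter dist).

Lemma le_diameter U x y : U x -> U y -> ((dist x y)%:E <= diameter U)%E.
Proof. by move=> Ux Uy; apply: ereal_sup_ubound; right; exists (x, y). Qed.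

Lemma diameter_le U (K : R) : 0 <= K -> (forall x y, U x -> U y -> dist x y <= K) ->
  (diameter U <= K%:E)%E.
Proof.
move=> K0 UK; apply: ge_ereal_sup => _ [->|[[x y] /= [Ux Uy] <-]].
  by rewrite lee_fin.
by rewrite lee_fin UK.
Qed.

Lemma diameter_ge0 U : (0 <= diameter U)%E.
Proof. by apply: ereal_sup_ubound; left. Qed.

Lemma diameter_set0 : diameter set0 = 0%E.
Proof.
by apply/eqP; rewrite eq_le diameter_ge0 andbT; apply: diameter_le.
Qed.

(** Finite covers suffice: they are padded to sequences with the empty set, whose diameter is 0 and
    contributes [0^d = 0] because [d > 0]. *)
Lemma hausdorff_measure_eq0 (J : choiceType) (C : J -> set T) E d : 0 < d ->
  (forall eps : R, 0 < eps -> exists s : seq J,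
     [/\ forall x, E x -> exists2 w, w \in s & C w x,
         forall w, w \in s -> (diameter (C w) <= eps%:E)%E &
         (\sum_(w <- s) poweR (diameter (C w)) d <= eps%:E)%E]) ->
  hausdorff_measure dist d E = 0%E.
Proof.
move=> d0 H; apply/eqP; rewrite eq_le; apply/andP; split; last first.
  apply: (@le_trans _ _ (hausdorff_content dist d 1 E)); last first.
    by apply: ereal_sup_ubound; exists 1; rewrite //= ltr01.
  apply: le_ereal_inf_tmp => _ [V _ <-].
  by apply: nneseries_ge0 => n _ _; exact: poweR_ge0.
apply: ge_ereal_sup => _ [delta /= delta0 <-].
apply/lee_addgt0Pr => e e0; rewrite add0e.
pose eps := Num.min delta e.
have eps0 : 0 < eps by rewrite lt_min delta0.
have [s [sE sd ss]] := H _ eps0.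
case: s => [|w0 s] in sE sd ss *.
  apply: (@le_trans _ _ 0%E); last by rewrite lee_fin ltW.
  apply: ereal_inf_lbound => /=; exists (fun=> set0).
    split => [x /sE []//|_]; by rewrite diameter_set0 lee_fin ltW.
  by rewrite eseries0// => i _ _; rewrite diameter_set0 poweR0r// gt_eqF.
set t := w0 :: s in sE sd ss.
pose V n := if (n < size t)%N then C (nth w0 t n) else set0.
apply: (@le_trans _ _ (\sum_(0 <= n <oo) poweR (diameter (V n)) d)%E).
  apply: ereal_inf_lbound; exists V => //; split.
    move=> x /sE [w wt Cx]; exists (index w t) => //.
    by rewrite /V index_mem wt nth_index.
  move=> n; rewrite /V; case: ifP => nt.
    by rewrite (le_trans (sd _ (mem_nth _ nt)))// lee_fin ge_min lexx.
  by rewrite diameter_set0 lee_fin ltW.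
rewrite (nneseries_split_cond 0 (size t)); last by move=> *; exact: poweR_ge0.
rewrite add0n eseries0 ?adde0; last first.
  by move=> i ti _; rewrite /V ltnNge ti/= diameter_set0 poweR0r// gt_eqF.
rewrite (@le_trans _ _ eps%:E)//; last by rewrite lee_fin ge_min lexx orbT.
apply: le_trans ss; rewrite (big_nth w0) le_eqVlt; apply/orP; left; apply/eqP.
by apply: eq_big_nat => i /andP[_ it]; rewrite /V it.
Qed.

Lemma hausdorff_measure_neq0 E d (K : R) : 0 < K ->
  (forall V : nat -> set T, E `<=` \bigcup_n V n ->
     (K%:E <= \sum_(0 <= n <oo) poweR (diameter (V n)) d)%E) ->
  hausdorff_measure dist d E <> 0%E.
Proof.
move=> K0 H E0; have : (K%:E <= hausdorff_measure dist d E)%E.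
  apply: (@le_trans _ _ (hausdorff_content dist d 1 E)); last first.
    by apply: ereal_sup_ubound; exists 1; rewrite //= ltr01.
  by apply: le_ereal_inf_tmp => _ [V [VE _] <-]; exact: H.
by rewrite E0 lee_fin leNgt K0.
Qed.

Lemma hausdorff_dim_le E d : 0 < d -> hausdorff_measure dist d E = 0%E ->
  (hausdorff_dim dist E <= d%:E)%E.
Proof. by move=> d0 Ed; apply: ereal_inf_lbound; exists d. Qed.

Lemma hausdorff_dim_ge E (d0 : R) :
  (forall d, 0 < d -> d < d0 -> hausdorff_measure dist d E <> 0%E) ->
  (d0%:E <= hausdorff_dim dist E)%E.
Proof.
move=> H; apply: le_ereal_inf_tmp => _ [d /= [dp Ed] <-].
by rewrite lee_fin leNgt; apply/negP => /(H _ dp).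
Qed.

End HausdorffFacts.

(** * Weighted sums over reduced words *)

Section ReducedWords.
Context (R : realType) (I : finType).
Implicit Types (i j : I) (w : seq I) (x : I -> R).

Definition reduced_seq (u : nat -> I) := forall n, u n != u n.+1.

(** Here [n] counts the letters after the initial [i], so these words have length [n + 1]; the same
    shift holds for [reduced_words]. *)
Fixpoint words_from n i : seq (seq I) :=
  if n is m.+1 then [seq i :: w | j <- [seq j <- enum I | j != i], w <- words_from m j]
  else [:: [:: i]].

Definition reduced_words n := [seq w | i <- enum I, w <- words_from n i].

Lemma mem_words_from n i j w : j != i -> w \in words_from n j ->
  i :: w \in words_from n.+1 i.
Proof.
move=> ji wj /=; apply/allpairsPdep; exists j, w; split => //.
by rewrite mem_filter ji mem_enum.
Qed.

Lemma words_fromP n i w : w \in words_from n i ->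
  exists w', [/\ w = i :: w', path (fun i j => i != j) i w' & size w' = n].
Proof.
elim: n i w => [|n IH] i w /=; first by rewrite inE => /eqP ->; exists [::].
move=> /allpairsPdep[j [v [+ /IH[v' [vE pv sv]] ->]]].
rewrite mem_filter => /andP[ji _]; exists v; split => //; last by rewrite vE /= sv.
by rewrite vE /= eq_sym ji.
Qed.

Definition wt x w := \prod_(i <- w) x i.

Lemma wt_gt0 x w : (forall i, 0 < x i) -> 0 < wt x w.
Proof. by move=> x0; apply: prodr_gt0. Qed.

Definition fraction_sum x := \sum_i x i / (1 + x i).

(** With [T] for the fraction sum, the vector [x_i / (1 + x_i)] is a supersolution of factor [T]:
    the inequality [T - x_i / (1 + x_i) <= T / (1 + x_i)] is equivalent to [T <= 1]. The constant in
    front serves the base case, where it must dominate [1 + x_i]. *)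
Lemma sum_words_from x n i : (forall i, 0 < x i) -> fraction_sum x <= 1 ->
  \sum_(w <- words_from n i) wt x w <=
    (1 + fraction_sum x + \sum_i x i) * fraction_sum x ^+ n * (x i / (1 + x i)).
Proof.
move=> x0 T1; set T := fraction_sum x.
have x1 j : 0 < 1 + x j by rewrite addr_gt0.
have T0 : 0 <= T by apply: sumr_ge0 => j _; rewrite divr_ge0// ltW.
have xS : 0 <= \sum_i x i by apply: sumr_ge0 => j _; exact/ltW.
set K := 1 + T + _.
have K0 : 0 <= K by rewrite !addr_ge0.
elim: n i => [|n IH] i.
  rewrite big_seq1 /wt big_seq1 expr0 mulr1 mulrA ler_pdivlMr// mulrC.
  rewrite ler_wpM2r ?(ltW (x0 i))// /K -addrA lerD2l (bigD1 i)//= addrCA lerDl.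
  by rewrite addr_ge0// sumr_ge0// => j _; exact/ltW.
rewrite big_allpairs_dep/= big_filter big_enum_cond/=.
under eq_bigr do [under eq_bigr do rewrite /wt big_cons; rewrite -mulr_sumr].
rewrite -mulr_sumr.
apply: (@le_trans _ _ (x i * \sum_(j | j != i) K * T ^+ n * (x j / (1 + x j)))).
  by rewrite ler_wpM2l ?(ltW (x0 i))// ler_sum// => j _; exact: IH.
have c0 : 0 <= K * T ^+ n by rewrite mulr_ge0// exprn_ge0.
rewrite -mulr_sumr exprSr [K * (_ * _)]mulrA mulrCA -[leRHS]mulrA ler_wpM2l//.
have -> : \sum_(j | j != i) x j / (1 + x j) = T - x i / (1 + x i).
  by rewrite /T /fraction_sum [X in X - _](bigD1 i)//= addrAC subrr add0r.
rewrite [leRHS]mulrCA ler_wpM2l ?(ltW (x0 i))// ler_pdivlMr//.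
rewrite mulrBl divfK ?gt_eqF// mulrDr mulr1 lerBlDr lerD2l.
by rewrite ler_piMl// ltW.
Qed.

Lemma sum_reduced_words x n : (forall i, 0 < x i) -> fraction_sum x <= 1 ->
  \sum_(w <- reduced_words n) wt x w <=
    (1 + fraction_sum x + \sum_i x i) * fraction_sum x ^+ n.+1.
Proof.
move=> x0 T1; rewrite big_allpairs_dep/= big_enum/= exprSr mulrA.
rewrite {3}/fraction_sum mulr_sumr ler_sum// => i _; exact: sum_words_from.
Qed.

End ReducedWords.

(** * Mass distribution on the tree of words *)

Section AvoidCylinders.
Context (R : realType) (I : finType) (x : I -> R).
Hypotheses (x0 : forall i, 0 < x i) (T1 : 1 <= fraction_sum x).

Let x1 j : 0 < 1 + x j. Proof. by rewrite addr_gt0. Qed.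

(* The mass of the cylinder of the word [rev w]; the denominators make it
   subadditive over the children of a cylinder. *)
Let mass (w : seq I) : R := wt x w * (if w is i :: _ then (1 + x i)^-1 else 1).

Let admits (w : seq I) (i : I) : bool := if w is j :: _ then i != j else true.

Let mass_ge0 w : 0 <= mass w.
Proof.
rewrite /mass mulr_ge0 ?(ltW (wt_gt0 _ _))//.
by case: w => // i w; rewrite invr_ge0 ltW.
Qed.

Let mass_le w : mass w <= wt x w.
Proof.
rewrite /mass ler_piMr ?(ltW (wt_gt0 _ _))//; case: w => // i w.
by rewrite invf_le1// lerDl ltW.
Qed.

(** With [T >= 1] the reverse inequality holds: [T - x_j / (1 + x_j) >= 1 / (1 + x_j)]. At the root
    the claim is [1 <= T] itself. *)
Let mass_children w : mass w <= \sum_(i | admits w i) mass (i :: w).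
Proof.
case: w => [|j w].
  rewrite /mass /wt big_nil mul1r; apply: (le_trans T1).
  by rewrite le_eqVlt; apply/orP; left; apply/eqP/eq_bigr => i _; rewrite big_seq1.
have -> : \sum_(i | admits (j :: w) i) mass (i :: j :: w) =
          wt x (j :: w) * \sum_(i | i != j) x i / (1 + x i).
  rewrite mulr_sumr; apply: eq_bigr => i _.
  by rewrite /mass {1}/wt big_cons -/(wt x (j :: w)) mulrAC mulrC mulrA.
rewrite ler_wpM2l ?(ltW (wt_gt0 _ _))//.
have -> : \sum_(i | i != j) x i / (1 + x i) = fraction_sum x - x j / (1 + x j).
  by rewrite /fraction_sum [X in X - _](bigD1 j)//= addrAC subrr add0r.
rewrite lerBrDr (le_trans _ T1)// -[X in X + _]mul1r -mulrDl divff ?gt_eqF//.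
Qed.

(** A substitute for a mass distribution measure. The invariant [P w] says that the forbidden words
    extending the current one have total mass below its own mass; by subadditivity some admissible
    child inherits it. Words are stored reversed, so that extending is consing. *)
Lemma avoid_cylinders (s : nat -> seq I) :
  (\sum_(0 <= n <oo) (wt x (s n))%:E < 1)%E ->
  exists u, reduced_seq u /\ forall n m, s n <> mkseq u m.
Proof.
move=> sw.
pose a w n : \bar R := if suffix w (rev (s n)) then (mass (rev (s n)))%:E else 0%E.
have a0 w n : (0 <= a w n)%E by rewrite /a; case: ifP => //; rewrite lee_fin mass_ge0.
pose P w := (\sum_(0 <= n <oo) a w n < (mass w)%:E)%E.
have P0 : P [::].
  rewrite /P /mass /wt big_nil mulr1; apply: le_lt_trans sw.
  apply: lee_nneseries => [n _ _|n _]; first exact: a0.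
  rewrite /a suffix0s lee_fin (le_trans (mass_le _))//.
  by rewrite /wt (perm_big (s n))//= perm_rev.
have step w : P w -> exists i, admits w i /\ P (i :: w).
  move=> Pw; apply: contrapT => /forallNP Q.
  have {}Q i : admits w i -> ((mass (i :: w))%:E <= \sum_(0 <= n <oo) a (i :: w) n)%E.
    by move=> wi; rewrite leNgt; apply/negP => ?; apply: (Q i).
  move: Pw; apply/negP; rewrite -leNgt.
  apply: (@le_trans _ _ (\sum_(i | admits w i) mass (i :: w))%:E).
    by rewrite lee_fin mass_children.
  rewrite -sumEFin; apply: (le_trans (lee_sum _ Q)).
  rewrite -nneseries_sum//; apply: lee_nneseries => [n _ _|n _].
    exact: sume_ge0.
  (* A given forbidden word lies under at most one child, so summing over the children counts it at
     most once. *)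
  have [[i0 si]|Ns] := pselect (exists i, suffix (i :: w) (rev (s n))); last first.
    rewrite big1// => i _; rewrite /a ifF//; apply/negP => si.
    by apply: Ns; exists i.
  have sE i : suffix (i :: w) (rev (s n)) = (i == i0).
    apply/idP/eqP => [si'|-> //].
    move/suffixP: si => [t1 e1]; move/suffixP: si' => [t2].
    rewrite e1 => /(congr1 rev); rewrite !rev_cat !rev_cons.
    rewrite -!cats1 -!catA /= => /eqP.
    by rewrite eqseq_cat// eqxx/= eqseq_cons => /andP[/eqP].
  have sw' : suffix w (rev (s n)).
    exact: suffix_trans (suffix_cons _ _) si.
  rewrite (@le_trans _ _ (\sum_(i | i == i0) (mass (rev (s n)))%:E)%E)//.
    rewrite big_mkcond [leRHS]big_mkcond/= lee_sum// => i _.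
    by rewrite /a sE; case: (i == i0) => //; case: (admits w i) => //;
      rewrite lee_fin.
  by rewrite (big_pred1 i0)// /a sw'.
have [f Pf] : {f : seq I -> I & forall w, P w -> admits w (f w) /\ P (f w :: w)}.
  have /choice[f Hf] : forall w, exists i, P w -> admits w i /\ P (i :: w).
    move=> w; have [/step[i ?]|NP] := pselect (P w); first by exists i.
    by have [i _] := step _ P0; exists i => Pw; case: (NP Pw).
  by exists f.
pose W := fix W n := if n is m.+1 then f (W m) :: W m else [::].
pose u n := f (W n).
have PW n : P (W n) by elim: n => //= n /Pf[].
have WE n : W n = rev (mkseq u n).
  by elim: n => //= n IH; rewrite mkseqS rev_rcons -IH.
exists u; split=> [n|n m snE].
  by have [] := Pf _ (PW n.+1); rewrite /= eq_sym.
(* If [s n] were a prefix of [u], its own term in the sum of [P (W m)] would already equal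
   [mass (W m)]. *)
have := PW m; rewrite /P; apply/negP; rewrite -leNgt.
apply: (@le_trans _ _ (a (W m) n)); first by rewrite /a WE -snE suffix_refl.
apply: (le_trans _ (@nneseries_lim_ge _ _ xpredT 0 n.+1 _)) => [|//].
by rewrite big_nat_recr//= leeDr// sume_ge0.
Qed.

End AvoidCylinders.

(** * Hausdorff measure of symbolically coded sets *)

Section SymbolicBounds.
Context (R : realType) (T : Type) (dist : T -> T -> R) (I : finType).

Lemma geometric_small (a z e : R) : 0 <= z < 1 -> 0 < e ->
  \forall n \near \oo, a * z ^+ n <= e.
Proof.
move=> /andP[z0 z1] e0.
have : geometric a z x @[x --> \oo] --> 0 by apply: cvg_geometric; rewrite ger0_norm.
move/cvgrPdist_le => /(_ _ e0); apply: filterS => n /=.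
by rewrite sub0r normrN; apply: le_trans; rewrite ler_norm.
Qed.

Lemma wt_le_expr (x : I -> R) (M : R) w : (forall i, 0 < x i) -> (forall i, x i <= M) ->
  wt x w <= M ^+ size w.
Proof.
move=> x0 xM; elim: w => [|i w IH]; first by rewrite /wt big_nil.
rewrite /wt big_cons exprS ler_pM// ?(ltW (x0 i))//.
exact: (ltW (wt_gt0 w x0)).
Qed.

Lemma uniform_bound (x : I -> R) : (forall i, x i < 1) ->
  exists M, 0 <= M < 1 /\ forall i, x i <= M.
Proof.
move=> x1; exists (\big[Num.max/0]_i x i); split; last by move=> i; exact: le_bigmax.
by rewrite bigmax_ge_id/=; apply/bigmax_ltP; split=> // i _.
Qed.

Lemma wt_powR (x : I -> R) d w : (forall i, 0 < x i) ->
  wt (fun i => x i `^ d) w = wt x w `^ d.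
Proof.
move=> x0; elim: w => [|i w IH]; first by rewrite /wt !big_nil powR1.
rewrite /wt !big_cons powRM ?(ltW (x0 i))//; last exact: (ltW (wt_gt0 w x0)).
by congr *%R; exact: IH.
Qed.

Lemma le_poweR (x y : \bar R) (d : R) : 0 <= d -> (0 <= x)%E -> (x <= y)%E ->
  (poweR x d <= poweR y d)%E.
Proof.
move=> d0 x0 xy; apply: gt0_ler_poweR => //; rewrite in_itv/= leey andbT//.
exact: le_trans xy.
Qed.

Lemma powR_lt1 (x d : R) : 0 < x < 1 -> 0 < d -> x `^ d < 1.
Proof.
move=> /andP[x0 x1] d0; have <- : 1 `^ d = 1 by rewrite powR1.
by rewrite gt0_ltr_powR// ?nnegrE ?ltW.
Qed.

(** The covers by words of length [n + 1] have mesh at most [K M^(n+1)], where [M < 1] bounds all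
    [L i], and a [d]-sum that decays geometrically by [sum_reduced_words]. *)
Lemma hausdorff_measure_cover_eq0 (C : seq I -> set T) (L : I -> R) (K d : R) E :
  0 < K -> 0 < d -> (forall i, 0 < L i < 1) ->
  fraction_sum (fun i => L i `^ d) < 1 ->
  (forall n x, E x -> exists2 w, w \in reduced_words I n & C w x) ->
  (forall n w, w \in reduced_words I n ->
     (diameter dist (C w) <= (K * wt L w)%:E)%E) ->
  hausdorff_measure dist d E = 0%E.
Proof.
move=> K0 d0 L01 T1 EC Cd.
have L0 i : 0 < L i by case/andP: (L01 i).
have Ld0 i : 0 < L i `^ d by rewrite powR_gt0.
have [M [M01 LM]] := @uniform_bound L (fun i => proj2 (andP (L01 i))).
have T0 : 0 <= fraction_sum (fun i => L i `^ d).
  by apply: sumr_ge0 => i _; rewrite divr_ge0 ?addr_ge0 ?(ltW (Ld0 i)).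
apply: (hausdorff_measure_eq0 (C := C)) => // e e0.
pose D := K `^ d * (1 + fraction_sum (fun i => L i `^ d) + \sum_i L i `^ d).
have [n [Kn Dn]] : exists n, K * M ^+ n.+1 <= e /\
    D * fraction_sum (fun i => L i `^ d) ^+ n.+1 <= e.
  have := filterI (@geometric_small K M e M01 e0)
    (@geometric_small D _ e (introT andP (conj T0 T1)) e0).
  move=> [N _ HN]; exists N; by have [] := HN N.+1 (leqnSn N).
exists (reduced_words I n); split.
- exact: EC.
- move=> w wn; apply: (le_trans (Cd _ _ wn)); rewrite lee_fin (le_trans _ Kn)//.
  rewrite ler_wpM2l ?(ltW K0)//; move/allpairsPdep: wn => [i [v [_ vi ->]]].
  have [w' [-> _ sw']] := words_fromP vi.
  by apply: (le_trans (wt_le_expr _ L0 LM)); rewrite /= sw'.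
- apply: (@le_trans _ _ (\sum_(w <- reduced_words I n) (K `^ d * wt (fun i => L i `^ d) w)%:E)%E).
    rewrite big_seq [leRHS]big_seq lee_sum// => w wn; rewrite wt_powR//.
    rewrite -powRM ?(ltW K0) ?(ltW (wt_gt0 w L0))//.
    rewrite -poweR_EFin; apply: le_poweR; rewrite ?(ltW d0)//.
    + exact: diameter_ge0.
    + exact: Cd wn.
  rewrite sumEFin lee_fin -mulr_sumr (le_trans _ Dn)// /D -mulrA.
  rewrite ler_wpM2l ?powR_ge0// sum_reduced_words// ltW//.
Qed.

(** Each set of a cover is replaced by one cylinder that contains all its coded points and whose
    weight is controlled by its diameter. If the [d]-sum is too small, [avoid_cylinders] yields a
    coded point outside the cover. *)
Lemma hausdorff_measure_code_neq0 (code : (nat -> I) -> T) (l : I -> R) (c d : R) E :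
  0 < c -> 0 < d -> (forall i, 0 < l i < 1) ->
  1 <= fraction_sum (fun i => l i `^ d) ->
  (forall u v n, reduced_seq u -> reduced_seq v ->
     (forall m, (m < n)%N -> u m = v m) -> u n != v n ->
     c * wt l (mkseq u n) <= dist (code u) (code v)) ->
  (forall u, reduced_seq u -> E (code u)) ->
  hausdorff_measure dist d E <> 0%E.
Proof.
move=> c0 d0 l01 T1 sep codeE.
have l0 i : 0 < l i by case/andP: (l01 i).
pose x i := l i `^ d.
have x0 i : 0 < x i by rewrite powR_gt0.
have [M [M01 xM]] := @uniform_bound x (fun i => powR_lt1 (l01 i) d0).
have [i0 _] : exists i0 : I, true.
  apply: contrapT => NI; move: T1; rewrite /fraction_sum big1 ?ler10// => i _.
  by exfalso; apply: NI; exists i.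
have cd0 : 0 < c `^ d by rewrite powR_gt0.
(* The word is the longest common prefix of the codes in [V]: where two codes diverge, separation
   bounds its weight by the diameter. If no divergence occurs, a prefix long enough to weigh at most
   [e] is taken. *)
have key (V : set T) (e : R) : 0 < e -> exists w : seq I,
    ((wt x w)%:E <= (c `^ d)^-1%:E * poweR (diameter dist V) d + e%:E)%E /\
    forall u, reduced_seq u -> V (code u) -> w = mkseq u (size w).
  move=> e0; have dV0 := diameter_ge0 dist V.
  have dVd : (0 <= (c `^ d)^-1%:E * poweR (diameter dist V) d)%E.
    by rewrite mule_ge0 ?poweR_ge0// lee_fin invr_ge0 ltW.
  apply: contrapT => /forallNP N.
  have common m : exists w : seq I, size w = m /\
      forall u, reduced_seq u -> V (code u) -> w = mkseq u m.
    elim: m => [|m [w [sw wu]]]; first by exists [::].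
    have [[u0 [u0r Vu0]]|NV] := pselect (exists u, reduced_seq u /\ V (code u)); last first.
      (* [V] contains no coded point here, so any word of the right length serves. *)
      exists (nseq m.+1 i0); rewrite size_nseq; split => // u ur Vu.
      by exfalso; apply: NV; exists u.
    have [H|] := pselect (forall v, reduced_seq v -> V (code v) -> v m = u0 m).
      exists (rcons w (u0 m)); rewrite size_rcons sw; split => // v vr Vv.
      by rewrite mkseqS -(wu v)// H.
    move=> /existsNP[v /not_implyP[vr /not_implyP[Vv vu0]]]; exfalso.
    apply: (N w); split; last by rewrite sw.
    apply: (@le_trans _ _ ((c `^ d)^-1%:E * poweR (diameter dist V) d)%E); last first.
      by rewrite leeDl// lee_fin ltW.
    rewrite muleC lee_pdivlMr// /x wt_powR// -EFinM -powRM ?(ltW c0) ?(ltW (wt_gt0 w l0))//.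
    rewrite -poweR_EFin; apply: le_poweR; rewrite ?(ltW d0)//.
    + by rewrite lee_fin mulr_ge0 ?(ltW c0)// (ltW (wt_gt0 w l0)).
    apply: le_trans (le_diameter dist Vu0 Vv); rewrite lee_fin mulrC (wu _ u0r Vu0).
    apply: sep => //; last by rewrite eq_sym; apply/eqP.
    move=> k km; have := wu _ vr Vv; rewrite (wu _ u0r Vu0).
    by move=> /(congr1 (fun s => nth i0 s k)); rewrite !nth_mkseq.
  have [n Mn] : exists n, 1 * M ^+ n <= e.
    by have [n _ Hn] := @geometric_small 1 M e M01 e0; exists n; apply: Hn => /=.
  have [w [sw wu]] := common n; apply: (N w); split; last by rewrite sw.
  apply: (@le_trans _ _ e%:E); last by rewrite leeDr.
  by rewrite lee_fin (le_trans _ Mn)// mul1r -sw wt_le_expr.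
(* With this constant the main terms contribute at most 1/4, and the errors [4^-1 / 2^(n+1)] sum to
   another 1/4, so the total weight stays below 1. *)
apply: (@hausdorff_measure_neq0 _ _ _ _ _ (c `^ d / 4)); first by rewrite divr_gt0.
move=> V EV; rewrite leNgt; apply/negP => VK.
have /choice[s Hs] : forall n, exists w : seq I,
    ((wt x w)%:E <= (c `^ d)^-1%:E * poweR (diameter dist (V n)) d
       + (4^-1 / (2 ^ n.+1)%:R)%:E)%E /\
    forall u, reduced_seq u -> V n (code u) -> w = mkseq u (size w).
  by move=> n; apply: key; rewrite divr_gt0// ltr0n expn_gt0.
have [|u [ur us]] := @avoid_cylinders R I x x0 T1 s.
  have A0 n : (0 <= (c `^ d)^-1%:E * poweR (diameter dist (V n)) d)%E.
    by rewrite mule_ge0 ?poweR_ge0// lee_fin invr_ge0 ltW.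
  apply: (@le_lt_trans _ _ (\sum_(0 <= n <oo) ((c `^ d)^-1%:E * poweR (diameter dist (V n)) d
       + (4^-1 / (2 ^ n.+1)%:R)%:E))%E).
    apply: lee_nneseries => [n _ _|n _]; last by have [] := Hs n.
    by rewrite lee_fin (ltW (wt_gt0 _ x0)).
  apply: (le_lt_trans (epsilon_trick _ A0 _)) => //.
  rewrite nneseriesZl; last by move=> *; exact: poweR_ge0.
  apply: (@le_lt_trans _ _ (4^-1 + 4^-1)%:E); last by rewrite lte_fin; lra.
  rewrite EFinD leeD2r// muleC lee_pdivrMr// -EFinM mulrC ltW//.
have [n _ Vn] := EV _ (codeE _ ur).
by have [_ /(_ _ ur Vn)] := Hs n; exact: us.
Qed.

End SymbolicBounds.

(** * Elementary estimates *)

Section RealBounds.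
Context (R : realType).
Implicit Types (x y t q : R).

(* Iterating this mean value estimate gives all the Taylor bounds below. *)
Lemma MVT_bound (f df : R -> R) (K r : R) n x :
  (forall y, is_derive y 1 f (df y)) -> f 0 = 0 -> 0 <= K ->
  (forall y, `|y| <= r -> `|df y| <= K * `|y| ^+ n) ->
  `|x| <= r -> `|f x| <= K * `|x| ^+ n.+1.
Proof.
move=> dfE f0 K0 Kdf xr.
have cf a b : {within `[a, b], continuous f}.
  apply: derivable_within_continuous => y _; exact: (@ex_derive _ _ _ _ _ _ _ (dfE y)).
have key c : `|c| <= `|x| -> `|df c * x| <= K * `|x| ^+ n.+1.
  move=> cx; rewrite normrM exprSr mulrA ler_wpM2r//.
  rewrite (le_trans (Kdf _ (le_trans cx xr)))// ler_wpM2l//.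
  by apply: lerXn2r; rewrite ?nnegrE.
have [x0|x0|->] := ltrgtP x 0; last by rewrite f0 normr0 mulr_ge0// exprn_ge0.
- have [c] := MVT x0 (fun y _ => dfE y) (cf _ _).
  rewrite in_itv/= f0 sub0r => /andP[xc c0] /(congr1 Num.norm).
  rewrite normrN sub0r mulrN normrN => ->; apply: key.
  by rewrite !ltr0_norm// lerN2 ltW.
- have [c] := MVT x0 (fun y _ => dfE y) (cf _ _).
  rewrite in_itv/= f0 !subr0 => /andP[c0 cx] ->; apply: key.
  by rewrite !gtr0_norm// ltW.
Qed.

Lemma norm_sin_le x : `|sin x| <= `|x|.
Proof.
rewrite -[leRHS]expr1 -[leRHS]mul1r.
apply: (MVT_bound (df := cos) (r := `|x|)) => // [|y _]; first exact: sin0.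
by rewrite expr0 mulr1 ler_norml cos_geN1 cos_le1.
Qed.

Lemma cos_sub1_le x : `|cos x - 1| <= x ^+ 2.
Proof.
rewrite -real_normK ?num_real// -[leRHS]mul1r.
apply: (MVT_bound (f := fun x => cos x - 1) (df := fun x => - sin x) (r := `|x|)) => // [y||y _].
- by apply: is_derive_eq; rewrite subr0.
- by rewrite cos0 subrr.
- by rewrite normrN mul1r expr1 norm_sin_le.
Qed.

Lemma sin_subid_le x : `|sin x - x| <= `|x| ^+ 3.
Proof.
rewrite -[leRHS]mul1r.
apply: (MVT_bound (f := fun x => sin x - x) (df := fun x => cos x - 1) (r := `|x|)) => // [|y _].
- by rewrite sin0 subrr.
- by rewrite mul1r real_normK ?num_real// cos_sub1_le.
Qed.

Lemma cos_sub2_le x : `|cos x - 1 + x ^+ 2 / 2| <= `|x| ^+ 4.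
Proof.
rewrite -[leRHS]mul1r.
apply: (MVT_bound (f := fun x => cos x - 1 + x ^+ 2 / 2) (df := fun x => x - sin x)
  (r := `|x|)) => // [y||y _].
- apply: is_derive_eq; rewrite /GRing.scale /=. lra.
- by rewrite cos0 subrr expr0n/= mul0r addr0.
- by rewrite mul1r distrC sin_subid_le.
Qed.

(** From [expR (-1/2) >= 1/2] comes [expR (1/2) <= 2], and squaring bounds [expR 1] by 4. *)
Lemma expR_norm_le x : `|x| <= 1 -> `|expR x| <= 4.
Proof.
move=> /ler_normlP[_ x1]; rewrite ger0_norm ?expR_ge0//.
have e1 : expR (1/2) <= 2 :> R.
  have := expR_ge1Dx (- (1/2) : R); rewrite expRN => h.
  rewrite -[leLHS]invrK -[leRHS]invrK lef_pV2 ?posrE ?invr_gt0 ?expR_gt0//.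
  by apply: le_trans h; lra.
rewrite (@le_trans _ _ (expR 1))// ?ler_expR//.
have -> : (1 : R) = 1/2 + 1/2 by lra.
have e0 := expR_gt0 (1/2 : R).
by rewrite expRD; nra.
Qed.

Lemma expR_sub1_le x : `|x| <= 1 -> `|expR x - 1| <= 4 * `|x|.
Proof.
rewrite -[X in 4 * X]expr1.
apply: (MVT_bound (f := fun x => expR x - 1) (df := expR)) => // [y||y].
- by apply: is_derive_eq; rewrite subr0.
- by rewrite expR0 subrr.
- by rewrite expr0 mulr1; exact: expR_norm_le.
Qed.

Lemma expR_sub2_le x : `|x| <= 1 -> `|expR x - 1 - x| <= 4 * `|x| ^+ 2.
Proof.
apply: (MVT_bound (f := fun x => expR x - 1 - x) (df := fun x => expR x - 1)) => // [y||y].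
- by apply: is_derive_eq; rewrite subr0.
- by rewrite expR0 !subrr.
- by rewrite expr1; exact: expR_sub1_le.
Qed.

Lemma expR_sub3_le x : `|x| <= 1 -> `|expR x - 1 - x - x ^+ 2 / 2| <= 4 * `|x| ^+ 3.
Proof.
apply: (MVT_bound (f := fun x => expR x - 1 - x - x ^+ 2 / 2)
  (df := fun x => expR x - 1 - x)) => // [y||y].
- apply: is_derive_eq; rewrite /GRing.scale /=. lra.
- by rewrite expR0 !subrr expr0n/= mul0r subr0.
- exact: expR_sub2_le.
Qed.

Lemma sin_ge x : 0 <= x <= 2^-1 -> x / 2 <= sin x.
Proof.
move=> /andP[x0 x1]; have /ler_normlP[+ _] := sin_subid_le x.
rewrite ger0_norm// => h.
have x2 : x ^+ 2 <= 2^-1 by nra.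
have : x ^+ 3 <= x / 2 by rewrite exprS ler_wpM2l.
by move: h; set s := sin x; set c := x ^+ 3; lra.
Qed.

(** If [asin q <= 1/2], then [sin_ge] gives [asin q <= 2 q]. Otherwise [q >= sin (1/2) >= 1/4],
    while [asin q <= pi/2 < 2]; hence the constant 8. *)
Lemma asin_bounds q : 0 <= q <= 1 -> q <= asin q <= 8 * q.
Proof.
move=> /andP[q0 q1].
have q1' : -1 <= q <= 1 by rewrite q1 andbT; lra.
have [/andP[a1 a2] sE] := asin_def q1'.
have pi2 := @pihalf_lt2 R; have pi1 := @pihalf_ge1 R.
have a0 : 0 <= asin q.
  rewrite leNgt; apply/negP => an.
  suff : sin (asin q) < sin 0 by rewrite sE sin0 ltNge q0.
  rewrite ltr_sin ?in_itv/= ?a1 ?a2//; apply/andP; split; lra.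
apply/andP; split.
  by rewrite -{1}sE (le_trans (ler_norm _))// (le_trans (norm_sin_le _))// ger0_norm.
have [small|big] := leP (asin q) 2^-1.
  by have := @sin_ge (asin q); rewrite a0 small sE => /(_ isT); lra.
have : sin 2^-1 <= sin (asin q).
  rewrite leNgt; apply/negP; rewrite ltr_sin ?in_itv/= ?a1 ?a2//.
    by rewrite ltNge ltW.
  by apply/andP; split; lra.
have := @sin_ge 2^-1; rewrite invr_ge0 ler0n lexx => /(_ isT).
by rewrite sE; lra.
Qed.

End RealBounds.

(** * The complex modulus as a real number *)

Section ComplexModulus.
Context (R : realType).
Local Notation C := R[i].
Implicit Types (z w : C).

Lemma norm_normc z : `|z| = real_complex R (normc z). Proof. by []. Qed.

Lemma normc_ge0 z : 0 <= normc z.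
Proof. by case: z => a b; exact: sqrtr_ge0. Qed.

Lemma normc_sq z : normc z ^+ 2 = complex.Re z ^+ 2 + complex.Im z ^+ 2.
Proof. by case: z => a b /=; rewrite sqr_sqrtr// addr_ge0 ?sqr_ge0. Qed.

Lemma normc_eq0 z : (normc z == 0) = (z == 0).
Proof.
apply/eqP/eqP => [/Normc.eq0_normc//|->]; exact: Normc.normc0.
Qed.

Lemma normc_gt0 z : (0 < normc z) = (z != 0).
Proof. by rewrite lt0r normc_ge0 andbT normc_eq0. Qed.

Lemma normc_real (x : R) : normc (real_complex R x) = `|x|.
Proof. by rewrite /= expr0n/= addr0 sqrtr_sqr. Qed.

Lemma normc_conj z : normc (conjc z) = normc z.
Proof. by case: z => a b /=; rewrite sqrrN. Qed.

Lemma conjc_div z w : conjc (z / w) = conjc z / conjc w.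
Proof. exact: fmorph_div. Qed.

Lemma normc_distC z w : normc (z - w) = normc (w - z).
Proof. by rewrite -opprB normcN. Qed.

Lemma normc_triangle z w v : normc (z - v) <= normc (z - w) + normc (w - v).
Proof. by rewrite (_ : z - v = (z - w) + (w - v)) ?le_normcD//; ring. Qed.

Lemma norm_Re_le z : `|complex.Re z| <= normc z.
Proof.
rewrite -(@ler_pXn2r _ 2) ?nnegrE ?normc_ge0// normc_sq real_normK ?num_real//.
by rewrite lerDl sqr_ge0.
Qed.

Lemma norm_Im_le z : `|complex.Im z| <= normc z.
Proof.
rewrite -(@ler_pXn2r _ 2) ?nnegrE ?normc_ge0// normc_sq real_normK ?num_real//.
by rewrite lerDr sqr_ge0.
Qed.

Lemma normc_le_ReIm z : normc z <= `|complex.Re z| + `|complex.Im z|.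
Proof.
rewrite -(@ler_pXn2r _ 2) ?nnegrE ?normc_ge0 ?addr_ge0// normc_sq sqrrD.
by rewrite !real_normK ?num_real// addrAC lerDl mulrn_wge0// mulr_ge0.
Qed.

End ComplexModulus.

(** * Comparison of spherical and Euclidean distance *)

Section SphericalDistance.
Context (R : realType).
Local Notation C := R[i].
Implicit Types (z w : C).

(** The argument of [asin] in [sdist]: half of the length of the chord between the two points of the
    unit sphere. *)
Definition chordal (x y : P1 R) : R := normc (hdet x y) / (hnorm x * hnorm y).

Lemma hnorm_Some z : hnorm (Some z) = Num.sqrt (1 + normc z ^+ 2).
Proof. by rewrite /hnorm /hx /hy Normc.normc1 expr1n addrC. Qed.

Lemma hnorm_None : hnorm (None : P1 R) = 1.
Proof. by rewrite /hnorm /hx /hy Normc.normc1 Normc.normc0 expr1n expr0n/= addr0 sqrtr1. Qed.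

Lemma hnorm_sq z : hnorm (Some z) ^+ 2 = 1 + normc z ^+ 2.
Proof. by rewrite hnorm_Some sqr_sqrtr// addr_ge0 ?sqr_ge0. Qed.

Lemma hnorm_ge1 x : 1 <= hnorm x :> R.
Proof.
case: x => [z|]; last by rewrite hnorm_None.
by rewrite hnorm_Some -[leLHS]sqrtr1 ler_wsqrtr// lerDl sqr_ge0.
Qed.

Let hnorm_gt0 x : 0 < hnorm x :> R. Proof. exact: lt_le_trans (hnorm_ge1 x). Qed.

Lemma chordal_ge0 x y : 0 <= chordal x y.
Proof. by rewrite divr_ge0 ?normc_ge0// mulr_ge0 ?(ltW (hnorm_gt0 _)). Qed.

Lemma chordal_Some z w :
  chordal (Some z) (Some w) = normc (z - w) / (hnorm (Some z) * hnorm (Some w)).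
Proof. by rewrite /chordal /hdet /hx /hy !mulr1. Qed.

Lemma chordal_None x : chordal None x = normc (hy x) / hnorm x.
Proof.
rewrite /chordal /hdet [hx None]/(1 : C) [hy None]/(0 : C).
by rewrite mulr0 subr0 mul1r hnorm_None mul1r.
Qed.

Lemma chordalC x y : chordal x y = chordal y x.
Proof.
by rewrite /chordal [hnorm x * _]mulrC /hdet -normcN opprB.
Qed.

(** This keeps the argument of [asin] in its domain. For finite points, [(1 + a^2)(1 + b^2) - (a +
    b)^2 = (1 - a b)^2]. *)
Lemma chordal_le1 (x y : P1 R) : chordal x y <= 1.
Proof.
have N (z : P1 R) : chordal None z <= 1.
  rewrite chordal_None ler_pdivrMr// mul1r; case: z => [z|]; rewrite /hy.
    by rewrite Normc.normc1 hnorm_ge1.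
  by rewrite Normc.normc0 hnorm_None.
case: x y => [z|] [w|]; rewrite ?N//; last by rewrite chordalC N.
rewrite chordal_Some ler_pdivrMr ?mulr_gt0// mul1r.
rewrite -(@ler_pXn2r _ 2) ?nnegrE ?normc_ge0 ?mulr_ge0 ?(ltW (hnorm_gt0 _))//.
rewrite exprMn !hnorm_sq.
have zw : normc (z - w) <= normc z + normc w.
  by rewrite (le_trans (le_normcD _ _))// normcN.
apply: (@le_trans _ _ ((normc z + normc w) ^+ 2)).
  by rewrite ler_pXn2r ?nnegrE ?normc_ge0 ?addr_ge0 ?normc_ge0.
have := sqr_ge0 (1 - normc z * normc w).
set a := normc z; set b := normc w; nra.
Qed.

Lemma sdist_bounds (x y : P1 R) : 2 * chordal x y <= sdist x y <= 16 * chordal x y.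
Proof.
have := @asin_bounds R (chordal x y); rewrite chordal_ge0 chordal_le1 => /(_ isT).
by rewrite /sdist -/(chordal x y); set s := asin _; lra.
Qed.

Lemma sdistC (x y : P1 R) : sdist x y = sdist y x.
Proof. by rewrite /sdist -!/(chordal _ _) chordalC. Qed.

Lemma sdist_gt0 (x y : P1 R) : x <> y -> 0 < sdist x y.
Proof.
move=> xy; have /andP[+ _] := sdist_bounds x y; apply: lt_le_trans.
rewrite mulr_gt0// divr_gt0// ?mulr_gt0// normc_gt0 /hdet.
case: x y xy => [z|] [w|] //= xy;
  rewrite ?mulr0 ?mulr1 ?mul0r ?mul1r ?subr0 ?sub0r ?oppr_eq0 ?oner_eq0//.
by rewrite subr_eq0; apply: contra_notN xy => /eqP ->.
Qed.

Lemma sdist_le z w : sdist (Some z) (Some w) <= 16 * normc (z - w).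
Proof.
have /andP[_ h] := sdist_bounds (Some z) (Some w); apply: (le_trans h).
rewrite ler_pM2l// chordal_Some ler_pdivrMr ?mulr_gt0// ler_peMr ?normc_ge0//.
by rewrite -[leLHS]mulr1 ler_pM// hnorm_ge1.
Qed.

Lemma hnorm_le4 z : normc z <= 3 -> hnorm (Some z) <= 4.
Proof.
move=> z3; rewrite -(@ler_pXn2r _ 2) ?nnegrE ?(ltW (hnorm_gt0 _))// hnorm_sq.
have := normc_ge0 z; nra.
Qed.

(** The norm of [z] stays in the bound because [z] will be a limit point not yet known to lie in a
    bounded region. *)
Lemma sdist_ge z w : normc w <= 3 ->
  normc (z - w) <= 2 * hnorm (Some z) * sdist (Some z) (Some w).
Proof.
move=> w3; have /andP[h _] := sdist_bounds (Some z) (Some w).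
move: h; rewrite chordal_Some mulrA ler_pdivrMr ?mulr_gt0// => h.
have w4 := hnorm_le4 w3.
have s0 : 0 <= sdist (Some z) (Some w).
  have /andP[+ _] := sdist_bounds (Some z) (Some w); apply: le_trans.
  by rewrite mulr_ge0 ?chordal_ge0.
have : sdist (Some z) (Some w) * (hnorm (Some z) * hnorm (Some w)) <=
       sdist (Some z) (Some w) * (hnorm (Some z) * 4).
  by rewrite ler_wpM2l// ler_wpM2l// ltW.
set a := hnorm (Some z) in h *; set s := sdist _ _ in h *.
by move=> h'; have := le_trans h h'; lra.
Qed.

Lemma sdist_None_ge w : normc w <= 3 -> 2^-1 <= sdist (None : P1 R) (Some w).
Proof.
move=> w3; have /andP[+ _] := sdist_bounds None (Some w).
apply: le_trans; rewrite chordal_None /hy Normc.normc1 mulrA mulr1.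
by rewrite ler_pdivlMr// mulrC ler_pdivrMr//; have := hnorm_le4 w3; lra.
Qed.

End SphericalDistance.

(** * Inversions in disjoint disks *)

Section Accumulation.
Context (R : realType).
Implicit Types (A B : set (P1 R)) (x : P1 R).

Lemma sub_accumulation A B x : A `<=` B -> accumulation_point A x -> accumulation_point B x.
Proof. by move=> AB Ax e /Ax[y [Ay yx xy]]; exists y; split=> //; exact: AB. Qed.

Lemma accumulationU A B x : accumulation_point (A `|` B) x ->
  accumulation_point A x \/ accumulation_point B x.
Proof.
move=> AB; apply: contrapT => /not_orP[/existsNP[e1 /not_implyP[e10 N1]]
  /existsNP[e2 /not_implyP[e20 N2]]].
have [|y [yAB yx]] := AB (Num.min e1 e2); first by rewrite lt_min e10.
rewrite lt_min => /andP[y1 y2]; case: yAB => [Ay|By].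
- by apply: N1; exists y.
- by apply: N2; exists y.
Qed.

Lemma accumulation_big (J : eqType) (s : seq J) (F : J -> set (P1 R)) x :
  accumulation_point [set y | exists2 w, w \in s & F w y] x ->
  exists2 w, w \in s & accumulation_point (F w) x.
Proof.
elim: s => [|w s IH] H; first by have [y [[]]] := H 1 ltr01.
have /accumulationU[Fw|/IH[v vs Fv]] : accumulation_point
    (F w `|` [set y | exists2 w, w \in s & F w y]) x.
- apply: sub_accumulation H => y [v]; rewrite inE => /orP[/eqP -> ?|vs Fv].
    by left.
  by right; exists v.
- by exists w; rewrite ?mem_head.
- by exists v; rewrite // in_cons vs orbT.
Qed.

Lemma accumulation_finite A x : finite_set A -> ~ accumulation_point A x.
Proof.
move=> /finite_seqP[s ->] H.
have [|w ws Hw] := @accumulation_big _ s (fun w => [set w]) x.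
  by apply: sub_accumulation H => y ys; exists y.
have [xw|/eqP/sdist_gt0 xw] := eqVneq x w.
  by have [y [/= -> ]] := Hw 1 ltr01; rewrite xw.
by have [y [/= -> _]] := Hw _ xw; rewrite sdistC ltxx.
Qed.

End Accumulation.

Section Inversions.
Context (R : realType) (I : finType) (a : I -> R[i]) (r : I -> R) (delta : R).
Local Notation C := R[i].
(** These bounds place the closed disks in [|z| <= 2] at mutual distance at least [delta], uniformly
    in the radii, which may tend to 0. *)
Hypotheses (r0 : forall j, 0 < r j) (r_delta : forall j, r j < delta)
  (delta_le : delta <= 2^-1) (a_le : forall j, normc (a j) <= 3/2)
  (a_sep : forall i j, i != j -> 3 * delta <= normc (a i - a j)).
Implicit Types (i j : I) (z w : C) (x y : P1 R).

Let delta0 : 0 < delta \/ forall j : I, False.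
Proof.
have [j|] := pselect (exists j : I, True).
  by left; case: j => j _; exact: lt_trans (r_delta j).
by move=> N; right => j; apply: N; exists j.
Qed.

Definition in_open_disk j x := if x is Some z then normc (z - a j) < r j else false.
Definition in_closed_disk j x := if x is Some z then normc (z - a j) <= r j else false.
Local Notation inU := in_open_disk.
Local Notation inB := in_closed_disk.
Local Notation s j := (inversion (a j) (r j)).

(** The inversion in the finite plane. At the centre, whose true image is infinity, division by zero
    gives the value [a j]. *)
Definition inversionC j z : C := a j + real_complex R (r j ^+ 2) / conjc (z - a j).
Local Notation sC := inversionC.

Lemma in_open_closed j x : inU j x -> inB j x.
Proof. by case: x => //= z; exact: ltW. Qed.

Lemma inversionE j z : z != a j -> s j (Some z) = Some (sC j z).
Proof. by rewrite /inversion => /negbTE ->. Qed.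

Lemma inversionC_sub j z : sC j z - a j = real_complex R (r j ^+ 2) / conjc (z - a j).
Proof. by rewrite /sC addrC addKr. Qed.

Lemma r2_neq0 j : real_complex R (r j ^+ 2) != 0.
Proof. by rewrite fmorph_eq0 expf_neq0// gt_eqF. Qed.

Lemma inversionC_neq j z : z != a j -> sC j z != a j.
Proof.
move=> za; rewrite -subr_eq0 inversionC_sub mulf_neq0 ?r2_neq0// invr_eq0.
by rewrite conjc_eq0 subr_eq0.
Qed.

Lemma inversionK j : involutive (s j).
Proof.
case=> [z|]; last by rewrite /= eqxx.
have [->|za] := eqVneq z (a j); first by rewrite /= eqxx.
rewrite inversionE// inversionE ?inversionC_neq//; congr Some.
apply: (addIr (- a j)); rewrite !inversionC_sub conjc_div conjcK conjc_real.
by rewrite invfM invrK mulrA divff ?mul1r// r2_neq0.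
Qed.

Lemma normc_inversionC j z : normc (sC j z - a j) = r j ^+ 2 / normc (z - a j).
Proof.
rewrite inversionC_sub Normc.normcM Normc.normcV normc_conj normc_real.
by rewrite ger0_norm ?sqr_ge0.
Qed.

Lemma in_open_inversion j x : inU j (s j x) = ~~ inB j x.
Proof.
case: x => [z|]; last by rewrite /= subrr Normc.normc0 r0.
have [->|za] := eqVneq z (a j).
  by rewrite /= eqxx subrr Normc.normc0 ltW.
rewrite inversionE// /inU normc_inversionC /inB -ltNge.
by rewrite ltr_pdivrMr ?normc_gt0 ?subr_eq0// expr2 ltr_pM2l.
Qed.

Lemma inversion_boundary j x : inB j x -> ~~ inU j x -> s j x = x.
Proof.
case: x => // z; rewrite /= -leNgt => z1 z2.
have zr : normc (z - a j) = r j by apply/eqP; rewrite eq_le z1.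
have za : z != a j by rewrite -subr_eq0 -normc_gt0 zr.
rewrite (negbTE za); congr Some; apply: (addIr (- a j)).
have /(congr1 (real_complex R)) : normc (z - a j) ^+ 2 = r j ^+ 2 by rewrite zr.
rewrite rmorphXn/= -norm_normc sqr_normc => <-; rewrite addrC addKr mulfK//.
by rewrite conjc_eq0 subr_eq0.
Qed.

Lemma disk_sep i j z w : i != j -> inB i (Some z) -> inB j (Some w) ->
  delta <= normc (z - w).
Proof.
move=> ij /= zi wj; have := a_sep ij.
have := normc_triangle (a i) z (a j); have := normc_triangle z w (a j).
rewrite (normc_distC (a i) z); have := r_delta i; have := r_delta j.
set A := normc (a i - a j); set B := normc (z - a j).
by move: zi wj; set D := normc (z - a i); set E := normc (w - a j); lra.
Qed.

Lemma center_sep i j z : i != j -> inB i (Some z) -> delta <= normc (z - a j).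
Proof. by move=> ij zi; apply: (disk_sep ij zi); rewrite /= subrr Normc.normc0 ltW. Qed.

Lemma disk_disjoint i j x : i != j -> inB i x -> ~~ inB j x.
Proof.
case: x => // z ij zi; rewrite /= -ltNge.
exact: lt_le_trans (r_delta j) (center_sep ij zi).
Qed.

Lemma disk_le i z : inB i (Some z) -> normc z <= 2.
Proof.
move=> /= zi; have := normc_triangle z (a i) 0; rewrite !subr0.
have := r_delta i; have := a_le i; have := delta_le.
by move: zi; set A := normc (z - a i); set B := normc z; lra.
Qed.

Lemma inversionC_dist j z w : z != a j -> w != a j ->
  normc (sC j z - sC j w) = r j ^+ 2 * normc (z - w) / (normc (z - a j) * normc (w - a j)).
Proof.
move=> za wa.
have E : sC j z - sC j w = real_complex R (r j ^+ 2) * conjc (w - z) /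
    (conjc (z - a j) * conjc (w - a j)).
  have cz : conjc (z - a j) != 0 by rewrite conjc_eq0 subr_eq0.
  have cw : conjc (w - a j) != 0 by rewrite conjc_eq0 subr_eq0.
  have -> : conjc (w - z) = conjc (w - a j) - conjc (z - a j).
    by rewrite -rmorphB; congr conjc; ring.
  rewrite /sC; move: (conjc (z - a j)) (conjc (w - a j)) cz cw => p q p0 q0.
  by field; rewrite p0 q0.
rewrite E !Normc.normcM Normc.normcV Normc.normcM !normc_conj normc_real.
by rewrite ger0_norm ?sqr_ge0// (normc_distC w z).
Qed.

(** Points of the other disks lie at distance between [delta] and 4 from [a j]; the product of two
    such distances in the exact formula lies between [delta^2] and 16. *)
Definition contraction_upper j := r j ^+ 2 / delta ^+ 2.
Definition contraction_lower j := r j ^+ 2 / 16.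
Local Notation L := contraction_upper.
Local Notation l := contraction_lower.

Lemma inversionC_contraction j i i' z w : i != j -> i' != j ->
  inB i (Some z) -> inB i' (Some w) ->
  l j * normc (z - w) <= normc (sC j z - sC j w) <= L j * normc (z - w).
Proof.
move=> ij ij' zi wi.
have zd := center_sep ij zi; have wd := center_sep ij' wi.
have d0 : 0 < delta by case: delta0 => // /(_ j).
have za : z != a j by rewrite -subr_eq0 -normc_gt0 (lt_le_trans d0).
have wa : w != a j by rewrite -subr_eq0 -normc_gt0 (lt_le_trans d0).
rewrite inversionC_dist// /l /L ![_ / _ * normc (z - w)]mulrAC.
have N0 : 0 <= r j ^+ 2 * normc (z - w) by rewrite mulr_ge0 ?sqr_ge0 ?normc_ge0.
have up v i0 : inB i0 (Some v) -> normc (v - a j) <= 4.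
  move=> /disk_le v2; have := normc_triangle v 0 (a j); rewrite subr0 sub0r normcN.
  by have := a_le j; move: v2; set A := normc v; set B := normc (v - a j); lra.
have z4 := up _ _ zi; have w4 := up _ _ wi.
have z0 : 0 < normc (z - a j) by rewrite (lt_le_trans d0).
have w0 : 0 < normc (w - a j) by rewrite (lt_le_trans d0).
apply/andP; split; apply: ler_wpM2l => //.
- rewrite lef_pV2 ?posrE ?mulr_gt0// (_ : 16 = 4 * 4); last by ring.
  by apply: ler_pM => //; exact: ltW.
- rewrite lef_pV2 ?posrE ?mulr_gt0 ?exprn_gt0// expr2.
  by apply: ler_pM => //; exact: ltW.
Qed.

Lemma contraction_upper_bounds j : 0 < L j < 1.
Proof.
have d0 : 0 < delta by case: delta0 => // /(_ j).
rewrite divr_gt0 ?exprn_gt0//= ltr_pdivrMr ?exprn_gt0// mul1r.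
by rewrite ltr_pXn2r ?nnegrE ?(ltW (r0 j)) ?(ltW d0).
Qed.

Lemma contraction_lower_bounds j : 0 < l j < 1.
Proof.
rewrite divr_gt0 ?exprn_gt0//= ltr_pdivrMr// mul1r.
by have := r0 j; have := r_delta j; have := delta_le; nra.
Qed.

(** * Words in the reflections *)

Fixpoint eval_word (w : seq I) x : P1 R := if w is j :: w' then s j (eval_word w' x) else x.

Lemma eval_cons j (w : seq I) x : eval_word (j :: w) x = s j (eval_word w x).
Proof. by []. Qed.

Lemma eval_cat (v w : seq I) x : eval_word (v ++ w) x = eval_word v (eval_word w x).
Proof. by elim: v => //= j v ->. Qed.

Lemma eval_rev (w : seq I) : cancel (eval_word w) (eval_word (rev w)).
Proof.
elim: w => //= j w IH x; rewrite rev_cons -cats1 eval_cat/= inversionK; exact: IH.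
Qed.

Lemma eval_revK (w : seq I) : cancel (eval_word (rev w)) (eval_word w).
Proof. by move=> x; rewrite -{1}(revK w) eval_rev. Qed.

Local Notation reduced := (sorted (fun i j : I => i != j)).

Lemma reduce_word (w : seq I) : exists v, reduced v /\ eval_word w =1 eval_word v.
Proof.
elim: w => [|j w [v [rv wv]]]; first by exists [::].
case: v rv wv => [|i v] rv wv; first by exists [:: j]; split => // x /=; rewrite wv.
have [ij|ij] := eqVneq j i.
  exists v; split; first exact: path_sorted rv.
  by move=> x /=; rewrite wv/= ij inversionK.
exists [:: j, i & v]; split; first by rewrite /= ij.
by move=> x; rewrite /= wv.
Qed.

(** Ping-pong from a point outside the open disks. Such a point may lie on a circle and be fixed by
    a one-letter word, hence the first alternative; from the second letter on, disjointness of the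
    closed disks forces the open disk. *)
Lemma eval_reduced j (w : seq I) x : reduced (j :: w) -> (forall i, ~~ inU i x) ->
  (eval_word (j :: w) x = x /\ inB j x) \/ inU j (eval_word (j :: w) x).
Proof.
move=> + xF; elim: w j => [|i w IH] j.
  move=> _ /=; have [xB|xB] := boolP (inB j x); last by right; rewrite in_open_inversion.
  by left; split=> //; apply: inversion_boundary.
move=> /= /andP[ji iw].
have yB : inB i (eval_word (i :: w) x).
  by case: (IH i iw) => [[-> //]|]; exact: in_open_closed.
right; rewrite in_open_inversion; apply: disk_disjoint yB.
by rewrite eq_sym.
Qed.

(** The complement of the open disks is a fundamental domain for the reflections: an orbit meets it
    at most once. *)
Lemma orbit_fundamental (w : seq I) x : (forall i, ~~ inU i x) ->
  (forall i, ~~ inU i (eval_word w x)) -> eval_word w x = x.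
Proof.
move=> xF; have [v [rv wv]] := reduce_word w; rewrite (wv x).
case: v rv {wv} => // j v rv yF.
by have [[]//|] := eval_reduced rv xF; rewrite (negbTE (yF j)).
Qed.

Lemma eval_infty j (w : seq I) : reduced (j :: w) -> inU j (eval_word (j :: w) None).
Proof. by move=> /eval_reduced -/(_ None)[//|[]|]. Qed.

(** Points whose itinerary starts with [w], where each step reflects in the disk that contains the
    point. *)
Fixpoint cylinder (w : seq I) x := if w is j :: w' then inU j x && cylinder w' (s j x) else true.

Definition deep n : set (P1 R) := [set x | exists2 w, w \in reduced_words I n & cylinder w x].

(** Itineraries are automatically reduced: [s j] moves a point of the open disk [j] outside the
    closed one, so the next letter differs from [j]. *)
Lemma deepS n j x : inU j x -> deep n (s j x) -> deep n.+1 x.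
Proof.
move=> xj [w /allpairsPdep[i [v [_ wv ->]]] wx].
exists (j :: v); last by rewrite /= xj.
apply/allpairsPdep; exists j, (j :: v); split; rewrite ?mem_enum//.
apply: (mem_words_from _ wv); move: wx; have [w' [-> _ _]] := words_fromP wv.
rewrite /= => /andP[xi _]; apply/eqP => ij; move: (in_open_closed xi); rewrite ij.
by apply/negP; rewrite -in_open_inversion inversionK.
Qed.

(** The orbit has at most one point outside all the open disks. Any other point that is not deep at
    level [n + 1] is the reflection of an orbit point not deep at level [n], and there are finitely
    many reflections. *)
Lemma finite_orbit_not_deep x0 n :
  finite_set ([set eval_word w x0 | w in setT] `\` deep n).
Proof.
pose F : set (P1 R) := [set x | forall i, ~~ inU i x].
set O := [set eval_word w x0 | w in setT].
have OF : finite_set (O `&` F).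
  have [[x [[v _ vx] xF]]|N] := pselect (exists x, (O `&` F) x); last first.
    by rewrite (_ : O `&` F = set0)//; apply/seteqP; split => // x Ox; apply: N; exists x.
  apply: (@sub_finite_set _ _ [set x]) => // y [[w _ wy] yF] /=.
  have yE : y = eval_word (w ++ rev v) x by rewrite eval_cat -vx eval_rev.
  by rewrite yE; apply: orbit_fundamental => //; rewrite -yE.
elim: n => [|n IH].
  apply: sub_finite_set OF => x [Ox Nx]; split => // i; apply/negP => xi; apply: Nx.
  exists [:: i]; last by rewrite /= xi.
  by apply/allpairsPdep; exists i, [:: i]; rewrite mem_enum mem_head.
apply: (@sub_finite_set _ _ ((O `&` F) `|` \bigcup_(j in setT) (s j @` (O `\` deep n)))).
  move=> x [[w _ wx] Nx].
  have [xF|/existsNP[j /negP xj]] := pselect (F x); first by left; split => //; exists w.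
  right; exists j => //; exists (s j x); last exact: inversionK.
  split; first by exists (j :: w); rewrite //= wx.
  by move=> /(deepS (negbNE xj)).
rewrite finite_setU; split => //; apply: bigcup_finite => // j _.
exact: finite_image.
Qed.

(** * Covering the limit set *)

Section Upper.
Variable G : set (P1 R -> P1 R).
Hypothesis G_words : forall f, G f -> exists w : seq I, f =1 eval_word w.

Lemma limit_set_deep x n : limit_set G x -> accumulation_point (deep n) x.
Proof.
move=> [x0 Gx]; set O := [set eval_word w x0 | w in setT].
have : accumulation_point (O `&` deep n `|` O `\` deep n) x.
  apply: sub_accumulation Gx => y [f /G_words[w fw] <-]; rewrite fw.
  have Ow : O (eval_word w x0) by exists w.
  by have [?|?] := pselect (deep n (eval_word w x0)); [left|right].
move=> /accumulationU[|/accumulation_finite[]].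
- by apply: sub_accumulation => y [].
- exact: finite_orbit_not_deep.
Qed.

(** The closure is Euclidean, so that the planar diameter estimate passes to it; infinity is no
    limit of the bounded cylinders of nonempty words. *)
Definition cylinder_closure (w : seq I) : set (P1 R) :=
  [set Some z | z in [set z | forall eps : R, 0 < eps ->
     exists2 z', cylinder w (Some z') & normc (z - z') < eps]].

Lemma accumulation_cylinder (w : seq I) x : w != [::] ->
  accumulation_point (cylinder w) x -> cylinder_closure w x.
Proof.
case: w => // j w _ H.
have cylB y : cylinder (j :: w) y -> exists2 z, y = Some z & normc z <= 3.
  case: y => [z|] // /andP[/in_open_closed /disk_le z2 _]; exists z => //.
  by rewrite (le_trans z2)// ler_nat.
case: x H => [z|] H; last first.
  have [|y [/cylB[z -> z3] _]] := H 2^-1; first by rewrite invr_gt0.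
  by rewrite sdistC ltNge sdist_None_ge.
exists z => // eps eps0.
have h0 : 0 < 2 * hnorm (Some z) by rewrite mulr_gt0// (lt_le_trans _ (hnorm_ge1 _)).
have [|y [yc _]] := H (eps / (2 * hnorm (Some z))); first by rewrite divr_gt0.
have [z' yE z3] := cylB _ yc; rewrite yE in yc *.
rewrite sdistC ltr_pdivlMr// mulrC => lt_eps; exists z' => //.
exact: le_lt_trans (sdist_ge z z3) lt_eps.
Qed.

(** Reflecting in the first disk strips the first letter, and reflecting back contracts by [L i].
    The constant absorbs the diameter [2 r j] of a single disk; it may depend on the radii, since
    these are fixed while [n] tends to infinity. *)
Lemma cylinder_diam n i (w : seq I) z z' : w \in words_from n i ->
  cylinder w (Some z) -> cylinder w (Some z') ->
  normc (z - z') <= (\sum_j 2 * r j / L j) * wt L w.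
Proof.
have L0 j : 0 < L j by case/andP: (contraction_upper_bounds j).
set K := \sum_j _.
have KL j : 2 * r j <= K * L j.
  rewrite -ler_pdivrMr// /K (bigD1 j)//= lerDl sumr_ge0// => j' _.
  by rewrite divr_ge0 ?(ltW (L0 _))// mulr_ge0// ltW.
elim: n i w z z' => [|n IH] i w z z' wn.
  rewrite /= inE in wn; rewrite (eqP wn) /= !andbT /wt big_seq1 => zi zi'.
  have := normc_triangle z (a i) z'; rewrite (normc_distC (a i)).
  have := KL i; move: zi zi'; set A := normc _; set B := normc _; set D := normc _; lra.
move: wn => /= /allpairsPdep[j [v [+ vj ->]]].
rewrite mem_filter => /andP[ji _].
have cons x : cylinder (i :: v) x = inU i x && cylinder v (s i x) by [].
rewrite !cons => /andP[zi zv] /andP[zi' zv'].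
have [v' [vE _ _]] := words_fromP vj.
have za t : cylinder v (s i (Some t)) -> t != a i /\ inB j (s i (Some t)).
  move=> tv; split; last by move: tv; rewrite vE => /andP[/in_open_closed].
  by apply/eqP => ta; move: tv; rewrite vE ta /= eqxx.
have [za1 zB] := za _ zv; have [za1' zB'] := za _ zv'.
rewrite !inversionE// in zv zv' zB zB'.
have zK t : t != a i -> sC i (sC i t) = t.
  move=> ta; have := inversionK i (Some t).
  by rewrite !inversionE ?inversionC_neq// => -[].
have /andP[_] := inversionC_contraction ji ji zB zB'.
rewrite !zK// => /le_trans; apply; rewrite /wt big_cons mulrCA ler_wpM2l ?(ltW (L0 _))//.
exact: IH vj zv zv'.
Qed.

Theorem limit_set_measure_eq0 (d : R) : 0 < d ->
  fraction_sum (fun i => L i `^ d) < 1 ->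
  hausdorff_measure (@sdist R) d (limit_set G) = 0%E.
Proof.
move=> d0 T1.
have L0 j : 0 < L j by case/andP: (contraction_upper_bounds j).
pose K := \sum_j 2 * r j / L j.
have K0 : 0 <= K.
  by apply: sumr_ge0 => j _; rewrite divr_ge0 ?(ltW (L0 _))// mulr_ge0// ltW.
(* The 16 converts Euclidean into spherical distance; the additional 1 pays for replacing two points
   of the closure by points of the cylinder, each within half of the weight. *)
apply: (@hausdorff_measure_cover_eq0 _ _ _ _ cylinder_closure L (16 * (K + 1)) d).
- by rewrite mulr_gt0// ltr_wpDl.
- exact: d0.
- exact: contraction_upper_bounds.
- exact: T1.
- move=> n x /(@limit_set_deep x n)/accumulation_big[w wn /accumulation_cylinder wx].
  exists w => //; apply: wx; move: wn => /allpairsPdep[i [v [_ /words_fromP[v' [-> _ _]] ->]]].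
  by [].
- move=> n w /allpairsPdep[i [v [_ vi ->]]].
  have wt0 : 0 < wt L v by exact: wt_gt0.
  apply: diameter_le.
    by rewrite mulr_ge0 ?(ltW wt0)// mulr_ge0// addr_ge0.
  move=> _ _ [z zc <-] [z' zc' <-]; apply: (le_trans (sdist_le _ _)).
  rewrite -mulrA ler_pM2l// mulrDl mul1r.
  have [|y yc zy] := zc (wt L v / 2); first by rewrite divr_gt0.
  have [|y' yc' zy'] := zc' (wt L v / 2); first by rewrite divr_gt0.
  have := cylinder_diam vi yc yc'; rewrite -/K.
  have := normc_triangle z y z'; have := normc_triangle y y' z'.
  rewrite (normc_distC y' z'); move: zy zy'.
  set A := normc (z - y); set B := normc (z' - y'); set D := normc (y - y').
  set E := normc (z - z'); set F := normc (y - z'); set W := wt L v.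
  set X := K * W; lra.
Qed.

End Upper.

(** * Coding points of the limit set *)

Section Lower.
Variable G : set (P1 R -> P1 R).
Hypothesis even_words_G : forall w : seq I, ~~ odd (size w) -> G (eval_word w).

Implicit Types (u v : nat -> I) (n m : nat).

Let shift u n := u n.+1.

Let reduced_shift u : reduced_seq u -> reduced_seq (shift u).
Proof. by move=> ru n; exact: ru. Qed.

Let mkseqS' u n : mkseq u n.+1 = u 0%N :: mkseq (shift u) n.
Proof. by rewrite /mkseq /= -[1%N]addn0 iotaDl -map_comp. Qed.

Let reduced_mkseq u n : reduced_seq u -> sorted (fun i j => i != j) (mkseq u n.+1).
Proof.
elim: n u => [//|n IH] u ru; rewrite mkseqS'.
have := IH _ (reduced_shift ru); rewrite mkseqS' /= => ->; rewrite andbT; exact: ru.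
Qed.

(** Image of infinity under the prefix of length [n + 1]. By [eval_infty] it is finite when [u] is
    reduced, so the default 0 does not occur there. *)
Definition approx u n : C := if eval_word (mkseq u n.+1) None is Some z then z else 0.
Local Notation zz := approx.

Let approxE u n : reduced_seq u -> eval_word (mkseq u n.+1) None = Some (zz u n).
Proof.
move=> ru; have := reduced_mkseq n ru; rewrite /zz mkseqS' => /eval_infty.
by case: (eval_word _ _).
Qed.

Let approx_disk u n : reduced_seq u -> inB (u 0%N) (Some (zz u n)).
Proof.
move=> ru; rewrite -approxE//; apply: in_open_closed.
by have := reduced_mkseq n ru; rewrite mkseqS' => /eval_infty.
Qed.

Let disk_neq i j z : i != j -> inB i (Some z) -> z != a j.
Proof.
move=> ij zi; rewrite -subr_eq0 -normc_gt0; apply: lt_le_trans (center_sep ij zi).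
by case: delta0 => // /(_ j).
Qed.

Let approxS u n : reduced_seq u -> zz u n.+1 = sC (u 0%N) (zz (shift u) n).
Proof.
move=> ru; have := approxE n.+1 ru; rewrite mkseqS'.
have ru' := reduced_shift ru; rewrite eval_cons approxE// inversionE; first by case.
by apply: disk_neq (approx_disk n ru'); rewrite eq_sym; exact: ru.
Qed.

Let rho_exists : exists rho, 0 <= rho < 1 /\ forall i, L i <= rho.
Proof.
by apply: uniform_bound => i; case/andP: (contraction_upper_bounds i).
Qed.

Let rho := projT1 (cid rho_exists).
Let rho01 : 0 <= rho < 1. Proof. by case: (projT2 (cid rho_exists)). Qed.
Let L_rho i : L i <= rho. Proof. by case: (projT2 (cid rho_exists)). Qed.

(** Induction through the shift, each letter contracting by at most [rho]. At the start both points
    lie in one disk of radius below [delta <= 1/2], so they are less than 1 apart. *)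
Let approx_step u n : reduced_seq u -> normc (zz u n.+1 - zz u n) <= rho ^+ n.
Proof.
have [rho0 _] := andP rho01.
elim: n u => [|n IH] u ru.
  have := approx_disk 0 ru; have := approx_disk 1 ru; rewrite /inB expr0.
  have := normc_triangle (zz u 1) (a (u 0%N)) (zz u 0).
  rewrite (normc_distC (a _)); have := r_delta (u 0%N); have := delta_le.
  lra.
have ru' := reduced_shift ru; have u01 : shift u 0 != u 0%N by rewrite eq_sym; exact: ru.
rewrite (approxS n.+1 ru) (approxS n ru).
have /andP[_ /le_trans] := inversionC_contraction u01 u01
  (approx_disk n.+1 ru') (approx_disk n ru').
apply; rewrite exprS ler_pM ?normc_ge0 ?IH//.
by case/andP: (contraction_upper_bounds (u 0%N)) => /ltW.
Qed.

Lemma cvg_geometric_steps (x : nat -> R) (q : R) : 0 <= q < 1 ->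
  (forall n, `|x n.+1 - x n| <= q ^+ n) -> cvgn x.
Proof.
move=> /andP[q0 q1] xq.
have c : cvgn (series (telescope x)).
  apply: normed_cvg; apply: (@series_le_cvg _ _ (geometric 1 q)) => [n|n|n|].
  - exact: normr_ge0.
  - by rewrite /= mul1r exprn_ge0.
  - by rewrite /= mul1r; exact: xq.
  - by apply: is_cvg_geometric_series; rewrite ger0_norm.
have -> : x = (fun n => x 0%N + series (telescope x) n).
  by apply/funext => n; rewrite {1}(eq_sum_telescope x n).
by apply: is_cvgD => //; exact: is_cvg_cst.
Qed.

Definition coding u : C := Complex (limn (fun n => complex.Re (zz u n)))
  (limn (fun n => complex.Im (zz u n))).

Let coding_cvg u (e : R) : reduced_seq u -> 0 < e ->
  \forall n \near \oo, normc (zz u n - coding u) < e.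
Proof.
move=> ru e0.
have cRe : cvgn (fun n => complex.Re (zz u n)).
  apply: (cvg_geometric_steps rho01) => n; apply: le_trans (approx_step n ru).
  by apply: le_trans (norm_Re_le _); case: (zz u n.+1) (zz u n) => ? ? [].
have cIm : cvgn (fun n => complex.Im (zz u n)).
  apply: (cvg_geometric_steps rho01) => n; apply: le_trans (approx_step n ru).
  by apply: le_trans (norm_Im_le _); case: (zz u n.+1) (zz u n) => ? ? [].
have e2 : 0 < e / 2 by rewrite divr_gt0.
move/cvgrPdist_lt: cRe => /(_ _ e2) nRe; move/cvgrPdist_lt: cIm => /(_ _ e2) nIm.
near=> n.
have h1 : `|limn (fun n => complex.Re (zz u n)) - complex.Re (zz u n)| < e / 2 by near: n.
have h2 : `|limn (fun n => complex.Im (zz u n)) - complex.Im (zz u n)| < e / 2 by near: n.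
rewrite normc_distC (le_lt_trans (normc_le_ReIm _))// (splitr e).
by rewrite /coding; move: h1 h2; case: (zz u n) => x y /= h1 h2; exact: ltrD.
Unshelve. all: by end_near.
Qed.

Let coding_disk u : reduced_seq u -> inB (u 0%N) (Some (coding u)).
Proof.
move=> ru; rewrite /inB leNgt; apply/negP; rewrite -subr_gt0 => e0.
have [n _ /(_ n (leqnn n))] := coding_cvg ru e0; rewrite /=.
have := approx_disk n ru; rewrite /inB.
have := normc_triangle (coding u) (zz u n) (a (u 0%N)); rewrite (normc_distC _ (zz u n)).
lra.
Qed.

(** The relation [approxS] passes to the limit because the reflection is Lipschitz on the other
    disks. *)
Let coding_shift u : reduced_seq u -> coding u = sC (u 0%N) (coding (shift u)).
Proof.
move=> ru; have ru' := reduced_shift ru.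
have u01 : shift u 0 != u 0%N by rewrite eq_sym; exact: ru.
apply/eqP; rewrite -subr_eq0 -normc_eq0; apply/eqP/le_anti; rewrite normc_ge0 andbT.
apply/ler_addgt0Pr => e e0; rewrite add0r.
have e2 : 0 < e / 2 by rewrite divr_gt0.
have [n1 _ H1] := coding_cvg ru e2; have [n2 _ H2] := coding_cvg ru' e2.
have := H1 (maxn n1 n2).+1 (leqW (leq_maxl _ _)); have := H2 (maxn n1 n2) (leq_maxr _ _).
move: (maxn n1 n2) => n /=; rewrite approxS//.
have /andP[_] := inversionC_contraction u01 u01 (approx_disk n ru') (coding_disk ru').
have := normc_triangle (coding u) (sC (u 0%N) (zz (shift u) n)) (sC (u 0%N) (coding (shift u))).
rewrite (normc_distC (coding u) (sC _ (zz (shift u) n))).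
have /andP[/ltW L0 /ltW L1] := contraction_upper_bounds (u 0%N).
have := ler_wpM2r (normc_ge0 (zz (shift u) n - coding (shift u))) L1.
rewrite mul1r; lra.
Qed.

Let coding_iter u n : reduced_seq u ->
  Some (coding u) = eval_word (mkseq u n) (Some (coding (fun m => u (n + m)%N))).
Proof.
elim: n u => [//|n IH] u ru; have ru' := reduced_shift ru.
rewrite mkseqS' eval_cons coding_shift// -inversionE.
  by congr (s _ _); exact: IH.
by apply: disk_neq (coding_disk ru'); rewrite eq_sym; exact: ru.
Qed.

(** The point is approached along the orbit of infinity. No approximant equals it: undoing the
    common prefix would identify infinity with the finite coded point of the shifted sequence. *)
Let coding_limit_set u : reduced_seq u -> limit_set G (Some (coding u)).
Proof.
move=> ru; exists None => e e0.
have e16 : 0 < e / 16 by rewrite divr_gt0.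
have [n _ Hn] := coding_cvg ru e16.
(* Index [2n + 1] is the prefix of length [2n + 2]; even length puts the word in the group. *)
have := Hn n.*2.+1; rewrite /= -addnn -addSn leq_addl => /(_ isT) zn.
exists (Some (zz u (n.+1 + n))); split.
- exists (eval_word (mkseq u (n.+1 + n).+1)); last exact: approxE.
  by apply: even_words_G; rewrite size_mkseq -addnS oddD addbb.
- rewrite -approxE// (coding_iter (n.+1 + n).+1 ru) => /(can_inj (eval_rev _)).
  by [].
- by rewrite (le_lt_trans (sdist_le _ _))// mulrC -ltr_pdivlMr.
Qed.

Let coding_sep u v n : reduced_seq u -> reduced_seq v ->
  (forall m, (m < n)%N -> u m = v m) -> u n != v n ->
  delta * wt l (mkseq u n) <= normc (coding u - coding v).
Proof.
elim: n u v => [|n IH] u v ru rv uv uvn.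
  rewrite /wt big_nil mulr1; exact: disk_sep uvn (coding_disk ru) (coding_disk rv).
have ru' := reduced_shift ru; have rv' := reduced_shift rv.
have u01 : shift u 0 != u 0%N by rewrite eq_sym; exact: ru.
have v01 : shift v 0 != u 0%N by rewrite uv// eq_sym; exact: rv.
rewrite (coding_shift ru) (coding_shift rv) -(uv 0%N)// mkseqS' /wt big_cons mulrCA.
have /andP[+ _] := inversionC_contraction u01 v01 (coding_disk ru') (coding_disk rv').
apply: le_trans; rewrite ler_wpM2l//.
  by case/andP: (contraction_lower_bounds (u 0%N)) => /ltW.
by apply: IH => // m mn; exact: uv.
Qed.

Theorem limit_set_measure_neq0 (d : R) : 0 < d ->
  1 <= fraction_sum (fun i => l i `^ d) ->
  hausdorff_measure (@sdist R) d (limit_set G) <> 0%E.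
Proof.
move=> d0 T1.
have [i0 _] : exists i0 : I, true.
  apply: contrapT => NI; move: T1; rewrite /fraction_sum big1 ?ler10// => i _.
  by exfalso; apply: NI; exists i.
have dp : 0 < delta by case: delta0 => // /(_ i0).
(* [sdist_ge] together with [hnorm <= 4] costs the factor 8. *)
apply: (@hausdorff_measure_code_neq0 _ _ _ _ (fun u => Some (coding u)) l (delta / 8) d).
- by rewrite divr_gt0.
- exact: d0.
- exact: contraction_lower_bounds.
- exact: T1.
- move=> u v n ru rv uv uvn; have := coding_sep ru rv uv uvn.
  have c3 t : reduced_seq t -> normc (coding t) <= 3.
    by move=> /coding_disk/disk_le t2; rewrite (le_trans t2)// ler_nat.
  have := sdist_ge (coding u) (c3 _ rv); have := hnorm_le4 (c3 _ ru).
  have h0 := lt_le_trans ltr01 (hnorm_ge1 (Some (coding u))).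
  have s0 : 0 <= sdist (Some (coding u)) (Some (coding v)).
    have /andP[+ _] := sdist_bounds (Some (coding u)) (Some (coding v)); apply: le_trans.
    by rewrite mulr_ge0 ?chordal_ge0.
  rewrite -mulrA => h1 h2 h3.
  have := ler_wpM2r s0 h1; move: h2 h3; rewrite mulrAC.
  lra.
- by move=> u; exact: coding_limit_set.
Qed.

End Lower.
End Inversions.

(** * Circles orthogonal to the unit circle *)

Section OrthogonalInversion.
Context (R : realType).
Local Notation C := R[i].
Implicit Types (t : R) (c : C).

Lemma expiE t : expi t = Complex (cos t) (sin t). Proof. by []. Qed.

Lemma cos_half_bounds t : `|t| <= 2^-1 -> 3/4 <= cos t <= 1.
Proof.
move=> t2; rewrite cos_le1 andbT; have := cos_sub1_le t.
have : t ^+ 2 <= 4^-1.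
  by rewrite -real_normK ?num_real//; have := normr_ge0 t; move: t2; nra.
by move=> h /ler_normlP[]; lra.
Qed.

Lemma sin_half_bounds t : `|t| <= 2^-1 -> `|t| / 2 <= `|sin t| <= `|t|.
Proof.
move=> t2; rewrite norm_sin_le andbT.
have [t0|t0] := leP 0 t.
  rewrite ger0_norm// in t2 *; apply: le_trans (ler_norm _).
  by apply: sin_ge; rewrite t0.
rewrite ltr0_norm// in t2 *; rewrite -[leRHS]normrN -sinN; apply: le_trans (ler_norm _).
by apply: sin_ge; rewrite t2 oppr_ge0 ltW.
Qed.

Lemma tan_half_bounds t : `|t| <= 2^-1 -> `|t| / 2 <= `|tan t| <= 2 * `|t|.
Proof.
move=> t2; have /andP[c1 c2] := cos_half_bounds t2.
have /andP[s1 s2] := sin_half_bounds t2.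
have c0 : 0 < cos t by lra.
rewrite /tan normrM normfV (gtr0_norm c0) ler_pdivlMr// ler_pdivrMr//.
apply/andP; split.
  by rewrite (le_trans _ s1)// ler_piMr ?divr_ge0.
by apply: (le_trans s2); have := normr_ge0 t; nra.
Qed.

(** The tangents to the unit circle at [c * expi t] and [c * expi (- t)] meet here, at distance
    [|tan t|] from both points. *)
Definition orthogonal_center c t : C := c * real_complex R (cos t)^-1.

Lemma orthogonal_circleE c t : normc c = 1 -> t != 0 -> `|t| <= 2^-1 ->
  orthogonal_circle (c * expi t) (c * expi (- t)) = (orthogonal_center c t, `|tan t|).
Proof.
move=> c1 t0 t2.
have /andP[ct _] := cos_half_bounds t2; have C0 : cos t != 0 by rewrite gt_eqF//; lra.
have S0 : sin t != 0.
  rewrite -normr_gt0; have /andP[+ _] := sin_half_bounds t2; apply: lt_le_trans.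
  by rewrite divr_gt0 ?normr_gt0.
have cne : c != 0 by rewrite -normc_gt0 c1.
have CS : cos t ^+ 2 + sin t ^+ 2 = 1 := cos2Dsin2 t.
have ne1 x : normc (expi x) = 1 by rewrite /= cos2Dsin2 sqrtr1.
have np x : normc (c * expi x) = 1 by rewrite Normc.normcM c1 ne1 mulr1.
have pq : c * expi t != c * expi (- t).
  rewrite (inj_eq (mulfI cne)) !expiE cosN sinN eq_complex/= eqxx/=.
  by rewrite -subr_eq0 opprK -mulr2n mulrn_eq0.
have pq' : c * expi t + c * expi (- t) != 0.
  rewrite -mulrDr mulf_neq0// !expiE cosN sinN eq_complex/= negb_and.
  by rewrite -mulr2n mulrn_eq0/= C0.
have circ : is_orthogonal_circle (c * expi t) (c * expi (- t)) (orthogonal_center c t) `|tan t|.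
  have dist x : cos x = cos t -> sin x ^+ 2 = sin t ^+ 2 ->
      normc (c * expi x - orthogonal_center c t) = `|tan t|.
    move=> cx sx; rewrite /orthogonal_center -mulrBr Normc.normcM c1 mul1r.
    apply/eqP; rewrite -(@eqrXn2 _ 2) ?normc_ge0// normc_sq real_normK ?num_real//.
    rewrite /= oppr0 addr0 cx sx /tan; apply/eqP.
    have -> : (cos t - (cos t)^-1) ^+ 2 + sin t ^+ 2 =
        cos t ^+ 2 + sin t ^+ 2 - 2 + (cos t ^+ 2)^-1 by field.
    have S2 : sin t ^+ 2 = 1 - cos t ^+ 2 by rewrite -CS; ring.
    by rewrite CS expr_div_n S2; field.
  have perp x : cos x = cos t ->
      complex.Re ((c * expi x - orthogonal_center c t) * conjc (c * expi x)) = 0.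
    move=> cx.
    have cc : c * conjc c = 1.
      have := sqr_normc c; rewrite norm_normc c1 => <-; exact: expr1n.
    have ee : expi x * conjc (expi x) = 1.
      have := sqr_normc (expi x); rewrite norm_normc ne1 => <-; exact: expr1n.
    have -> : (c * expi x - orthogonal_center c t) * conjc (c * expi x) =
        (c * conjc c) * (expi x * conjc (expi x)) -
        (c * conjc c) * (real_complex R (cos t)^-1 * conjc (expi x)).
      by rewrite /orthogonal_center rmorphM/=; ring.
    by rewrite cc ee !mul1r /= cx mul0r subr0 mulVf// subrr.
  split.
  - by rewrite normr_gt0 /tan mulf_neq0 ?invr_eq0.
  - exact: dist.
  - by apply: dist; rewrite ?cosN// sinN sqrrN.
  - exact: perp.
  - by apply: perp; rewrite cosN.
have := is_orthogonal_circle_unique (np _) (np _) pq pq' circ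
  (orthogonal_circleP (np _) (np _) pq pq').
by case: (orthogonal_circle _ _) => a r [-> ->].
Qed.

End OrthogonalInversion.

(** * Disks and words of the reflection group at a real parameter *)

Section ReflectionGroup.
Context (R : realType) (g : nat) (c : 'I_g.+1 -> R[i]) (k : 'I_g.+1 -> nat).
Hypotheses (c1 : forall j, normc (c j) = 1) (c_inj : injective c)
  (k1 : forall j, (1 <= k j)%N).
Local Notation C := R[i].
Implicit Types (z : R) (i j : 'I_g.+1).

Definition half_angle z j : R := z ^+ k j / 2.
Definition disk_center z j : C := orthogonal_center (c j) (half_angle z j).
Definition disk_radius z j : R := `|tan (half_angle z j)|.

Lemma half_angle_bounds z j : z != 0 -> `|z| <= 1 ->
  [/\ half_angle z j != 0, `|half_angle z j| = `|z| ^+ k j / 2 &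
      `|half_angle z j| <= `|z| / 2].
Proof.
move=> z0 z1; split.
- by rewrite mulf_neq0 ?expf_neq0 ?invr_eq0.
- by rewrite /half_angle normrM normrX [X in _ * X]ger0_norm ?invr_ge0.
rewrite /half_angle normrM normrX [X in _ * X]ger0_norm ?invr_ge0// ler_wpM2r//.
by rewrite -[leRHS]expr1 ler_wiXn2l// k1.
Qed.

Lemma sigmaE z j : z != 0 -> `|z| <= 1 ->
  sigma c k z j = inversion (disk_center z j) (disk_radius z j).
Proof.
move=> z0 z1; have [h0 _ h1] := half_angle_bounds j z0 z1.
rewrite /sigma orthogonal_circleE//; apply: (le_trans h1).
by rewrite ler_piMl ?invr_ge0.
Qed.

(** The factor 4 leaves room for the centres: for [|z| < delta] each is within [delta / 2] of [c j],
    so a separation of [3 * delta] survives. *)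
Lemma center_separation : exists delta : R, 0 < delta <= 2^-1 /\
  forall i j, i != j -> 4 * delta <= normc (c i - c j).
Proof.
pose d := \big[Num.min/2^-1]_(p : 'I_g.+1 * 'I_g.+1 | p.1 != p.2) (normc (c p.1 - c p.2) / 4).
exists d; split.
  apply/andP; split; last exact: bigmin_le_id.
  apply: lt_bigmin => [|p pp]; first by rewrite invr_gt0.
  by rewrite divr_gt0// normc_gt0 subr_eq0 (inj_eq c_inj).
move=> i j ij; rewrite mulrC -ler_pdivlMr//.
exact: (@bigmin_le_cond _ _ _ _ (i, j) (fun p => p.1 != p.2) (fun p => normc (c p.1 - c p.2) / 4)).
Qed.

Lemma disk_configuration (delta : R) z : 0 < delta <= 2^-1 ->
  (forall i j, i != j -> 4 * delta <= normc (c i - c j)) -> z != 0 -> `|z| < delta ->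
  [/\ forall j, 0 < disk_radius z j,
      forall j, `|z| ^+ k j / 4 <= disk_radius z j <= `|z| ^+ k j,
      forall j, disk_radius z j < delta,
      forall j, normc (disk_center z j) <= 3/2 &
      forall i j, i != j -> 3 * delta <= normc (disk_center z i - disk_center z j)].
Proof.
move=> /andP[d0 d2] sep z0 zd.
have z1 : `|z| <= 1 by lra.
have zn0 : 0 < `|z| by rewrite normr_gt0.
have r_bounds j : `|z| ^+ k j / 4 <= disk_radius z j <= `|z| ^+ k j.
  have [h0 hE h1] := half_angle_bounds j z0 z1.
  have h2 : `|half_angle z j| <= 2^-1 by lra.
  have := tan_half_bounds h2; rewrite hE -/(disk_radius z j).
  by move: (`|z| ^+ k j) => X /andP[? ?]; apply/andP; split; lra.
have zk j : `|z| ^+ k j <= `|z| by rewrite -[leRHS]expr1 ler_wiXn2l// k1.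
have near_c j : normc (disk_center z j - c j) <= `|z| / 2.
  have [h0 hE h1] := half_angle_bounds j z0 z1.
  have h2 : `|half_angle z j| <= 2^-1 by lra.
  have /andP[C1 C2] := cos_half_bounds h2.
  rewrite /disk_center /orthogonal_center -{2}(mulr1 (c j)) -mulrBr Normc.normcM c1 mul1r.
  rewrite -(rmorph1 (real_complex R)) -rmorphB normc_real.
  set t := half_angle z j in h0 hE h1 h2 C1 C2 *.
  have ct0 : 0 < cos t by lra.
  have -> : (cos t)^-1 - 1 = (1 - cos t) / cos t by field; rewrite gt_eqF.
  rewrite normrM normfV (gtr0_norm ct0) ler_pdivrMr// distrC (le_trans (cos_sub1_le _))//.
  rewrite -real_normK ?num_real//; have := normr_ge0 t; move: h1 h2.
  move: (`|t|) => T h1 h2 T0.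
  have : T ^+ 2 <= 2^-1 * T by rewrite expr2 ler_wpM2r.
  nra.
split => //.
- by move=> j; have /andP[+ _] := r_bounds j; apply: lt_le_trans; rewrite divr_gt0// exprn_gt0.
- by move=> j; have /andP[_] := r_bounds j; have := zk j; move: (`|z| ^+ k j) => X; lra.
- move=> j; have := near_c j; have := normc_triangle (disk_center z j) (c j) 0.
  by rewrite !subr0 c1; lra.
- move=> i j ij; have := near_c i; have := near_c j; have := sep i j ij.
  have := normc_triangle (c i) (disk_center z i) (c j).
  have := normc_triangle (disk_center z i) (disk_center z j) (c j).
  by rewrite (normc_distC (c i) (disk_center z i)); lra.
Qed.

Lemma Gamma_words z f : z != 0 -> `|z| <= 1 -> (forall j, 0 < disk_radius z j) ->
  Gamma c k z f -> exists w, f =1 eval_word (disk_center z) (disk_radius z) w.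
Proof.
move=> z0 z1 r0; elim=> {f} [|f [j _ <-]|f h _ [v fv] _ [w hw]|f f' _ [w fw] ff' f'f].
- by exists [::].
- by exists [:: widen_ord (leqnSn g) j; ord_max] => x; rewrite /gamma/= !sigmaE.
- by exists (v ++ w) => x; rewrite eval_cat /= hw fv.
- exists (rev w) => x; apply: (can_inj ff').
  by rewrite f'f fw eval_revK.
Qed.

(** Letters are taken in pairs, [s i s j = (s i s_o) (s_o s j)] with [o] the last index: the first
    factor is a generator or the identity, the second the inverse of such an element. *)
Lemma Gamma_even_words z w : z != 0 -> `|z| <= 1 -> (forall j, 0 < disk_radius z j) ->
  ~~ odd (size w) -> Gamma c k z (eval_word (disk_center z) (disk_radius z) w).
Proof.
move=> z0 z1 r0.
pose s j := inversion (disk_center z j) (disk_radius z j).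
have sK j : involutive (s j) by exact: inversionK.
have to_max i : Gamma c k z (s i \o s ord_max).
  have [->|io] := eqVneq i ord_max.
    rewrite (_ : _ \o _ = id); first exact: generated_id.
    by apply/funext => x /=; rewrite sK.
  apply: generated_mem.
  have ig : (i < g)%N.
    by rewrite ltn_neqAle -ltnS ltn_ord andbT; apply: contra io => /eqP ?; apply/eqP/val_inj.
  exists (Ordinal ig) => //; rewrite /gamma !sigmaE//.
  by congr (s _ \o _); exact: val_inj.
have [n] := ubnP (size w); elim: n w => // n IH [|i [|j w]] //=.
  by move=> _ _; exact: generated_id.
rewrite negbK => wn wo.
rewrite (_ : (fun x => _) = (s i \o s ord_max) \o ((s ord_max \o s j) \o
    eval_word (disk_center z) (disk_radius z) w)); last first.
  by apply/funext => x /=; rewrite sK.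
apply: (@generated_comp _ _ (s i \o s ord_max)); first exact: to_max.
apply: (@generated_comp _ _ (s ord_max \o s j)); last by apply: IH => //; exact: ltnW wn.
exact (generated_inv (to_max j) (can_comp (sK j) (sK ord_max))
  (can_comp (sK ord_max) (sK j))).
Qed.

End ReflectionGroup.

(** * Asymptotics of the dimension *)

Section DimensionAsymptotics.
Context (R : realType).

Lemma near_dnbhs0 (P : R -> Prop) (r : R) : 0 < r ->
  (forall z, z != 0 -> `|z| < r -> P z) -> \forall z \near (0 : R)^', P z.
Proof.
move=> r0 H; exists r => //= z; rewrite /ball_ /= sub0r normrN => zr z0.
exact: H.
Qed.

Lemma near_dnbhs0_log (M : R) : \forall z \near (0 : R)^', M <= ln `|z^-1|.
Proof.
apply: (@near_dnbhs0 _ (expR (- M))); first exact: expR_gt0.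
move=> z z0 zM; have zn : 0 < `|z| by rewrite normr_gt0.
rewrite normfV lnV ?posrE// lerNr -[leRHS]expRK.
by rewrite ler_ln ?posrE ?expR_gt0// ltW.
Qed.

Lemma fraction_mono (x y : R) : 0 < x -> x <= y -> x / (1 + x) <= y / (1 + y).
Proof.
move=> x0 xy; have y0 : 0 < y by exact: lt_le_trans xy.
rewrite ler_pdivrMr ?addr_gt0// mulrAC ler_pdivlMr ?addr_gt0//.
by rewrite !mulrDr !mulr1 mulrC lerD2r.
Qed.

Lemma fraction_smono (x y : R) : 0 < x -> x < y -> x / (1 + x) < y / (1 + y).
Proof.
move=> x0 xy; have y0 : 0 < y by exact: lt_trans xy.
rewrite ltr_pdivrMr ?addr_gt0// mulrAC ltr_pdivlMr ?addr_gt0//.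
by rewrite !mulrDr !mulr1 mulrC ltrD2r.
Qed.

Context (g : nat) (c : 'I_g.+1 -> R[i]) (k : 'I_g.+1 -> nat).
Hypotheses (c1 : forall j, normc (c j) = 1) (c_inj : injective c)
  (k1 : forall j, (1 <= k j)%N).
Variable u : R.
Hypotheses (u01 : 0 < u < 1) (u_root : fraction_sum (fun j => u ^+ k j) = 1).

Local Notation dim z := (hausdorff_dim (@sdist R) (limit_set (Gamma c k z))).

Let u0 : 0 < u. Proof. by case/andP: u01. Qed.
Let lnu : ln u < 0. Proof. by rewrite ln_lt0. Qed.

Let powR_lnE (x d : R) : 0 < x -> x `^ d = expR (d * ln x).
Proof. by move=> x0; rewrite /powR gt_eqF. Qed.

Let expn_lnE n : u ^+ n = expR (n%:R * ln u).
Proof. by rewrite expRM_natl lnK ?posrE. Qed.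

(** With [lam = ln |1/z|], the logarithm of a contraction ratio is [- 2 k_j lam] up to a constant
    [A] or [B]. For [d] at the claimed bound, [d] times that constant is at most [eps], which the
    gain [k_j eps] compensates since [k_j >= 1]. So the powers lie on the right side of [u^(k_j)],
    and monotonicity of [x / (1 + x)] concludes. *)
Lemma dim_bounds (eps : R) : 0 < eps -> eps < - ln u ->
  \forall z \near (0 : R)^',
    (((- ln u - eps) / (2 * ln `|z^-1|))%:E <= dim z)%E /\
    (dim z <= ((- ln u + eps) / (2 * ln `|z^-1|))%:E)%E.
Proof.
move=> e0 eu; have [delta [d02 sep]] := center_separation c_inj.
have [d0 d2] := andP d02.
have nd : \forall z \near (0 : R)^', z != 0 /\ `|z| < delta.
  by apply: (near_dnbhs0 d0) => z.
pose A := ln (delta ^+ 2)^-1.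
have A0 : 0 <= A.
  rewrite ln_ge0// invf_ge1 ?exprn_gt0// expr_le1 ?ltW//.
  by rewrite (le_lt_trans d2)// invf_lt1// ltr1n.
(* [256 = 16 * 16]: one factor from [contraction_lower], the other the square of the 4 in the lower
   bound of the radius. *)
pose B : R := ln 256.
have B0 : 0 <= B by rewrite ln_ge0// ler1n.
near=> z.
have [z0 zd] : z != 0 /\ `|z| < delta by near: z.
have l1 : 1 <= ln `|z^-1| by near: z; exact: near_dnbhs0_log.
have lA : (- ln u + eps) * (A + 1) / eps <= ln `|z^-1| by near: z; exact: near_dnbhs0_log.
have lB : (- ln u) * B / eps <= ln `|z^-1| by near: z; exact: near_dnbhs0_log.
have lnz : ln `|z| = - ln `|z^-1| by rewrite normfV lnV ?opprK// posrE normr_gt0.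
set lam := ln `|z^-1| in l1 lA lB lnz *.
have lam0 : 0 < lam by exact: lt_le_trans l1.
have zn : 0 < `|z| by rewrite normr_gt0.
have z1 : `|z| <= 1 by rewrite (le_trans (ltW zd))// (le_trans d2)// invf_le1// ler1n.
have [r0 rb rd ac asep] := disk_configuration c1 k1 d02 sep z0 zd.
have ln_zk j : ln (`|z| ^+ k j) = - ((k j)%:R * lam).
  by rewrite lnXn// lnz mulNrn mulr_natl.
split.
- apply: hausdorff_dim_ge => d dp dlt.
  apply: (limit_set_measure_neq0 r0 rd d2 ac asep _ dp).
    by move=> w wo; exact: Gamma_even_words.
  rewrite -u_root; apply: ler_sum => j _; apply: fraction_mono; first exact: exprn_gt0.
  have l0 : 0 < contraction_lower (disk_radius k z) j by rewrite divr_gt0// exprn_gt0.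
  rewrite powR_lnE// expn_lnE ler_expR.
  have lnl : - (2 * (k j)%:R * lam + B) <= ln (contraction_lower (disk_radius k z) j).
    have zk0 : 0 < `|z| ^+ k j by rewrite exprn_gt0.
    have -> : - (2 * (k j)%:R * lam + B) = ln ((`|z| ^+ k j) ^+ 2 / 256).
      by rewrite lnM ?posrE ?invr_gt0 ?exprn_gt0// lnV ?posrE// -/B lnXn// ln_zk mulr2n; ring.
    rewrite ler_ln ?posrE ?divr_gt0 ?exprn_gt0//.
    have /andP[zr _] := rb j; rewrite /contraction_lower.
    have : (`|z| ^+ k j / 4) ^+ 2 <= disk_radius k z j ^+ 2.
      by rewrite ler_pXn2r ?nnegrE ?divr_ge0 ?(ltW zk0) ?(ltW (r0 j)).
    by move: (`|z| ^+ k j) (disk_radius k z j) => X Y; rewrite expr_div_n; lra.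
  apply: (@le_trans _ _ (d * - (2 * (k j)%:R * lam + B))); last by rewrite ler_wpM2l// ltW.
  have dd : d * (2 * lam) <= - ln u - eps.
    by rewrite -ler_pdivlMr ?mulr_gt0// ltW.
  have dB : d * B <= eps.
    have : d <= (- ln u) / lam.
      rewrite ler_pdivlMr//; have : 0 <= d * lam by rewrite mulr_ge0 ?ltW.
      by lra.
    move=> /(ler_wpM2r B0) h; apply: (le_trans h).
    by rewrite mulrAC ler_pdivrMr// -ler_pdivrMl// mulrC.
  have kj : 1 <= (k j)%:R :> R by rewrite ler1n.
  rewrite mulrN mulrDr lerNr.
  have -> : d * (2 * (k j)%:R * lam) = (k j)%:R * (d * (2 * lam)) by ring.
  have k0 : 0 <= (k j)%:R :> R by lra.
  have := ler_wpM2l k0 dd; have : eps <= (k j)%:R * eps by rewrite ler_peMl// ltW.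
  by lra.
- set d := _ / _.
  have dp : 0 < d by rewrite divr_gt0 ?mulr_gt0//; lra.
  apply: hausdorff_dim_le => //.
  apply: (limit_set_measure_eq0 r0 rd d2 ac asep) => //.
    by move=> f Gf; exact: Gamma_words Gf.
  rewrite -u_root.
  suff H j : contraction_upper (disk_radius k z) delta j `^ d < u ^+ k j.
    have L0 j : 0 < contraction_upper (disk_radius k z) delta j `^ d.
      by rewrite powR_gt0// divr_gt0 ?exprn_gt0.
    rewrite /fraction_sum (bigD1 ord0)//= [ltRHS](bigD1 ord0)//=.
    apply: ltr_leD; first exact: fraction_smono.
    by apply: ler_sum => j _; apply: fraction_mono => //; exact/ltW.
  have L0 : 0 < contraction_upper (disk_radius k z) delta j by rewrite divr_gt0 ?exprn_gt0.
  rewrite powR_lnE// expn_lnE ltr_expR.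
  have lnL : ln (contraction_upper (disk_radius k z) delta j) <= A - 2 * (k j)%:R * lam.
    have zk0 : 0 < `|z| ^+ k j by rewrite exprn_gt0.
    have -> : A - 2 * (k j)%:R * lam = ln ((`|z| ^+ k j) ^+ 2 / delta ^+ 2).
      by rewrite lnM ?posrE ?invr_gt0 ?exprn_gt0// -/A lnXn// ln_zk mulr2n; ring.
    rewrite ler_ln ?posrE ?divr_gt0 ?exprn_gt0//.
    have /andP[_ zr] := rb j; rewrite /contraction_upper ler_wpM2r ?invr_ge0 ?sqr_ge0//.
    by rewrite ler_pXn2r ?nnegrE ?(ltW zk0) ?(ltW (r0 j)).
  apply: (@le_lt_trans _ _ (d * (A - 2 * (k j)%:R * lam))); first by rewrite ler_wpM2l// ltW.
  have dd : d * (2 * lam) = - ln u + eps.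
    by rewrite /d divfK// gt_eqF// mulr_gt0.
  have dA : d * A < eps.
    have h : d * (A + 1) <= eps / 2.
      rewrite /d mulrAC ler_pdivrMr ?mulr_gt0//.
      have -> : eps / 2 * (2 * lam) = eps * lam by field.
      by rewrite -ler_pdivrMl// mulrC.
    by move: h; rewrite mulrDr mulr1; lra.
  have kj : 1 <= (k j)%:R :> R by rewrite ler1n.
  have -> : d * (A - 2 * (k j)%:R * lam) = d * A - (k j)%:R * (d * (2 * lam)) by ring.
  rewrite dd; have : eps <= (k j)%:R * eps by rewrite ler_peMl// ltW.
  by lra.
Unshelve. all: by end_near.
Qed.

Theorem dim_equiv :
  (fun z : R => fine (dim z)) ~_((0 : R)^') (fun z : R => (- ln u / (2 * ln `|z^-1|))%R).
Proof.
apply/eqaddoP => e e0.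
have lnu' : 0 < - ln u by rewrite oppr_gt0.
pose eps := Num.min (e * - ln u) (- ln u / 2).
have eps0 : 0 < eps by rewrite lt_min mulr_gt0// divr_gt0.
have epsu : eps < - ln u by rewrite gt_min; apply/orP; right; lra.
near=> z.
have [lo hi] : (((- ln u - eps) / (2 * ln `|z^-1|))%:E <= dim z)%E /\
    (dim z <= ((- ln u + eps) / (2 * ln `|z^-1|))%:E)%E.
  by near: z; exact: dim_bounds.
have l1 : 1 <= ln `|z^-1| by near: z; exact: near_dnbhs0_log.
have lam0 : 0 < 2 * ln `|z^-1| by rewrite mulr_gt0// (lt_le_trans _ l1).
(* The two real bounds rule out infinite values, so [fine] returns the dimension itself. *)
case E : (dim z) lo hi => [s| |]; rewrite ?leye_eq ?leeNy_eq// !lee_fin => lo hi.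
rewrite /= !fctE E /=.
move: lam0 lo hi; set X := 2 * _ => lam0 lo hi.
rewrite [X in _ <= _ * X]gtr0_norm ?divr_gt0// mulrA ler_pdivlMr//.
rewrite -[X in _ * X](gtr0_norm lam0) -normrM mulrBl divfK ?gt_eqF//.
move: lo hi; rewrite ler_pdivrMr// ler_pdivlMr// => lo hi.
have : eps <= e * - ln u by rewrite ge_min lexx.
by rewrite ler_norml; move=> h; apply/andP; split; lra.
Unshelve. all: by end_near.
Qed.

End DimensionAsymptotics.

(** * From the polynomial to the eigenvalue equation *)

Section LargestRoot.
Context (R : realType) (g : nat) (hg : (2 <= g)%N).

(** The polynomial is negative at 0 and positive on [[1, oo)], so it has a root in [[0, 1]] and the
    largest one is in [(0, 1)]. With [X = u^m] and [Y = u^n], the polynomial times [g] is the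
    numerator of [g X / (1 + X) + Y / (1 + Y) - 1]. *)
Lemma largest_root (m n : nat) (u : R) : (1 <= m)%N ->
  let P : {poly R} := 'X^(m + n) + (1 - g%:R^-1) *: 'X^m - (g%:R^-1)%:P in
  root P u -> (forall v, root P v -> v <= u) ->
  0 < u < 1 /\ g%:R * (u ^+ m / (1 + u ^+ m)) + u ^+ n / (1 + u ^+ n) = 1.
Proof.
move=> m1 P Pu uP.
have g2 : 2 <= g%:R :> R by rewrite ler_nat.
have g0 : 0 < g%:R :> R by lra.
have gi : 0 < (g%:R^-1 : R) <= 2^-1 by rewrite invr_gt0 g0/= lef_pV2 ?posrE.
have PE x : P.[x] = x ^+ (m + n) + (1 - g%:R^-1) * x ^+ m - g%:R^-1.
  by rewrite /P !hornerE ?hornerXn.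
have P0 : P.[0] < 0.
  by rewrite PE expr0n addn_eq0 expr0n eqn0Ngt m1/= mulr0 addr0 sub0r; lra.
have P1 x : 1 <= x -> 0 < P.[x].
  move=> x1; rewrite PE; have := exprn_ege1 (m + n) x1; have := exprn_ege1 m x1.
  by move: (x ^+ m) (x ^+ (m + n)) => X Y; nra.
have [x /andP[x0 x1] /(uP _) xu] : exists2 x, 0 <= x <= 1 & root P x.
  by apply: (@poly_ivt R P 0 1) => //; rewrite (ltW P0) (ltW (P1 _ _)).
have u0 : 0 < u.
  rewrite lt_neqAle (le_trans x0 xu) andbT; apply/eqP => u0.
  by move: Pu P0; rewrite -u0 /root => /eqP ->; rewrite ltxx.
have u1 : u < 1.
  by rewrite ltNge; apply/negP => /P1; move: Pu; rewrite /root => /eqP ->; rewrite ltxx.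
split; first by rewrite u0.
move: Pu; rewrite /root PE exprD => /eqP.
have : 0 < u ^+ m by rewrite exprn_gt0. have : 0 < u ^+ n by rewrite exprn_gt0.
move: (u ^+ m) (u ^+ n) => X Y Y0 X0 E.
have E' : g%:R * (X * Y) + (g%:R - 1) * X - 1 = 0.
  have : g%:R * (X * Y + (1 - g%:R^-1) * X - g%:R^-1) = 0 by rewrite E mulr0.
  by move=> <-; field; rewrite gt_eqF.
have X1 : 1 + X != 0 by rewrite gt_eqF// addr_gt0.
have Y1 : 1 + Y != 0 by rewrite gt_eqF// addr_gt0.
apply/eqP; rewrite -subr_eq0; apply/eqP.
transitivity ((g%:R * (X * Y) + (g%:R - 1) * X - 1) / ((1 + X) * (1 + Y))).
  by field; rewrite X1 Y1.
by rewrite E' mul0r.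
Qed.

End LargestRoot.

(** * Complex derivatives and germs *)

Section ComplexDerivatives.
Context (R : realType).
Local Notation C := R[i].
Local Notation Co := (R[i])^o.
Implicit Types (f h : C -> C) (w z : C).

(** [R[i]^o] is normed over [R[i]], so the derivative in direction 1 is the complex derivative. *)
Definition cderivable f w := derivable (f : Co -> Co) w 1.

Lemma cderivableM f h w : cderivable f w -> cderivable h w ->
  cderivable (fun z => f z * h z) w.
Proof. exact: derivableM. Qed.

Lemma cderivableD f h w : cderivable f w -> cderivable h w ->
  cderivable (fun z => f z + h z) w.
Proof. exact: derivableD. Qed.

Lemma cderivableN f w : cderivable f w -> cderivable (fun z => - f z) w.
Proof. exact: derivableN. Qed.

Lemma cderivableV f w : f w != 0 -> cderivable f w -> cderivable (fun z => (f z)^-1) w.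
Proof. exact: derivableV. Qed.

Lemma cderivable_cst a w : cderivable (fun=> a) w.
Proof. exact: derivable_cst. Qed.

Lemma cderivable_id w : cderivable (fun z => z) w.
Proof. exact: derivable_id. Qed.

Lemma cderivableX f n w : cderivable f w -> cderivable (fun z => f z ^+ n) w.
Proof.
move=> fw; elim: n => [|n IH]; first exact: cderivable_cst.
under eq_fun do rewrite exprS; exact: cderivableM.
Qed.

Lemma cderivable_comp f h w : cderivable h w -> cderivable f (h w) ->
  cderivable (fun z => f (h z)) w.
Proof.
move=> hw fhw.
have dh := (derivable1_diffP (h : Co -> Co) w).1 hw.
have df := (derivable1_diffP (f : Co -> Co) (h w)).1 fhw.
apply: (derivable1_diffP ((fun z => f (h z)) : Co -> Co) w).2.
exact: (@differentiable_comp _ Co Co Co (h : Co -> Co) (f : Co -> Co) w dh df).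
Qed.

Lemma cderivable_continuous f w : cderivable f w ->
  (f : Co -> Co) z @[z --> (w : Co)] --> (f w : Co).
Proof. by move=> /derivable1_diffP fw; exact: differentiable_continuous. Qed.

Lemma near_cderivable f h w : (\forall z \near (w : Co), f z = h z) ->
  cderivable f w -> cderivable h w.
Proof.
by move=> fh; apply: (@near_eq_derivable _ Co Co (f : Co -> Co) (h : Co -> Co) w 1).
Qed.

Lemma near_normcP (P : C -> Prop) w :
  (\forall z \near (w : Co), P z) <-> exists2 e : R, 0 < e & forall z, normc (z - w) < e -> P z.
Proof.
split=> [[e /= e0 H]|[e e0 H]].
- move: e0; rewrite ltcE /= => /andP[/eqP e1 e0].
  exists (complex.Re e) => // z zw; apply: H; rewrite /ball_ /= distrC norm_normc ltcE /=.
  by rewrite e1 eqxx.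
- exists (real_complex R e); first by rewrite /= ltcR.
  by move=> z /=; rewrite distrC norm_normc ltcR; exact: H.
Qed.

Lemma near0_normcP (P : C -> Prop) :
  (\forall z \near (0 : Co)^', P z) <->
  exists2 e : R, 0 < e & forall z, 0 < normc z < e -> P z.
Proof.
split=> [[e /= e0 H]|[e e0 H]].
- move: e0; rewrite ltcE /= => /andP[/eqP e1 e0].
  exists (complex.Re e) => // z /andP[z0 zw]; apply: H; last by rewrite -normc_gt0.
  by rewrite /ball_ /= sub0r normrN norm_normc ltcE /= e1 eqxx.
- exists (real_complex R e); first by rewrite /= ltcR.
  move=> z /=; rewrite sub0r normrN norm_normc ltcR => ze z0.
  by apply: H; rewrite normc_gt0 z0.
Qed.

(** A quadratic Taylor remainder gives differentiability; this is the entry point for the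
    exponential, the cardinal sine at 0 and the square root. *)
Lemma cderivable_quadratic f w (d : C) (K e : R) : 0 < e ->
  (forall t, normc t < e -> normc (f (w + t) - f w - d * t) <= K * normc t ^+ 2) ->
  cderivable f w.
Proof.
move=> e0 H; apply/cvg_ex; exists d; apply/cvgrPdist_lt => eps.
rewrite ltcE /= => /andP[/eqP eps1 eps0].
have K0 : 0 < `|K| + 1 by rewrite ltr_wpDl.
apply/near0_normcP; exists (Num.min e (complex.Re eps / (`|K| + 1))).
  by rewrite lt_min e0 divr_gt0.
move=> t /andP[t0]; rewrite lt_min => /andP[te]; rewrite ltr_pdivlMr// => tK.
have tn0 : t != 0 by rewrite -normc_gt0.
rewrite norm_normc ltcE /= eps1 eqxx /=.
have -> : d - t^-1 *: (f (t *: 1 + w) - f w) = - ((f (w + t) - f w - d * t) / t).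
  by rewrite /GRing.scale/= mulr1 [t + w]addrC; field.
rewrite normcN Normc.normcM Normc.normcV ltr_pdivrMr//.
apply: (le_lt_trans (H _ te)); rewrite expr2 mulrA ltr_pM2r// mulrC.
apply: le_lt_trans tK; rewrite ler_wpM2l ?normc_ge0//.
by rewrite (le_trans (ler_norm K))// lerDl.
Qed.

Lemma cderivable_near f w (e : R) : cderivable f w -> 0 < e ->
  \forall z \near (w : Co), normc (f z - f w) < e.
Proof.
move=> /cderivable_continuous /cvgrPdist_lt H e0.
have /H : (0 : C) < real_complex R e by rewrite ltcR.
by apply: filterS => z; rewrite distrC norm_normc ltcR.
Qed.

Lemma cderivable_neq0 f w : cderivable f w -> f w != 0 ->
  \forall z \near (w : Co), f z != 0.
Proof.
move=> fw fw0; have n0 : 0 < normc (f w) by rewrite normc_gt0.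
apply: filterS (cderivable_near fw n0) => z; apply: contraTneq => ->.
by rewrite sub0r normcN ltxx.
Qed.

End ComplexDerivatives.

(** * Complex exponential, cosine, cardinal sine and square root *)

Section ComplexExponential.
Context (R : realType).
Local Notation C := R[i].
Local Notation Co := (R[i])^o.
Local Notation ii := (Complex 0 1 : C).
Implicit Types (w z : C).

Definition cexp z : C := real_complex R (expR (complex.Re z)) * expi (complex.Im z).

Lemma cexpD z w : cexp (z + w) = cexp z * cexp w.
Proof.
case: z w => [a b] [c d]; rewrite /cexp /expi /= expRD cosD sinD.
by apply/eqP; rewrite eq_complex /=; apply/andP; split; apply/eqP; ring.
Qed.

Lemma cexp0 : cexp 0 = 1.
Proof. by rewrite /cexp /expi /= expR0 cos0 sin0 mul1r. Qed.

(** The third order is what differentiating [csin z / z] at 0 requires. The constant is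
    [(4 + 4 + 2) + (4 + 4)], from the real and imaginary parts. *)
Lemma cexp_cubic z : normc z <= 1 ->
  normc (cexp z - 1 - z - z ^+ 2 / 2) <= 18 * normc z ^+ 3.
Proof.
move=> z1; have n0 := normc_ge0 z; have xz := norm_Re_le z; have yz := norm_Im_le z.
case: z z1 n0 xz yz => x y; set n := normc _ => z1 n0 xn yn.
rewrite /= in xn yn.
have x1 : `|x| <= 1 by lra.
have half : (2 : C)^-1 = real_complex R 2^-1 by rewrite fmorphV rmorph_nat.
have reE : complex.Re (cexp (Complex x y) - 1 - Complex x y - Complex x y ^+ 2 / 2) =
    (expR x - 1 - x - x ^+ 2 / 2) + expR x * (cos y - 1 + y ^+ 2 / 2) -
    (expR x - 1) * (y ^+ 2 / 2).
  by rewrite half /cexp /expi expr2 /=; ring.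
have imE : complex.Im (cexp (Complex x y) - 1 - Complex x y - Complex x y ^+ 2 / 2) =
    expR x * (sin y - y) + (expR x - 1 - x) * y.
  by rewrite half /cexp /expi expr2 /=; field.
have ex := expR_norm_le x1.
have xn2 : `|x| ^+ 2 <= n ^+ 2 by rewrite ler_pXn2r ?nnegrE.
have xn3 : `|x| ^+ 3 <= n ^+ 3 by rewrite ler_pXn2r ?nnegrE.
have yn2 : `|y| ^+ 2 <= n ^+ 2 by rewrite ler_pXn2r ?nnegrE.
have yn3 : `|y| ^+ 3 <= n ^+ 3 by rewrite ler_pXn2r ?nnegrE.
have yn4 : `|y| ^+ 4 <= n ^+ 3.
  by rewrite exprSr (le_trans _ yn3)// ler_piMr ?exprn_ge0//; lra.
have b1 : `|expR x - 1 - x - x ^+ 2 / 2| <= 4 * n ^+ 3.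
  by rewrite (le_trans (expR_sub3_le x1))// ler_wpM2l.
have b2 : `|expR x * (cos y - 1 + y ^+ 2 / 2)| <= 4 * n ^+ 3.
  by rewrite normrM ler_pM// (le_trans (cos_sub2_le y)).
have b3 : `|(expR x - 1) * (y ^+ 2 / 2)| <= 2 * n ^+ 3.
  rewrite normrM (_ : 2 * n ^+ 3 = (4 * n) * (n ^+ 2 / 2)); last by field.
  apply: ler_pM => //; first by rewrite (le_trans (expR_sub1_le x1))// ler_wpM2l.
  by rewrite normrM normrX [X in _ * X]ger0_norm ?invr_ge0// ler_wpM2r ?invr_ge0.
have b4 : `|expR x * (sin y - y)| <= 4 * n ^+ 3.
  by rewrite normrM ler_pM// (le_trans (sin_subid_le y)).
have b5 : `|(expR x - 1 - x) * y| <= 4 * n ^+ 3.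
  rewrite normrM [n ^+ 3]exprSr mulrA ler_pM//.
  by rewrite (le_trans (expR_sub2_le x1))// ler_wpM2l.
rewrite (le_trans (normc_le_ReIm _))// reE imE.
have := ler_normB (expR x - 1 - x - x ^+ 2 / 2 + expR x * (cos y - 1 + y ^+ 2 / 2))
  ((expR x - 1) * (y ^+ 2 / 2)).
have := ler_normD (expR x - 1 - x - x ^+ 2 / 2) (expR x * (cos y - 1 + y ^+ 2 / 2)).
have := ler_normD (expR x * (sin y - y)) ((expR x - 1 - x) * y).
by move: b1 b2 b3 b4 b5; move: (n ^+ 3) => N; lra.
Qed.

Lemma cexp_quadratic z : normc z <= 1 -> normc (cexp z - 1 - z) <= 19 * normc z ^+ 2.
Proof.
move=> z1; have c3 := cexp_cubic z1.
have n0 := normc_ge0 z.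
have z32 : normc z ^+ 3 <= normc z ^+ 2 by rewrite exprSr ler_piMr ?exprn_ge0.
have h : normc (z ^+ 2 / 2) <= normc z ^+ 2.
  rewrite expr2 !Normc.normcM Normc.normcV -expr2 ler_piMr ?exprn_ge0//.
  have -> : (2 : C) = real_complex R 2 by rewrite rmorph_nat.
  by rewrite normc_real ger0_norm// invf_le1// ler1n.
have := le_normcD (cexp z - 1 - z - z ^+ 2 / 2) (z ^+ 2 / 2); rewrite subrK.
by move: (normc z ^+ 2) (normc z ^+ 3) z32 h c3 => N M; lra.
Qed.

Lemma cderivable_cexp w : cderivable cexp w.
Proof.
apply: (@cderivable_quadratic _ _ _ (cexp w) (normc (cexp w) * 19) 1) => // t /ltW t1.
rewrite cexpD (_ : _ - _ = cexp w * (cexp t - 1 - t)); last by ring.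
by rewrite Normc.normcM -mulrA ler_wpM2l ?normc_ge0// cexp_quadratic.
Qed.

Definition ccos z : C := (cexp (ii * z) + cexp (- (ii * z))) / 2.
Definition csin z : C := (cexp (ii * z) - cexp (- (ii * z))) / (2 * ii).

Let i_neq0 : ii != 0. Proof. by rewrite eq_complex /= oner_eq0 andbF. Qed.
Let ii2 : ii * ii = -1. Proof. by rewrite -expr2 sqr_i. Qed.

Lemma ccos2Dcsin2 z : ccos z ^+ 2 + csin z ^+ 2 = 1.
Proof.
have E : cexp (ii * z) * cexp (- (ii * z)) = 1 by rewrite -cexpD subrr cexp0.
rewrite /ccos /csin !expr_div_n exprMn [ii ^+ 2]expr2 ii2.
transitivity (cexp (ii * z) * cexp (- (ii * z))); last by [].
by field.
Qed.

Lemma ccos_real (t : R) : ccos (real_complex R t) = real_complex R (cos t).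
Proof.
rewrite /ccos; have -> : ii * real_complex R t = Complex 0 t.
  by apply/eqP; rewrite eq_complex /=; apply/andP; split; apply/eqP; ring.
have -> : - Complex 0 t = Complex 0 (- t) :> C by rewrite /GRing.opp/= oppr0.
rewrite /cexp /expi /= expR0 cosN sinN.
apply: (mulIf (_ : (2 : C) != 0)); first by rewrite pnatr_eq0.
rewrite divfK ?pnatr_eq0// -(rmorph_nat (real_complex R)) -rmorphM.
by apply/eqP; rewrite eq_complex /=; apply/andP; split; apply/eqP; ring.
Qed.

Let cderivable_cexp_i (e : C) w : cderivable (fun z => cexp (e * z)) w.
Proof.
apply: (cderivable_comp (f := cexp) (h := fun z => e * z)); last exact: cderivable_cexp.
exact (cderivableM (@cderivable_cst R e w) (@cderivable_id R w)).
Qed.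

Lemma cderivable_ccos w : cderivable ccos w.
Proof.
rewrite (_ : ccos = fun z => (cexp (ii * z) + cexp (- ii * z)) * 2^-1); last first.
  by apply/funext => z; rewrite /ccos mulNr.
exact (cderivableM (cderivableD (@cderivable_cexp_i _ w) (@cderivable_cexp_i _ w))
  (@cderivable_cst R _ w)).
Qed.

Lemma cderivable_csin w : cderivable csin w.
Proof.
rewrite (_ : csin = fun z => (cexp (ii * z) + - cexp (- ii * z)) * (2 * ii)^-1); last first.
  by apply/funext => z; rewrite /csin mulNr.
exact (cderivableM (cderivableD (@cderivable_cexp_i _ w) (cderivableN (@cderivable_cexp_i _ w)))
  (@cderivable_cst R _ w)).
Qed.

Lemma csin_cubic z : normc z <= 1 -> normc (csin z - z) <= 18 * normc z ^+ 3.
Proof.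
move=> z1; have n1 : normc (ii * z) = normc z.
  by rewrite Normc.normcM /= expr0n expr1n add0r sqrtr1 mul1r.
have h1 := @cexp_cubic (ii * z); rewrite n1 in h1.
have h2 := @cexp_cubic (- (ii * z)); rewrite normcN n1 in h2.
have -> : csin z - z = ((cexp (ii * z) - 1 - ii * z - (ii * z) ^+ 2 / 2) -
    (cexp (- (ii * z)) - 1 - - (ii * z) - (- (ii * z)) ^+ 2 / 2)) / (2 * ii).
  by rewrite /csin; move: (cexp _) (cexp _) => a b; field.
rewrite Normc.normcM Normc.normcV.
have -> : normc (2 * ii) = 2.
  have two : (2 : C) = real_complex R 2 by rewrite rmorph_nat.
  by rewrite Normc.normcM two normc_real ger0_norm//= expr0n expr1n add0r sqrtr1 mulr1.
rewrite ler_pdivrMr//; have := h1 z1; have := h2 z1.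
set P := cexp _ - _ - _ - _; set Q := cexp _ - _ - _ - _.
have := le_normcD Q (- P); rewrite normcN; lra.
Qed.

(** An entire function that turns the zero of the sine at 0 into an explicit factor, from which
    orders at 0 are read off. *)
Definition csinc z : C := if z == 0 then 1 else csin z / z.

Lemma csincE z : csin z = z * csinc z.
Proof.
rewrite /csinc; case: eqVneq => [->|z0]; last by rewrite mulrC divfK.
by rewrite mul0r /csin mulr0 oppr0 subrr mul0r.
Qed.

Lemma csinc0 : csinc 0 = 1. Proof. by rewrite /csinc eqxx. Qed.

Lemma cderivable_csinc w : cderivable csinc w.
Proof.
have [->|w0] := eqVneq w 0.
  apply: (@cderivable_quadratic _ _ _ 0 18 1) => // t /ltW t1.
  rewrite add0r mul0r subr0 csinc0; have [->|t0] := eqVneq t 0.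
    by rewrite csinc0 subrr Normc.normc0 expr0n/= mulr0.
  rewrite -(@ler_pM2r _ (normc t)) ?normc_gt0// -mulrA -exprSr.
  by rewrite -Normc.normcM mulrBl mul1r [_ * t]mulrC -csincE csin_cubic.
apply: (@near_cderivable _ (fun z => csin z / z)).
  have := cderivable_neq0 (@cderivable_id R w) w0.
  by apply: filterS => z; rewrite /csinc => /negbTE ->.
apply: cderivableM; first exact: cderivable_csin.
by apply: cderivableV => //; exact: cderivable_id.
Qed.

Lemma sqrt_branch_exists : exists S : C -> C, forall z, S z ^+ 2 = z /\ 0 <= complex.Re (S z).
Proof.
have /choice[S HS] : forall z : C, exists s : C, s ^+ 2 = z /\ 0 <= complex.Re s; last by exists S.
move=> z; have [s sz] : exists s : C, s ^+ 2 = z by exists (sqrtC z); exact: sqrtCK.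
have [s0|s0] := leP 0 (complex.Re s); first by exists s.
exists (- s); rewrite sqrrN; split => //.
by case: s s0 {sz} => a b /= /ltW; rewrite oppr_ge0.
Qed.

Definition csqrt : C -> C := projT1 (cid sqrt_branch_exists).

Lemma csqrtK z : csqrt z ^+ 2 = z.
Proof. by case: (projT2 (cid sqrt_branch_exists) z). Qed.

Lemma Re_csqrt_ge0 z : 0 <= complex.Re (csqrt z).
Proof. by case: (projT2 (cid sqrt_branch_exists) z). Qed.

Lemma Re_csqrt_gt0 z : 0 < complex.Re z -> 0 < complex.Re (csqrt z).
Proof.
move=> z0; rewrite lt_neqAle Re_csqrt_ge0 andbT eq_sym; apply: contraTneq z0 => s0.
rewrite -(csqrtK z); case: (csqrt z) s0 => a b; rewrite expr2 /= => ->.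
by rewrite mul0r sub0r -leNgt oppr_le0 -expr2 sqr_ge0.
Qed.

Lemma csqrt_real (x : R) : 0 < x -> csqrt (real_complex R (x ^+ 2)) = real_complex R x.
Proof.
move=> x0; apply/eqP; have := csqrtK (real_complex R (x ^+ 2)).
rewrite rmorphXn => /eqP; rewrite eqf_sqr => /orP[//|/eqP E].
have := Re_csqrt_ge0 (real_complex R (x ^+ 2)); rewrite rmorphXn E /=.
by rewrite oppr_ge0 leNgt x0.
Qed.

(** With [s] the root of [w] and [D] the increment of the root, [t = D (2 s + D)] and the Taylor
    remainder is [- D^2 / (2 s)]. Since [2 s + D] is the sum of two roots of non-negative real part,
    its modulus is at least [Re s], which bounds [D] by a multiple of [t]. *)
Lemma cderivable_csqrt w : 0 < complex.Re w -> cderivable csqrt w.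
Proof.
move=> w0; have s0 := Re_csqrt_gt0 w0; set s := csqrt w in s0.
have sn0 : 0 < normc s by rewrite (lt_le_trans s0)// (le_trans (ler_norm _))// norm_Re_le.
have sne : s != 0 by rewrite -normc_gt0.
set r := complex.Re s in s0.
apply: (@cderivable_quadratic _ _ _ (2 * s)^-1 ((r ^+ 2)^-1 / normc (2 * s)) 1) => // t _.
pose D := csqrt (w + t) - s.
have tE : t = D * (2 * s + D).
  have -> : t = csqrt (w + t) ^+ 2 - s ^+ 2 by rewrite !csqrtK addrC addKr.
  by rewrite /D; ring.
have -> : csqrt (w + t) - csqrt w - (2 * s)^-1 * t = - (D ^+ 2) / (2 * s).
  by rewrite -/s -/D {1}tE; field.
have rD : r <= normc (2 * s + D).
  apply: le_trans (norm_Re_le _); apply: le_trans (ler_norm _).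
  have -> : 2 * s + D = s + csqrt (w + t) by rewrite /D; ring.
  have := Re_csqrt_ge0 (w + t); rewrite /r.
  by case: (s) (csqrt (w + t)) => a b [c d] /= h; rewrite lerDl.
rewrite Normc.normcM Normc.normcV normcN mulrAC ler_wpM2r ?invr_ge0 ?normc_ge0//.
rewrite ler_pdivlMl ?exprn_gt0// expr2 Normc.normcM -expr2 -exprMn.
rewrite ler_pXn2r ?nnegrE ?mulr_ge0 ?normc_ge0 ?(ltW s0)//.
by rewrite [in leRHS]tE Normc.normcM mulrC ler_wpM2l ?normc_ge0.
Qed.

End ComplexExponential.

(** * Holomorphic germs and orders at 0 *)

Section Germs.
Context (R : realType).
Local Notation C := R[i].
Local Notation Co := (R[i])^o.
Implicit Types (f h : C -> C) (w z : C) (m n : int).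

Local Notation hol f := (holomorphic_at f 0).

Lemma holomorphic_entire f : (forall w, cderivable f w) -> hol f.
Proof. by move=> H; apply/near_normcP; exists 1 => // w _; exact: H. Qed.

Lemma holomorphic_derivable f : hol f -> cderivable f 0.
Proof. exact: nbhs_singleton. Qed.

Lemma holomorphic_cst (a : C) : hol (fun=> a).
Proof. by apply: holomorphic_entire => w; exact: cderivable_cst. Qed.

Lemma holomorphicD f h : hol f -> hol h -> hol (fun z => f z + h z).
Proof. by move=> F H; apply: filterS2 F H => z; exact: cderivableD. Qed.

Lemma holomorphicN f : hol f -> hol (fun z => - f z).
Proof. by apply: filterS => z; exact: cderivableN. Qed.

Lemma holomorphicB f h : hol f -> hol h -> hol (fun z => f z - h z).
Proof. by move=> F /holomorphicN; exact: holomorphicD. Qed.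

Lemma holomorphicM f h : hol f -> hol h -> hol (fun z => f z * h z).
Proof. by move=> F H; apply: filterS2 F H => z; exact: cderivableM. Qed.

Lemma holomorphicX f (n : nat) : hol f -> hol (fun z => f z ^+ n).
Proof. by apply: filterS => z; exact: cderivableX. Qed.

Lemma holomorphicV f : hol f -> f 0 != 0 -> hol (fun z => (f z)^-1).
Proof.
move=> F f0; apply: filterS2 F (cderivable_neq0 (holomorphic_derivable F) f0) => z fz fz0.
exact: cderivableV.
Qed.

Lemma holomorphic_div f h : hol f -> hol h -> h 0 != 0 -> hol (fun z => f z / h z).
Proof. by move=> F H h0; exact (holomorphicM F (holomorphicV H h0)). Qed.

Lemma holomorphic_csqrt f : hol f -> 0 < complex.Re (f 0) -> hol (fun z => csqrt (f z)).
Proof.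
move=> F f0; apply: filterS2 F (cderivable_near (holomorphic_derivable F) f0) => z fz fz0.
suff H : cderivable (@csqrt R) (f z) by exact (cderivable_comp (f := @csqrt R) fz H).
apply: cderivable_csqrt; have := le_lt_trans (norm_Re_le _) fz0.
by case: (f z) (f 0) f0 => a b [c d] /= c0 /ltr_normlP[]; lra.
Qed.

Lemma holomorphic_near f (e : R) : hol f -> 0 < e ->
  \forall z \near (0 : Co), normc (f z - f 0) < e.
Proof. by move=> /holomorphic_derivable; exact: cderivable_near. Qed.

Lemma holomorphic_neq0 f : hol f -> f 0 != 0 -> \forall z \near (0 : Co), f z != 0.
Proof. by move=> /holomorphic_derivable; exact: cderivable_neq0. Qed.

Lemma near_punctured (P : C -> Prop) : (\forall z \near (0 : Co), P z) ->
  \forall z \near (0 : Co)^', P z.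
Proof.
move=> /near_normcP[e e0 H]; apply/near0_normcP; exists e => // z /andP[_ ze].
by apply: H; rewrite subr0.
Qed.

Lemma near_neq0 : \forall z \near (0 : Co)^', z != 0.
Proof. by apply/near0_normcP; exists 1 => // z /andP[+ _]; rewrite normc_gt0. Qed.

Lemma holomorphic_expn (n : nat) : hol (fun z => z ^+ n).
Proof.
apply: holomorphic_entire => w.
exact (@cderivableX R (fun z => z) n w (@cderivable_id R w)).
Qed.

Lemma order_near f h m : (\forall z \near (0 : Co)^', f z = h z) ->
  order_at0 h m -> order_at0 f m.
Proof.
move=> fh [u [U u0 hu]]; exists u; split => //.
by apply: filterS2 fh hu => z -> .
Qed.

Lemma order_holomorphic f : hol f -> f 0 != 0 -> order_at0 f 0.
Proof. by move=> F f0; exists f; split => //; apply: nearW => z; rewrite expr0z mul1r. Qed.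

Lemma orderM f h m n : order_at0 f m -> order_at0 h n -> order_at0 (fun z => f z * h z) (m + n).
Proof.
move=> [u [U u0 fu]] [v [V v0 hv]]; exists (fun z => u z * v z); split.
- exact (holomorphicM U V).
- by rewrite mulf_neq0.
- apply: filterS3 near_neq0 fu hv => z z0 -> ->.
  by rewrite expfzDr// mulrACA.
Qed.

Lemma orderV f m : order_at0 f m -> order_at0 (fun z => (f z)^-1) (- m).
Proof.
move=> [u [U u0 fu]]; exists (fun z => (u z)^-1); split.
- exact (holomorphicV U u0).
- by rewrite invr_eq0.
- by apply: filterS fu => z ->; rewrite invfM invr_expz.
Qed.

Lemma order_div f h m n : order_at0 f m -> order_at0 h n ->
  order_at0 (fun z => f z / h z) (m - n).
Proof. by move=> F /orderV; exact: orderM. Qed.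

Lemma order_neq0 f m : order_at0 f m -> \forall z \near (0 : Co)^', f z != 0.
Proof.
move=> [u [U u0 fu]].
apply: filterS3 near_neq0 fu (near_punctured (holomorphic_neq0 U u0)) => z z0 -> uz.
by rewrite mulf_neq0// expfz_neq0.
Qed.

Lemma order_cderivable f m : order_at0 f m -> \forall z \near (0 : Co)^', cderivable f z.
Proof.
move=> [u [U _ fu]].
have /near0_normcP[e1 e10 H1] := near_punctured U.
have /near0_normcP[e2 e20 H2] := fu.
apply/near0_normcP; exists (Num.min e1 e2); first by rewrite lt_min e10.
move=> z /andP[z0]; rewrite lt_min => /andP[ze1 ze2].
apply: (@near_cderivable _ (fun z => z ^ m * u z)).
  (* The normal form holds only off 0, hence a ball around [z] that avoids 0. *)
  apply/near_normcP; exists (Num.min (normc z) (e2 - normc z)).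
    by rewrite lt_min z0 subr_gt0.
  move=> w; rewrite lt_min => /andP[w1 w2]; rewrite H2//; apply/andP; split.
    rewrite normc_gt0; apply: contraTneq w1 => ->.
    by rewrite sub0r normcN ltxx.
  by have := normc_triangle w z 0; rewrite !subr0; lra.
apply: (cderivableM (f := fun z => z ^ m) (h := u)); last by apply: H1; rewrite z0.
case: m {fu H2} => n; first exact: (@cderivableX R (fun z => z) n z (@cderivable_id R z)).
apply: (cderivableV (f := fun z => z ^+ n.+1)); first by rewrite expf_neq0// -normc_gt0.
exact (@cderivableX R (fun z => z) n.+1 z (@cderivable_id R z)).
Qed.

Lemma order_meromorphic f m : order_at0 f m -> meromorphic_at0 f.
Proof.
move=> [u [U _ fu]]; case: m fu => n fu.
- exists 0%N, (fun z => z ^+ n * u z); split.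
    exact (holomorphicM (@holomorphic_expn n) U).
  by apply: filterS fu => z ->; rewrite expr0 mul1r.
- exists n.+1, u; split => //; apply: filterS2 near_neq0 fu => z z0 ->.
  by rewrite mulrA divff ?mul1r// expf_neq0.
Qed.

Lemma order_gt0_small f m : 0 < m -> order_at0 f m -> forall e : R, 0 < e ->
  \forall z \near (0 : Co)^', normc (f z) < e.
Proof.
case: m => // n n0 [u [U _ fu]] e e0.
have n1 : (0 < n)%N by [].
have H := holomorphic_near (f := fun z => z ^+ n * u z) _ e0.
have : \forall z \near (0 : Co), normc (z ^+ n * u z - 0 ^+ n * u 0) < e.
  exact (H (holomorphicM (@holomorphic_expn n) U)).
move=> /near_punctured Hz; apply: filterS2 fu Hz => z ->.
by rewrite expr0n gtn_eqF// mul0r subr0.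
Qed.

Lemma near_real (P : C -> Prop) : (\forall z \near (0 : Co)^', P z) ->
  \forall x \near (0 : R)^', P (real_complex R x).
Proof.
move=> /near0_normcP[e e0 H]; apply: (@near_dnbhs0 _ _ e e0) => x x0 xe.
by apply: H; rewrite normc_real normr_gt0 x0.
Qed.

End Germs.

(** * Moebius transformations *)

Section Mobius.
Context (R : realType).
Local Notation C := R[i].
Implicit Types (x y u v : P1 R) (M N : 'M[C]_2).

Lemma mulmx2E m n (A : 'M[C]_(m, 2)) (B : 'M[C]_(2, n)) i j :
  (A *m B) i j = A i ord0 * B ord0 j + A i ord_max * B ord_max j.
Proof.
rewrite mxE !big_ord_recl big_ord0 addr0; congr (_ + A i _ * B _ j); exact: val_inj.
Qed.

Lemma hvecE x : hvec x ord0 ord0 = hx x /\ hvec x ord_max ord0 = hy x.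
Proof. by rewrite !mxE. Qed.

Lemma ord2P (P : 'I_2 -> Prop) : P ord0 -> P ord_max -> forall i, P i.
Proof.
move=> P0 P1 [[|[|//]] i2].
- by rewrite (_ : Ordinal i2 = ord0)//; exact: val_inj.
- by rewrite (_ : Ordinal i2 = ord_max)//; exact: val_inj.
Qed.

Lemma cV2P (v w : 'cV[C]_2) : v ord0 ord0 = w ord0 ord0 ->
  v ord_max ord0 = w ord_max ord0 -> v = w.
Proof. by move=> h0 h1; apply/matrixP; apply: ord2P => j; rewrite (ord1 j). Qed.

Lemma det_mx2 M : \det M = M ord0 ord0 * M ord_max ord_max - M ord0 ord_max * M ord_max ord0.
Proof.
rewrite (expand_det_row _ ord0) !big_ord_recl big_ord0 addr0.
have -> : lift ord0 ord0 = ord_max :> 'I_2 by exact: val_inj.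
rewrite /cofactor !det_mx11 !mxE /= expr0 expr1 mul1r mulN1r mulrN.
by congr (_ * M _ _ - _ * M _ _); exact: val_inj.
Qed.

Lemma mobiusP M x (a : C) y : a != 0 -> M *m hvec x = a *: hvec y -> mobius M x = y.
Proof.
move=> a0 E; rewrite /mobius E !mxE; case: y E => [z|] _ /=.
  by rewrite mulr1 (negbTE a0) mulrAC divff ?mul1r.
by rewrite mulr0 eqxx.
Qed.

Lemma hvec_neq0 x : hvec x != 0.
Proof.
apply/eqP => /matrixP H; case: x H => [z|] H.
- by have := H ord_max ord0; rewrite !mxE /= => /eqP; rewrite oner_eq0.
- by have := H ord0 ord0; rewrite !mxE /= => /eqP; rewrite oner_eq0.
Qed.

Lemma mobius_hvec M x : M \in unitmx ->
  exists2 a : C, a != 0 & M *m hvec x = a *: hvec (mobius M x).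
Proof.
move=> Mu; set v := M *m hvec x.
have v0 : v != 0.
  apply: contra (hvec_neq0 x) => /eqP v0.
  by rewrite -[hvec x](mulKmx Mu) -/v v0 mulmx0.
rewrite /mobius -/v; case: (eqVneq (v ord_max ord0) 0) => [v1|v1].
- exists (v ord0 ord0).
    by apply: contra v0 => /eqP v00; apply/eqP/cV2P; rewrite ?v00 ?v1 mxE.
  by apply: cV2P; rewrite [RHS]mxE [hvec _ _ _]mxE /= ?mulr1 ?mulr0.
- exists (v ord_max ord0) => //.
  by apply: cV2P; rewrite [RHS]mxE [hvec _ _ _]mxE /= ?mulr1// mulrC divfK.
Qed.

Lemma mobius_comp M N x : M \in unitmx -> N \in unitmx ->
  mobius (M *m N) x = mobius M (mobius N x).
Proof.
move=> Mu Nu; have [a a0 aE] := mobius_hvec x Nu.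
have [b b0 bE] := mobius_hvec (mobius N x) Mu.
apply: (@mobiusP _ _ (a * b)); first by rewrite mulf_neq0.
rewrite -mulmxA.
rewrite aE.
rewrite -(scalemxAr a M (hvec (mobius N x))).
rewrite bE.
exact: scalerA.
Qed.

Lemma mobius1 x : mobius 1%:M x = x.
Proof. by apply: (@mobiusP _ _ 1); rewrite ?oner_neq0// mul1mx scale1r. Qed.

Lemma mobiusK M : M \in unitmx -> cancel (mobius M) (mobius (invmx M)).
Proof. by move=> Mu x; rewrite -mobius_comp ?unitmx_inv// mulVmx// mobius1. Qed.

Lemma mobiusKV M : M \in unitmx -> cancel (mobius (invmx M)) (mobius M).
Proof. by move=> Mu x; rewrite -mobius_comp ?unitmx_inv// mulmxV// mobius1. Qed.

Lemma koebe_conj M P (al be : P1 R) (y : C) : P \in unitmx ->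
  koebe_coordinates M al be y ->
  koebe_coordinates (P *m M *m invmx P) (mobius P al) (mobius P be) y.
Proof.
move=> Pu [Mu [lam [mu [Ma Mb lm yE]]]]; split.
  by rewrite !unitmx_mul Pu Mu unitmx_inv.
have conjE x (t : C) : M *m hvec x = t *: hvec x ->
    P *m M *m invmx P *m hvec (mobius P x) = t *: hvec (mobius P x).
  move=> Mx; have [a a0 aE] := mobius_hvec x Pu.
  apply: (scalerI a0).
  have -> : a *: (P *m M *m invmx P *m hvec (mobius P x)) =
      P *m M *m invmx P *m (a *: hvec (mobius P x)).
    exact: scalemxAr.
  rewrite -aE.
  rewrite -!mulmxA (mulmxA (invmx P)) mulVmx//.
  rewrite mul1mx Mx.
  rewrite -(scalemxAr t P (hvec x)).
  rewrite aE.
  rewrite [LHS]scalerA [RHS]scalerA.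
  by rewrite mulrC.
by exists lam, mu; split => //; exact: conjE.
Qed.

Lemma mobius_coords M x : M \in unitmx -> exists a : C,
  [/\ a != 0, M ord0 ord0 * hx x + M ord0 ord_max * hy x = a * hx (mobius M x) &
      M ord_max ord0 * hx x + M ord_max ord_max * hy x = a * hy (mobius M x)].
Proof.
move=> Mu; have [a a0 aE] := mobius_hvec x Mu; exists a.
have E i : M i ord0 * hvec x ord0 ord0 + M i ord_max * hvec x ord_max ord0 =
    a * hvec (mobius M x) i ord0.
  by rewrite -mulmx2E aE [LHS]mxE.
by have := E ord0; have := E ord_max; rewrite !(hvecE _).1 !(hvecE _).2; split.
Qed.

(** [hdet] is the determinant of two homogeneous coordinate vectors, so [M] multiplies it by
    [\det M]; [f] records the rescaling back to the chosen representatives. In a cross-ratio all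
    these factors cancel. *)
Lemma hdet_mobius M : M \in unitmx -> exists2 f : P1 R -> C, (forall z, f z != 0) &
  forall x y, f x * f y * hdet (mobius M x) (mobius M y) = \det M * hdet x y.
Proof.
move=> /mobius_coords H; have /choice[f Hf] := fun x => H x.
exists f => [z|x y]; first by case: (Hf z).
have [_ x0 x1] := Hf x; have [_ y0 y1] := Hf y.
rewrite /hdet mulrBr.
have mE a b p q : a * b * (p * q) = a * p * (b * q) :> C by exact: mulrACA.
have e1 := mE (f x) (f y) (hx (mobius M x)) (hy (mobius M y)).
have e2 : f x * f y * (hx (mobius M y) * hy (mobius M x)) =
    (f y * hx (mobius M y)) * (f x * hy (mobius M x)).
  by rewrite (mulrC (f x) (f y)); exact: mE.
apply: (etrans (congr2 (fun a b : C => a - b) e1 e2)).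
rewrite -y1 -y0 -x1 -x0 det_mx2.
move: (M ord0 ord0) (M ord0 ord_max) (M ord_max ord0) (M ord_max ord_max).
by move: (hx x) (hx y) (hy x) (hy y) => a b c d m1 m2 m3 m4; ring.
Qed.

Lemma cross_ratio_mobius M u v x y : M \in unitmx ->
  cross_ratio (mobius M u) (mobius M v) (mobius M x) (mobius M y) = cross_ratio u v x y.
Proof.
move=> Mu; have [f f0 fE] := hdet_mobius Mu.
have d0 : \det M != 0 by rewrite -unitfE -unitmxE.
have hE a b : hdet (mobius M a) (mobius M b) = \det M / (f a * f b) * hdet a b.
  have fab : f a * f b != 0 by rewrite mulf_neq0.
  by apply: (mulfI fab); rewrite fE; field; rewrite !f0.
have K0 : \det M ^+ 2 / (f u * f v * f x * f y) != 0.
  by rewrite mulf_neq0 ?expf_neq0// invr_eq0 !mulf_neq0.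
pose mul2 := fun a b : C => a * b.
apply: (etrans (congr2 (fun a b : C => a / b) (congr2 mul2 (hE u x) (hE v y))
  (congr2 mul2 (hE u y) (hE v x)))).
rewrite /mul2 /cross_ratio.
move: (hdet u x) (hdet v y) (hdet u y) (hdet v x) => a b c d.
have -> : \det M / (f u * f x) * a * (\det M / (f v * f y) * b) =
    \det M ^+ 2 / (f u * f v * f x * f y) * (a * b) by field; rewrite !f0.
have -> : \det M / (f u * f y) * c * (\det M / (f v * f x) * d) =
    \det M ^+ 2 / (f u * f v * f x * f y) * (c * d) by field; rewrite !f0.
by rewrite -mulf_div divff// mul1r.
Qed.

Lemma cross_ratio_Some (a b c d : C) :
  cross_ratio (Some a) (Some b) (Some c) (Some d) = (a - c) * (b - d) / ((a - d) * (b - c)).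
Proof. by rewrite /cross_ratio /hdet /= !mulr1. Qed.

Lemma closed_disk_mobius M N : M \in unitmx -> N \in unitmx ->
  closed_disk (M *m N) = mobius M @` closed_disk N.
Proof.
move=> Mu Nu; rewrite /closed_disk; move: [set Some z | z in _] => D.
by rewrite image_comp; congr image; apply/funext => x; exact: mobius_comp.
Qed.

Lemma open_disk_mobius M N : M \in unitmx -> N \in unitmx ->
  open_disk (M *m N) = mobius M @` open_disk N.
Proof.
move=> Mu Nu; rewrite /open_disk; move: [set Some z | z in _] => D.
by rewrite image_comp; congr image; apply/funext => x; exact: mobius_comp.
Qed.

Lemma schottky_conj g (gam : 'I_g -> P1 R -> P1 R) M : M \in unitmx ->
  schottky_generators gam ->
  schottky_generators (fun i => mobius M \o gam i \o mobius (invmx M)).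
Proof.
move=> Mu [N [Nu Nd Ng]]; exists (fun e => M *m N e); split.
- by move=> e; rewrite unitmx_mul Mu Nu.
- move=> e e' ee'; rewrite (closed_disk_mobius Mu (Nu e)) (closed_disk_mobius Mu (Nu e')).
  apply/seteqP; split => // x.
  move=> [[y Ny yx] [y' Ny' yx']].
  have yy' : y = y' by apply: (can_inj (mobiusK Mu)); rewrite yx yx'.
  have : (closed_disk (N e) `&` closed_disk (N e')) y.
    by split; [exact: Ny|rewrite yy'; exact: Ny'].
  by rewrite (Nd _ _ ee').
- move=> i; rewrite (closed_disk_mobius Mu (Nu _)) (open_disk_mobius Mu (Nu _)) -(Ng i).
  apply/seteqP; split => [_ [x Nx <-]|_ [_ [x Nx <-] <-]] /=.
    exists (gam i (mobius (invmx M) x)) => //; exists (mobius (invmx M) x) => // xN.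
    by apply: Nx; exists (mobius (invmx M) x) => //; exact: mobiusKV.
  exists (mobius M x); last by rewrite mobiusK.
  by move=> [x' Nx' /(can_inj (mobiusK Mu)) xx']; apply: Nx; rewrite -xx'.
Qed.

Lemma generated_conj (S : set (P1 R -> P1 R)) (p q : P1 R -> P1 R) :
  cancel p q -> cancel q p ->
  [set p \o f \o q | f in generated S] = generated [set p \o f \o q | f in S].
Proof.
move=> pq qp; apply/seteqP; split => [_ [f Gf <-]|f Gf].
- elim: Gf => {f} [|f Sf|f h _ IHf _ IHh|f f' _ IH ff' f'f].
  + rewrite (_ : _ \o _ = id); first exact: generated_id.
    by apply/funext => x /=; rewrite qp.
  + by apply: generated_mem; exists f.
  + rewrite (_ : _ \o _ = (p \o f \o q) \o (p \o h \o q)); first exact: (generated_comp IHf IHh).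
    by apply/funext => x /=; rewrite pq.
  + apply: (generated_inv IH) => x /=; first by rewrite pq ff' qp.
    by rewrite pq f'f qp.
- elim: Gf => {f} [|_ [f Sf <-]|_ _ _ [f Gf <-] _ [h Gh <-]|_ f' _ [f Gf <-] ff' f'f].
  + by exists id; [exact: generated_id|apply/funext => x /=; rewrite qp].
  + by exists f => //; exact: generated_mem.
  + exists (f \o h); first exact: (generated_comp Gf Gh).
    by apply/funext => x /=; rewrite pq.
  + exists (q \o f' \o p); last by apply/funext => x /=; rewrite !qp.
    apply: (generated_inv Gf) => x /=.
    * by have := ff' (p x); rewrite /= pq => ->; rewrite pq.
    * by apply: (can_inj pq); have := f'f (p x).
Qed.

End Mobius.

(** * Koebe coordinates of the generators *)

Section KoebeFunctions.
Context (R : realType) (g : nat) (c : 'I_g.+1 -> R[i]) (k : 'I_g.+1 -> nat).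
Hypotheses (c1 : forall j, normc (c j) = 1) (c_inj : injective c)
  (k1 : forall j, (1 <= k j)%N).
Local Notation C := R[i].
Local Notation Co := (R[i])^o.
Local Notation hol f := (holomorphic_at f 0).
Local Notation w i := (widen_ord (leqnSn g) i).
Local Notation o := (@ord_max g).
Implicit Types (z : C) (j : 'I_g.+1) (i : 'I_g).

Let cb j : C := conjc (c j).

Let c_cb j : c j * cb j = 1.
Proof. by rewrite /cb -sqr_normc norm_normc c1 rmorph1 expr1n. Qed.

Definition angle j z : C := z ^+ k j / 2.
Definition cos_angle j z : C := ccos (angle j z).
(** The square of the sine of [z^(k j) / 2], in a form that displays its order at 0. *)
Definition sin2_angle j z : C := z ^+ (2 * k j) * (csinc (angle j z) ^+ 2 / 4).

Lemma sin2_angleE j z : sin2_angle j z = 1 - cos_angle j z ^+ 2.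
Proof.
have := ccos2Dcsin2 (angle j z); rewrite csincE addrC => /(canRL (addrK _)).
rewrite /cos_angle => <-; rewrite /sin2_angle /angle mulnC exprM.
by move: (csinc (z ^+ k j / 2)) (z ^+ k j) => s t; field.
Qed.

Lemma angle0 j : angle j 0 = 0.
Proof. by rewrite /angle expr0n gtn_eqF ?k1// mul0r. Qed.

Lemma cos_angle0 j : cos_angle j 0 = 1.
Proof. by rewrite /cos_angle angle0 -(rmorph0 (real_complex R)) ccos_real cos0 rmorph1. Qed.

Lemma sin2_angle0 j : sin2_angle j 0 = 0.
Proof. by rewrite sin2_angleE cos_angle0 expr1n subrr. Qed.

Lemma cderivable_angle j z : cderivable (angle j) z.
Proof.
exact (cderivableM (@cderivableX R (fun z => z) (k j) z (@cderivable_id R z))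
  (@cderivable_cst R _ z)).
Qed.

Lemma holomorphic_cos_angle j : hol (cos_angle j).
Proof.
apply: holomorphic_entire => z.
exact (cderivable_comp (f := @ccos R) (@cderivable_angle j z) (@cderivable_ccos R _)).
Qed.

Lemma holomorphic_csinc_angle j : hol (fun z => csinc (angle j z)).
Proof.
apply: holomorphic_entire => z.
exact (cderivable_comp (f := @csinc R) (@cderivable_angle j z) (@cderivable_csinc R _)).
Qed.

Lemma holomorphic_sin2_angle j : hol (sin2_angle j).
Proof.
exact (holomorphicM (@holomorphic_expn R (2 * k j))
  (holomorphicM (@holomorphicX R _ 2 (holomorphic_csinc_angle j)) (@holomorphic_cst R _))).
Qed.

Lemma order_sin2_angle j : order_at0 (sin2_angle j) (2 * k j)%N%:Z.
Proof.
exists (fun z => csinc (angle j z) ^+ 2 / 4); split.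
- exact (holomorphicM (@holomorphicX R _ 2 (holomorphic_csinc_angle j)) (@holomorphic_cst R _)).
- by rewrite angle0 csinc0 expr1n mul1r invr_eq0 pnatr_eq0.
- by apply: nearW => z.
Qed.

(* The matrix [[mA, mB], [mC, mD]] represents [gamma], its determinant is [mdet];
   [eigL] and [eigS] are its eigenvalues of larger and smaller modulus. *)
Definition mA i z : C := c (w i) * cb o - cos_angle (w i) z * cos_angle o z.
Definition mB i z : C := cos_angle (w i) z * c o - c (w i) * cos_angle o z.
Definition mC i z : C := cos_angle (w i) z * cb o - cb (w i) * cos_angle o z.
Definition mD i z : C := cb (w i) * c o - cos_angle (w i) z * cos_angle o z.
Definition mdet i z : C := sin2_angle (w i) z * sin2_angle o z.
Definition eigL i z : C :=
  (mA i z + mD i z - csqrt ((mA i z + mD i z) ^+ 2 - 4 * mdet i z)) / 2.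
Definition eigS i z : C := mdet i z / eigL i z.
Definition attr i z : C := (mA i z - eigS i z) / mC i z.
Definition rep_coef i z : C :=
  (sin2_angle (w i) z / eigL i z - cos_angle (w i) z / cos_angle o z) / mC i z.
(* All repelling points tend to [c ord_max]; this form exhibits the common
   factor [sin2_angle ord_max] of their differences. *)
Definition rep i z : C := c o / cos_angle o z + sin2_angle o z * rep_coef i z.
Definition multiplier i z : C := mdet i z / eigL i z ^+ 2.

Lemma mdetE i z : mA i z * mD i z - mB i z * mC i z = mdet i z.
Proof.
rewrite /mA /mB /mC /mD /mdet !sin2_angleE.
move: (cos_angle (w i) z) (cos_angle o z) => x y.
have e1 := c_cb (w i); have e2 := c_cb o.
transitivity ((c (w i) * cb (w i)) * (c o * cb o) + x ^+ 2 * y ^+ 2 -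
  x ^+ 2 * (c o * cb o) - y ^+ 2 * (c (w i) * cb (w i))); first by ring.
by rewrite e1 e2; ring.
Qed.

Section Eigen.
Variables (i : 'I_g) (z : C).
Hypotheses (L0 : eigL i z != 0) (C0 : mC i z != 0) (cos0 : cos_angle o z != 0).

Lemma eigLM : eigL i z * eigS i z = mdet i z.
Proof. by rewrite /eigS mulrC divfK. Qed.

Lemma eigLD : eigL i z + eigS i z = mA i z + mD i z.
Proof.
apply: (mulfI L0); rewrite mulrDr eigLM.
have := csqrtK ((mA i z + mD i z) ^+ 2 - 4 * mdet i z).
rewrite /eigL.
move: (csqrt ((mA i z + mD i z) ^+ 2 - 4 * mdet i z)) => s.
move: (mA i z + mD i z) (mdet i z) => t d sE.
have -> : d = (t ^+ 2 - s ^+ 2) / 4 by rewrite sE; field.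
by field.
Qed.

(** The second row of the eigenvector equation is the definition of the point; the first then
    follows from the trace and the determinant. *)
Lemma attr_eigen :
  mA i z * attr i z + mB i z = eigL i z * attr i z /\ mC i z * attr i z + mD i z = eigL i z.
Proof.
have E1 := eigLD; have E2 := eigLM; have E3 := mdetE i z.
have attrC : mC i z * attr i z = mA i z - eigS i z by rewrite /attr mulrC divfK.
split; last by rewrite attrC addrAC -E1 addrK.
apply: (mulfI C0); rewrite mulrDr.
rewrite (mulrCA (mC i z) (mA i z)) (mulrCA (mC i z) (eigL i z)) attrC (mulrC (mC i z) (mB i z)).
move: E1 E2 E3; move: (mA i z) (mB i z) (mC i z) (mD i z) (mdet i z) (eigL i z) (eigS i z).
move=> A B CC D d l m E1 E2 E3; have -> : B * CC = A * D - d by rewrite -E3; ring.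
have -> : D = l + m - A by rewrite E1; ring.
by rewrite -E2; ring.
Qed.

(** Recovers the usual eigenvector formula from the split form, by [c o * cb o = 1] and
    [sin^2 = 1 - cos^2]. *)
Lemma repE : rep i z = (eigS i z - mD i z) / mC i z.
Proof.
apply: (mulIf C0); rewrite divfK//.
transitivity (c o / cos_angle o z * mC i z +
    sin2_angle o z * (sin2_angle (w i) z / eigL i z - cos_angle (w i) z / cos_angle o z)).
  by rewrite /rep /rep_coef mulrDl -(mulrA (sin2_angle o z)) divfK.
rewrite /eigS /mdet /mC /mD (sin2_angleE o z).
have e2 := c_cb o; move: L0 cos0; move: (eigL i z) => l l0.
move: (cos_angle o z) (cos_angle (w i) z) (sin2_angle (w i) z) => y x t y0.
transitivity ((c o * cb o) * x / y - c o * cb (w i) + (1 - y ^+ 2) * (t / l - x / y)).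
  by move: (cb o) (cb (w i)) => b b'; field; rewrite l0 y0.
rewrite e2; move: (cb (w i)) => b; field; by rewrite l0 y0.
Qed.

Lemma rep_eigen :
  mA i z * rep i z + mB i z = eigS i z * rep i z /\ mC i z * rep i z + mD i z = eigS i z.
Proof.
have E1 := eigLD; have E2 := eigLM; have E3 := mdetE i z.
have repC : mC i z * rep i z = eigS i z - mD i z by rewrite repE mulrC divfK.
split; last by rewrite repC subrK.
apply: (mulfI C0); rewrite mulrDr.
rewrite (mulrCA (mC i z) (mA i z)) (mulrCA (mC i z) (eigS i z)) repC (mulrC (mC i z) (mB i z)).
move: E1 E2 E3; move: (mA i z) (mB i z) (mC i z) (mD i z) (mdet i z) (eigL i z) (eigS i z).
move=> A B CC D d l m E1 E2 E3; have -> : B * CC = A * D - d by rewrite -E3; ring.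
have -> : A = l + m - D by rewrite E1; ring.
by rewrite -E2; ring.
Qed.

Lemma multiplierE : multiplier i z = eigS i z / eigL i z.
Proof. by rewrite /multiplier /eigS expr2 invfM mulrA. Qed.

End Eigen.

Let w_neq i : w i != o.
Proof. by rewrite -(inj_eq val_inj) /= ltn_eqF. Qed.

Let w_inj : injective (widen_ord (leqnSn g)).
Proof. by move=> x y /(congr1 val) /= xy; exact: val_inj. Qed.

Let chord i : R := normc (c (w i) - c o).
Let chord_gt0 i : 0 < chord i.
Proof. by rewrite normc_gt0 subr_eq0 (inj_eq c_inj). Qed.

Lemma mAD0 i : mA i 0 + mD i 0 = - real_complex R (chord i ^+ 2).
Proof.
rewrite rmorphXn /= -norm_normc sqr_normc rmorphB -!/(cb _).
rewrite /mA /mD !cos_angle0 mulrBr !mulrBl c_cb c_cb; ring.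
Qed.

Lemma mC0 i : mC i 0 != 0.
Proof.
rewrite /mC !cos_angle0 mul1r mulr1 subr_eq0; apply: contra (w_neq i) => /eqP E.
by apply/eqP/c_inj/esym/(can_inj (@conjcK R)).
Qed.

Lemma mdet0 i : mdet i 0 = 0.
Proof. by rewrite /mdet sin2_angle0 mul0r. Qed.

(** The trace at 0 is a negative real and the chosen root of its square is positive, so the minus
    sign in [eigL] adds the two terms instead of cancelling them. *)
Lemma eigL0 i : eigL i 0 = - real_complex R (chord i ^+ 2).
Proof.
rewrite /eigL mAD0 mdet0 mulr0 subr0 sqrrN -rmorphXn csqrt_real ?exprn_gt0//.
by field.
Qed.

Lemma eigL0_neq0 i : eigL i 0 != 0.
Proof. by rewrite eigL0 oppr_eq0 fmorph_eq0 gt_eqF// exprn_gt0. Qed.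

Lemma attr0 i : attr i 0 = c (w i).
Proof.
apply: (mulIf (mC0 i)); rewrite /attr divfK ?mC0// /eigS mdet0 mul0r subr0.
by rewrite /mA /mC !cos_angle0 !mul1r !mulr1 mulrBr c_cb.
Qed.

Lemma rep0 i : rep i 0 = c o.
Proof. by rewrite /rep sin2_angle0 mul0r addr0 cos_angle0 divr1. Qed.

Lemma rep_coef0 i : rep_coef i 0 = (cb (w i) - cb o)^-1.
Proof.
rewrite /rep_coef sin2_angle0 mul0r sub0r /mC !cos_angle0 divr1 mul1r mulr1 mulN1r.
by rewrite -invrN opprB.
Qed.

Lemma holomorphic_mA i : hol (mA i).
Proof.
exact (holomorphicB (@holomorphic_cst R _)
  (holomorphicM (holomorphic_cos_angle _) (holomorphic_cos_angle _))).
Qed.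

Lemma holomorphic_mD i : hol (mD i).
Proof.
exact (holomorphicB (@holomorphic_cst R _)
  (holomorphicM (holomorphic_cos_angle _) (holomorphic_cos_angle _))).
Qed.

Lemma holomorphic_mC i : hol (mC i).
Proof.
exact (holomorphicB (holomorphicM (holomorphic_cos_angle _) (@holomorphic_cst R _))
  (holomorphicM (@holomorphic_cst R _) (holomorphic_cos_angle _))).
Qed.

Lemma holomorphic_mdet i : hol (mdet i).
Proof. exact (holomorphicM (holomorphic_sin2_angle _) (holomorphic_sin2_angle _)). Qed.

Lemma holomorphic_eigL i : hol (eigL i).
Proof.
have hT := holomorphicD (holomorphic_mA i) (holomorphic_mD i).
have hD : hol (fun z => (mA i z + mD i z) ^+ 2 - 4 * mdet i z).
  exact (holomorphicB (@holomorphicX R _ 2 hT)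
    (holomorphicM (@holomorphic_cst R _) (holomorphic_mdet i))).
have hS : hol (fun z => csqrt ((mA i z + mD i z) ^+ 2 - 4 * mdet i z)).
  apply: (holomorphic_csqrt hD).
  by rewrite mAD0 mdet0 mulr0 subr0 sqrrN -rmorphXn /= !exprn_gt0.
exact (holomorphicM (holomorphicB hT hS) (@holomorphic_cst R _)).
Qed.

Lemma holomorphic_eigS i : hol (eigS i).
Proof. exact (holomorphic_div (holomorphic_mdet i) (holomorphic_eigL i) (eigL0_neq0 i)). Qed.

Lemma holomorphic_attr i : hol (attr i).
Proof.
exact (holomorphic_div (holomorphicB (holomorphic_mA i) (holomorphic_eigS i))
  (holomorphic_mC i) (mC0 i)).
Qed.

Lemma cos_angle0_neq0 j : cos_angle j 0 != 0.
Proof. by rewrite cos_angle0 oner_neq0. Qed.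

Lemma holomorphic_rep_coef i : hol (rep_coef i).
Proof.
exact (holomorphic_div (holomorphicB
    (holomorphic_div (holomorphic_sin2_angle _) (holomorphic_eigL i) (eigL0_neq0 i))
    (holomorphic_div (holomorphic_cos_angle _) (holomorphic_cos_angle _) (cos_angle0_neq0 _)))
  (holomorphic_mC i) (mC0 i)).
Qed.

Lemma holomorphic_rep i : hol (rep i).
Proof.
exact (holomorphicD
  (holomorphic_div (@holomorphic_cst R _) (holomorphic_cos_angle _) (cos_angle0_neq0 _))
  (holomorphicM (holomorphic_sin2_angle _) (holomorphic_rep_coef i))).
Qed.

Lemma order_attr_attr i i' : i != i' -> order_at0 (fun z => attr i z - attr i' z) 0.
Proof.
move=> ii'; apply: order_holomorphic.
  exact (holomorphicB (holomorphic_attr i) (holomorphic_attr i')).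
by rewrite !attr0 subr_eq0 (inj_eq c_inj) (inj_eq w_inj).
Qed.

Lemma order_attr_rep i i' : order_at0 (fun z => attr i z - rep i' z) 0.
Proof.
apply: order_holomorphic.
  exact (holomorphicB (holomorphic_attr i) (holomorphic_rep i')).
by rewrite attr0 rep0 subr_eq0 (inj_eq c_inj).
Qed.

Lemma order_rep_attr i i' : order_at0 (fun z => rep i z - attr i' z) 0.
Proof.
apply: order_holomorphic.
  exact (holomorphicB (holomorphic_rep i) (holomorphic_attr i')).
by rewrite attr0 rep0 subr_eq0 (inj_eq c_inj) eq_sym.
Qed.

(** The terms [c o / cos] cancel, leaving [sin^2] times a difference of coefficients that at 0 are
    the distinct numbers [1 / (cb (w i) - cb o)]. *)
Lemma order_rep_rep i i' : i != i' ->
  order_at0 (fun z => rep i z - rep i' z) (2 * k o)%N%:Z.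
Proof.
move=> ii'; rewrite -[_%:Z]addr0.
apply: (@order_near _ _ (fun z => sin2_angle o z * (rep_coef i z - rep_coef i' z))).
  by apply: nearW => z; rewrite /rep; ring.
apply: orderM; first exact: order_sin2_angle.
apply: order_holomorphic.
  exact (holomorphicB (holomorphic_rep_coef i) (holomorphic_rep_coef i')).
rewrite !rep_coef0 subr_eq0 (inj_eq invr_inj) (inj_eq (addIr _)).
by rewrite (inj_eq (can_inj (@conjcK R))) (inj_eq c_inj) (inj_eq w_inj).
Qed.

Lemma order_multiplier i : order_at0 (multiplier i) ((2 * k (w i))%N%:Z + (2 * k o)%N%:Z).
Proof.
rewrite -[X in order_at0 _ X]subr0.
apply: (@order_div _ (mdet i) (fun z => eigL i z ^+ 2)).
  exact (orderM (order_sin2_angle _) (order_sin2_angle _)).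
apply: order_holomorphic; first exact (@holomorphicX R _ 2 (holomorphic_eigL i)).
by rewrite expf_neq0// eigL0_neq0.
Qed.

Lemma near_eigen i : \forall z \near (0 : Co)^',
  [/\ eigL i z != 0, mC i z != 0, cos_angle o z != 0, mdet i z != 0 &
      normc (eigS i z) < normc (eigL i z)].
Proof.
have n1 := near_punctured (holomorphic_neq0 (holomorphic_eigL i) (eigL0_neq0 i)).
have n2 := near_punctured (holomorphic_neq0 (holomorphic_mC i) (mC0 i)).
have n3 := near_punctured (holomorphic_neq0 (holomorphic_cos_angle o) (cos_angle0_neq0 o)).
have n4 := order_neq0 (orderM (order_sin2_angle (w i)) (order_sin2_angle o)).
have e0 : 0 < chord i ^+ 2 / 3 by rewrite divr_gt0// exprn_gt0.
have n5 := near_punctured (holomorphic_near (holomorphic_eigS i) e0).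
have n6 := near_punctured (holomorphic_near (holomorphic_eigL i) e0).
have key (x y x0 : C) (q : R) : 0 < q -> normc x0 = q ->
    normc (y - 0) < q / 3 -> normc (x - x0) < q / 3 -> normc y < normc x.
  move=> q0 xq; rewrite subr0 => yq xx0.
  by have := normc_triangle x0 x 0; rewrite !subr0 xq (normc_distC x0 x); lra.
have S0 : eigS i 0 = 0 by rewrite /eigS mdet0 mul0r.
have l0 : normc (eigL i 0) = chord i ^+ 2.
  by rewrite eigL0 normcN normc_real ger0_norm// sqr_ge0.
have q0 : 0 < chord i ^+ 2 by rewrite exprn_gt0.
rewrite S0 in n5.
near=> z; split; [by near: z|by near: z|by near: z|by near: z|].
by apply: (key _ _ (eigL i 0) (chord i ^+ 2) q0 l0); near: z.
Unshelve. all: by end_near.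
Qed.

End KoebeFunctions.

(** * Matrices of conjugated maps and of disks *)

Section ReflectionMatrices.
Context (R : realType).
Local Notation C := R[i].
Implicit Types (x y : P1 R) (a b : C).

Definition mx2 (m11 m12 m21 m22 : C) : 'M[C]_2 := \matrix_(i, j)
  if i == ord0 then (if j == ord0 then m11 else m12) else (if j == ord0 then m21 else m22).

Lemma mx2E m11 m12 m21 m22 : [/\ mx2 m11 m12 m21 m22 ord0 ord0 = m11,
  mx2 m11 m12 m21 m22 ord0 ord_max = m12, mx2 m11 m12 m21 m22 ord_max ord0 = m21 &
  mx2 m11 m12 m21 m22 ord_max ord_max = m22].
Proof. by rewrite /mx2; split; rewrite mxE. Qed.

Lemma mx2_unit m11 m12 m21 m22 :
  (mx2 m11 m12 m21 m22 \in unitmx) = (m11 * m22 - m12 * m21 != 0).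
Proof. by rewrite unitmxE unitfE det_mx2; have [-> -> -> ->] := mx2E m11 m12 m21 m22. Qed.

Lemma mx2_mul m11 m12 m21 m22 n11 n12 n21 n22 :
  mx2 m11 m12 m21 m22 *m mx2 n11 n12 n21 n22 =
  mx2 (m11 * n11 + m12 * n21) (m11 * n12 + m12 * n22)
      (m21 * n11 + m22 * n21) (m21 * n12 + m22 * n22).
Proof.
have [e1 e2 e3 e4] := mx2E m11 m12 m21 m22; have [f1 f2 f3 f4] := mx2E n11 n12 n21 n22.
by apply/matrixP; apply: ord2P; apply: ord2P;
  rewrite mulmx2E [RHS]mxE /= ?e1 ?e2 ?e3 ?e4 ?f1 ?f2 ?f3 ?f4.
Qed.

Lemma mobius_mx2P m11 m12 m21 m22 x y (t : C) : t != 0 ->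
  m11 * hx x + m12 * hy x = t * hx y -> m21 * hx x + m22 * hy x = t * hy y ->
  mobius (mx2 m11 m12 m21 m22) x = y.
Proof.
move=> t0 h0 h1; apply: (mobiusP t0); have [e1 e2 e3 e4] := mx2E m11 m12 m21 m22.
apply: cV2P; rewrite mulmx2E [RHS]mxE (hvecE x).1 (hvecE x).2.
- by rewrite e1 e2 (hvecE y).1.
- by rewrite e3 e4 (hvecE y).2.
Qed.

Definition conjP1 x : P1 R := if x is Some z then Some (conjc z) else None.

Lemma conjP1K : involutive conjP1.
Proof. by case=> [z|] //=; rewrite conjcK. Qed.

Lemma hx_conj x : hx (conjP1 x) = conjc (hx x).
Proof. by case: x => [z|] //=; rewrite oppr0. Qed.

Lemma hy_conj x : hy (conjP1 x) = conjc (hy x).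
Proof. by case: x => [z|] //=; rewrite oppr0. Qed.

Lemma conj_mobius m11 m12 m21 m22 x : m11 * m22 - m12 * m21 != 0 ->
  conjP1 (mobius (mx2 m11 m12 m21 m22) x) =
  mobius (mx2 (conjc m11) (conjc m12) (conjc m21) (conjc m22)) (conjP1 x).
Proof.
rewrite -mx2_unit => Mu; have [t [t0]] := mobius_coords x Mu.
have [-> -> -> ->] := mx2E m11 m12 m21 m22 => h0 h1.
apply/esym/(@mobius_mx2P _ _ _ _ _ _ (conjc t)); first by rewrite conjc_eq0.
- by rewrite !hx_conj hy_conj -!rmorphM -rmorphD h0.
- by rewrite !hy_conj hx_conj -!rmorphM -rmorphD h1.
Qed.

Definition disk_matrix a (r : R) := mx2 (real_complex R r) a 0 1.

Lemma disk_matrix_det a (r : R) : 0 < r -> real_complex R r * 1 - a * 0 != 0.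
Proof. by move=> r0; rewrite mulr0 subr0 mulr1 fmorph_eq0 gt_eqF. Qed.

Lemma disk_matrix_unit a (r : R) : 0 < r -> disk_matrix a r \in unitmx.
Proof. by move=> r0; rewrite mx2_unit disk_matrix_det. Qed.

Lemma mobius_disk_matrix a (r : R) z :
  mobius (disk_matrix a r) (Some z) = Some (real_complex R r * z + a).
Proof.
by apply: (@mobius_mx2P _ _ _ _ _ _ 1); rewrite ?oner_neq0//= ?mulr1 ?mul1r// mul0r add0r.
Qed.

Lemma disk_matrix_image (P : R -> Prop) (a : C) (r : R) : 0 < r ->
  mobius (disk_matrix a r) @` [set Some z | z in [set z : C | P (normc z)]] =
  [set Some z | z in [set z : C | P (normc (z - a) / r)]].
Proof.
move=> r0; have rn0 : real_complex R r != 0 by rewrite fmorph_eq0 gt_eqF.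
have nr : normc (real_complex R r) = r by rewrite normc_real gtr0_norm.
apply/seteqP; split => [_ [_ [z Pz <-] <-]|_ [z Pz <-]].
- exists (real_complex R r * z + a); last by rewrite mobius_disk_matrix.
  by rewrite /= addrK Normc.normcM nr mulrAC divff ?mul1r// gt_eqF.
- exists (Some ((z - a) / real_complex R r)).
    exists ((z - a) / real_complex R r) => //=.
    by rewrite Normc.normcM Normc.normcV nr.
  by rewrite mobius_disk_matrix mulrC divfK// subrK.
Qed.

End ReflectionMatrices.

(** * Matrices and Schottky disks of the generators *)

Section SchottkyReflection.
Context (R : realType) (g : nat) (c : 'I_g.+1 -> R[i]) (k : 'I_g.+1 -> nat).
Hypotheses (c1 : forall j, normc (c j) = 1) (c_inj : injective c)
  (k1 : forall j, (1 <= k j)%N).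
Local Notation C := R[i].
Local Notation w i := (widen_ord (leqnSn g) i).
Local Notation o := (@ord_max g).
Variables (z : R) (delta : R).
Hypotheses (d02 : 0 < delta <= 2^-1)
  (sep : forall i j, i != j -> 4 * delta <= normc (c i - c j))
  (z0 : z != 0) (zd : `|z| < delta).

Local Notation a := (disk_center c k z).
Local Notation r := (disk_radius k z).
Local Notation s j := (inversion (a j) (r j)).
Local Notation inU j x := (in_open_disk a r j x).
Local Notation inB j x := (in_closed_disk a r j x).

Let z1 : `|z| <= 1.
Proof.
have [d0 d2] := andP d02; rewrite (le_trans (ltW zd))// (le_trans d2)//.
by rewrite invf_le1// ler1n.
Qed.

Let conf := disk_configuration c1 k1 d02 sep z0 zd.
Let r0 j : 0 < r j. Proof. by case: conf. Qed.
Let rd j : r j < delta. Proof. by case: conf. Qed.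
Let ac j : normc (a j) <= 3/2. Proof. by case: conf. Qed.
Let asep i j : i != j -> 3 * delta <= normc (a i - a j).
Proof. by case: conf => _ _ _ _; exact. Qed.
Let d2 : delta <= 2^-1. Proof. by case/andP: d02. Qed.

Let ct j := cos (half_angle k z j).

Let ct_bounds j : 0 < ct j /\ ct j ^+ 2 != 1.
Proof.
have [h0 _ h1] := half_angle_bounds k1 j z0 z1.
have h2 : `|half_angle k z j| <= 2^-1 by rewrite (le_trans h1)// ler_piMl ?invr_ge0.
split; first by have /andP[] := cos_half_bounds h2; rewrite /ct; lra.
have /andP[sn _] := sin_half_bounds h2.
have sn0 : 0 < `|sin (half_angle k z j)|.
  by rewrite (lt_le_trans _ sn)// divr_gt0// normr_gt0.
apply/eqP => E; move: sn0; rewrite normr_gt0.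
have := cos2Dsin2 (half_angle k z j); rewrite -/(ct j) E => /(canRL (addKr _)).
by rewrite addNr => /eqP; rewrite sqrf_eq0 => ->.
Qed.

Let cC j : C := real_complex R (ct j).
Let cC_neq0 j : cC j != 0.
Proof. by rewrite fmorph_eq0 gt_eqF//; case: (ct_bounds j). Qed.
Let conj_cC j : conjc (cC j) = cC j. Proof. exact: conjc_real. Qed.

Let c_conj j : c j * conjc (c j) = 1.
Proof. by rewrite -sqr_normc norm_normc c1 rmorph1 expr1n. Qed.

Let aE j : a j = c j / cC j.
Proof. by rewrite /disk_center /orthogonal_center fmorphV. Qed.

Let conj_a j : conjc (a j) = conjc (c j) / cC j.
Proof. by rewrite aE conjc_div conj_cC. Qed.

Let r2E j : real_complex R (r j ^+ 2) = (1 - cC j ^+ 2) / cC j ^+ 2.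
Proof.
rewrite /disk_radius real_normK ?num_real// /tan expr_div_n -/(ct j).
rewrite sin2cos2 -/(ct j) fmorph_div rmorphB rmorphXn rmorph1; exact.
Qed.

(** Orthogonality means [|a|^2 - r^2 = 1], so the inversion is [(a t - 1) / (t - conj a)] with [t]
    the conjugate of the variable; multiplying through by the cosine gives these entries. *)
Definition reflection_mx j : 'M[C]_2 := mx2 (c j) (- cC j) (cC j) (- conjc (c j)).

Let reflection_det j : c j * - conjc (c j) - (- cC j) * cC j != 0.
Proof.
rewrite mulrN mulNr opprK c_conj addrC subr_eq0 -expr2 -rmorphXn.
rewrite -(rmorph1 (real_complex R)) (inj_eq (@complexI R)).
by case: (ct_bounds j).
Qed.

Lemma inversion_mobius j x : s j x = mobius (reflection_mx j) (conjP1 x).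
Proof.
apply/esym; case: x => [t|]; last first.
  apply: (@mobius_mx2P _ _ _ _ _ _ _ (cC j)) => //=; rewrite ?mulr1 ?mulr0 ?addr0//.
  by rewrite aE mulrC divfK.
have [->|ta] := eqVneq t (a j).
  apply: (@mobius_mx2P _ _ _ _ _ _ _ ((1 - cC j ^+ 2) / cC j)).
  - rewrite mulf_neq0 ?invr_eq0// subr_eq0 eq_sym -subr_eq0.
    by have := reflection_det j; rewrite mulrN mulNr opprK c_conj addrC expr2.
  - rewrite /= eqxx /= mulr1 conj_a; transitivity ((c j * conjc (c j)) / cC j - cC j).
      by move: (conjc (c j)) => b; ring.
    by rewrite c_conj; field; exact: cC_neq0.
  - rewrite /= eqxx /= mulr1 mulr0 conj_a; move: (conjc (c j)) => b; field; exact: cC_neq0.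
rewrite inversionE//.
have den : cC j * conjc t - conjc (c j) = cC j * conjc (t - a j).
  by rewrite rmorphB /= conj_a; move: (conjc (c j)) (conjc t) => b u; field; exact: cC_neq0.
have ta' : conjc (t - a j) != 0 by rewrite conjc_eq0 subr_eq0.
apply: (@mobius_mx2P _ _ _ _ _ _ _ (cC j * conjc (t - a j))); first by rewrite mulf_neq0.
- rewrite /= mulr1 /inversionC r2E mulrDr.
  have -> : cC j * conjc (t - a j) * ((1 - cC j ^+ 2) / cC j ^+ 2 / conjc (t - a j)) =
      (1 - cC j ^+ 2) / cC j.
    by move: (conjc (t - a j)) ta' => u u0; field; rewrite u0 cC_neq0.
  rewrite rmorphB /= conj_a aE.
  transitivity (c j * conjc t - (c j * conjc (c j)) / cC j + (1 - cC j ^+ 2) / cC j).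
    by rewrite c_conj; field; exact: cC_neq0.
  by move: (conjc (c j)) (conjc t) => b u; field; exact: cC_neq0.
- by rewrite /= !mulr1 -den.
Qed.

Let cw j : cos_angle k j (real_complex R z) = cC j.
Proof.
rewrite /cos_angle /angle -rmorphXn -(rmorph_nat (real_complex R) 2) -fmorph_div ccos_real.
by [].
Qed.

Definition gamma_mx i : 'M[C]_2 := let t := real_complex R z in
  mx2 (mA c k i t) (mB c k i t) (mC c k i t) (mD c k i t).

Let gamma_mxE i : gamma_mx i = reflection_mx (w i) *m
  mx2 (conjc (c o)) (- cC o) (cC o) (- c o).
Proof.
rewrite mx2_mul /gamma_mx /mA /mB /mC /mD !cw.
by congr mx2; ring.
Qed.

Let conj_reflection_det : conjc (c o) * - c o - (- cC o) * cC o != 0.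
Proof. by have := reflection_det o; rewrite mulrN (mulrC (c o)) mulrN. Qed.

Lemma gamma_mx_unit i : gamma_mx i \in unitmx.
Proof.
by rewrite gamma_mxE unitmx_mul !mx2_unit conj_reflection_det reflection_det.
Qed.

(** The conjugations of the two reflections cancel, leaving the first matrix times the conjugate of
    the second. *)
Lemma gamma_mobius i : gamma c k z i = mobius (gamma_mx i).
Proof.
apply/funext => x; rewrite /gamma /= !sigmaE//.
have conjN (t : C) : conjc (- t) = - conjc t by exact: rmorphN.
rewrite !inversion_mobius (conj_mobius _ (reflection_det o)) conjP1K gamma_mxE mobius_comp.
- by rewrite !conjN conjcK conj_cC.
- by rewrite mx2_unit reflection_det.
- by rewrite mx2_unit conj_reflection_det.
Qed.

Let closed_disk_disk_matrix j : closed_disk (disk_matrix (a j) (r j)) = [set x | inB j x].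
Proof.
rewrite /closed_disk (@disk_matrix_image _ (fun t => t <= 1))//.
apply/seteqP; split => [_ [t /= tr <-]|[t|]//= tr] /=.
  by move: tr; rewrite ler_pdivrMr// mul1r.
by exists t => //=; rewrite ler_pdivrMr// mul1r.
Qed.

Let open_disk_disk_matrix j : open_disk (disk_matrix (a j) (r j)) = [set x | inU j x].
Proof.
rewrite /open_disk (@disk_matrix_image _ (fun t => t < 1))//.
apply/seteqP; split => [_ [t /= tr <-]|[t|]//= tr] /=.
  by move: tr; rewrite ltr_pdivrMr// mul1r.
by exists t => //=; rewrite ltr_pdivrMr// mul1r.
Qed.

(** The conjugated centre accounts for the antiholomorphy of the reflection: the image of disk [j]
    is the matrix image of the conjugate disk. *)
Let reflected_mx j := reflection_mx o *m disk_matrix (conjc (a j)) (r j).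

Let reflected_disk j : closed_disk (reflected_mx j) = [set x | inB j (s o x)].
Proof.
rewrite closed_disk_mobius ?disk_matrix_unit ?mx2_unit ?reflection_det//.
rewrite /closed_disk (@disk_matrix_image _ (fun t => t <= 1))//.
have oK := inversionK a r0 o.
apply/seteqP; split => [_ [_ [t /= tr <-] <-]|x /= xB].
  rewrite /= (_ : Some t = conjP1 (Some (conjc t))); last by rewrite /= conjcK.
  rewrite -inversion_mobius oK /=; move: tr; rewrite ler_pdivrMr// mul1r.
  by rewrite -normc_conj rmorphB /= conjcK.
exists (conjP1 (s o x)); last by rewrite -inversion_mobius oK.
case: (s o x) xB => // t /= tr; exists (conjc t) => //=.
by rewrite ler_pdivrMr// mul1r -rmorphB normc_conj.
Qed.

(** The disks are [D_i] and [s o (D_i)], the latter all inside [D_o]. The reflection [s o] sends the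
    exterior of [s o (D_i)] to the exterior of [D_i], and [s i] sends that to the interior of
    [D_i]. *)
Lemma schottky_gamma : schottky_generators (gamma c k z).
Proof.
have disj i j x : i != j -> inB i x -> inB j x -> False.
  by move=> ij xi xj; move: (disk_disjoint r0 rd asep ij xi); rewrite xj.
have oK := inversionK a r0 o.
have wo i : w i != o by rewrite -(inj_eq val_inj) /= ltn_eqF.
have reflU j x : j != o -> inB j (s o x) -> inB o x.
  move=> jo xj; apply: in_open_closed; rewrite -[x]oK in_open_inversion//.
  exact: (disk_disjoint r0 rd asep jo).
have w_neq i i' : i != i' -> w i != w i'.
  by apply: contra => /eqP /(congr1 val) /= ii'; apply/eqP/val_inj.
exists (fun e => if e.2 then disk_matrix (a (w e.1)) (r (w e.1)) else reflected_mx (w e.1)).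
split.
- move=> [i [|]] /=; first exact: disk_matrix_unit.
  by rewrite unitmx_mul disk_matrix_unit// mx2_unit reflection_det.
- move=> [i b] [i' b'] ee'; apply/seteqP; split => // x.
  case: b b' ee' => [] [] ee' /=;
    rewrite ?closed_disk_disk_matrix ?reflected_disk => -[/= xi xi'].
  + apply: (disj _ _ _ _ xi xi'); apply: w_neq.
    by apply: contra ee' => /eqP ->.
  + exact: (disj _ _ _ (wo i) xi (reflU _ _ (wo i') xi')).
  + exact: (disj _ _ _ (wo i') xi' (reflU _ _ (wo i) xi)).
  + apply: (disj _ _ _ _ xi xi'); apply: w_neq.
    by apply: contra ee' => /eqP ->.
- move=> i /=; rewrite reflected_disk open_disk_disk_matrix.
  have wK := inversionK a r0 (w i).
  have gE x : gamma c k z i x = s (w i) (s o x) by rewrite /gamma /= !sigmaE.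
  apply/seteqP; split => [_ [x /= xB <-]|x /= xU].
    by rewrite /= gE in_open_inversion//; apply/negP.
  exists (s o (s (w i) x)); last by rewrite gE oK wK.
  by rewrite /= oK; apply/negP; rewrite -in_open_inversion// wK.
Qed.

End SchottkyReflection.

(** * Normalization of the fixed points and admissibility *)

Section AdmissibleFamily.
Context (R : realType) (g : nat) (hg : (2 <= g)%N)
  (c : 'I_g.+1 -> R[i]) (k : 'I_g.+1 -> nat).
Hypotheses (c1 : forall j, normc (c j) = 1) (c_inj : injective c)
  (k1 : forall j, (1 <= k j)%N).
Local Notation C := R[i].
Local Notation Co := (R[i])^o.
Local Notation w i := (widen_ord (leqnSn g) i).
Local Notation o := (@ord_max g).
Implicit Types (z : C) (i : 'I_g) (e : 'I_g * bool).

Definition index0 : 'I_g := Ordinal (ltnW hg).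
Definition index1 : 'I_g := Ordinal hg.
Local Notation i0 := index0.
Local Notation i1 := index1.
Local Notation attr := (attr c k).
Local Notation rep := (rep c k).
Local Notation multiplier := (multiplier c k).

Definition point e z : C := if e.2 then attr e.1 z else rep e.1 z.

(** [num] and [den] scale the map [(x - attr i0) / (x - rep i0)] so that [norm_mx] sends [attr i0],
    [rep i0], [attr i1] to 0, infinity, 1. *)
Definition num z : C := attr i1 z - rep i0 z.
Definition den z : C := attr i1 z - attr i0 z.
Definition norm_mx z : 'M[C]_2 :=
  mx2 (num z) (- (num z * attr i0 z)) (den z) (- (den z * rep i0 z)).

Definition koebe : koebe_family R g := KoebeFamily
  (fun i z => (attr i z - attr i0 z) * num z / ((attr i z - rep i0 z) * den z))
  (fun i z => (rep i z - attr i0 z) * num z / ((rep i z - rep i0 z) * den z))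
  (fun i z => multiplier i z).

Lemma order_point e e' : e != e' -> order_at0 (fun z => point e z - point e' z)
  (if ~~ e.2 && ~~ e'.2 then (2 * k o)%N%:Z else 0).
Proof.
case: e e' => [i [|]] [i' [|]] ee'; rewrite /point /=.
- apply: order_attr_attr => //; by apply: contra ee' => /eqP ->.
- exact: order_attr_rep.
- exact: order_rep_attr.
- apply: order_rep_rep => //; by apply: contra ee' => /eqP ->.
Qed.

Lemma order_num : order_at0 num 0. Proof. exact: order_attr_rep. Qed.
Lemma order_den : order_at0 den 0. Proof. exact: order_attr_attr. Qed.

Lemma order_kalpha i : (2 <= i)%N -> order_at0 (kalpha koebe i) 0.
Proof.
move=> i2; have ii0 : i != i0 by apply: contraTneq i2 => ->.
exact (order_div (orderM (order_attr_attr c1 c_inj k1 ii0) order_num)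
  (orderM (order_attr_rep c1 c_inj k1 i i0) order_den)).
Qed.

(** The normalization sends [rep i0] to infinity, and the other repelling points collide with it;
    hence the pole. *)
Lemma order_kbeta i : (1 <= i)%N -> order_at0 (kbeta koebe i) (- (2 * k o)%N%:Z).
Proof.
move=> i2; have ii0 : i != i0 by apply: contraTneq i2 => ->.
rewrite (_ : - _ = (0 + 0) - ((2 * k o)%N%:Z + 0)); last by ring.
exact (order_div (orderM (order_rep_attr c1 c_inj k1 i i0) order_num)
  (orderM (order_rep_rep c1 c_inj k1 ii0) order_den)).
Qed.

Lemma order_kmult i : order_at0 (kmult koebe i) ((2 * k (w i))%N%:Z + (2 * k o)%N%:Z).
Proof. exact: order_multiplier. Qed.

Definition regular z : Prop :=
  [/\ forall i, [/\ eigL c k i z != 0, mC c k i z != 0, cos_angle k o z != 0,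
        mdet k i z != 0 & normc (eigS c k i z) < normc (eigL c k i z)],
      forall e e', e != e' -> point e z != point e' z &
      forall i, [/\ (2 <= i)%N -> cderivable (kalpha koebe i) z,
        (1 <= i)%N -> cderivable (kbeta koebe i) z & cderivable (kmult koebe i) z]].

Lemma near_regular : \forall z \near (0 : Co)^', regular z.
Proof.
have F0 : Filter ((0 : Co)^') by exact: _.
have H1 := filter_forall F0 (near_eigen c1 c_inj k1).
have H2 : \forall z \near (0 : Co)^', forall e e', e != e' -> point e z != point e' z.
  apply: (filter_forall F0) => e; apply: (filter_forall F0) => e'.
  have [->|ee'] := eqVneq e e'; first by apply: nearW => z; rewrite eqxx.
  by apply: filterS (order_neq0 (order_point ee')) => z; rewrite subr_eq0.
have H3 : \forall z \near (0 : Co)^', forall i, [/\ (2 <= i)%N -> cderivable (kalpha koebe i) z,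
        (1 <= i)%N -> cderivable (kbeta koebe i) z & cderivable (kmult koebe i) z].
  apply: (filter_forall F0) => i.
  have A : \forall z \near (0 : Co)^', (2 <= i)%N -> cderivable (kalpha koebe i) z.
    have [i2|_] := boolP (2 <= i)%N; last by apply: nearW.
    by apply: filterS (order_cderivable (order_kalpha i2)) => z ? _.
  have B : \forall z \near (0 : Co)^', (1 <= i)%N -> cderivable (kbeta koebe i) z.
    have [i2|_] := boolP (1 <= i)%N; last by apply: nearW.
    by apply: filterS (order_cderivable (order_kbeta i2)) => z ? _.
  have D := order_cderivable (order_kmult i).
  by apply: filterS3 A B D.
by apply: filterS3 H1 H2 H3.
Qed.

Section Normalization.
Variable z : C.
Hypothesis reg : regular z.

Let pt e e' : e != e' -> point e z - point e' z != 0.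
Proof. by move=> ee'; rewrite subr_eq0; case: reg => _ + _; apply. Qed.

Let num0 : num z != 0. Proof. exact: (@pt (i1, true) (i0, false)). Qed.
Let den0 : den z != 0. Proof. exact: (@pt (i1, true) (i0, true)). Qed.
Let ab0 : attr i0 z - rep i0 z != 0. Proof. exact: (@pt (i0, true) (i0, false)). Qed.

Lemma norm_mx_unit : norm_mx z \in unitmx.
Proof.
rewrite mx2_unit (_ : _ - _ = num z * den z * (attr i0 z - rep i0 z)); last by ring.
by rewrite !mulf_neq0.
Qed.

Let norm_None : mobius (norm_mx z) (Some (rep i0 z)) = None.
Proof.
apply: (@mobius_mx2P _ _ _ _ _ _ _ (num z * (rep i0 z - attr i0 z))).
- by rewrite mulf_neq0// -opprB oppr_eq0.
- by rewrite /= mulr1; ring.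
- by rewrite /=; ring.
Qed.

Let norm_Some (x y : C) : x - rep i0 z != 0 ->
  y * ((x - rep i0 z) * den z) = (x - attr i0 z) * num z ->
  mobius (norm_mx z) (Some x) = Some y.
Proof.
move=> x0 E; apply: (@mobius_mx2P _ _ _ _ _ _ _ ((x - rep i0 z) * den z)).
- by rewrite mulf_neq0.
- by rewrite [RHS]mulrC E /= mulr1; ring.
- by rewrite /=; ring.
Qed.

Lemma attractingE i : attracting koebe i z = mobius (norm_mx z) (Some (attr i z)).
Proof.
have ai0 : attr i z - rep i0 z != 0.
  by apply: (@pt (i, true) (i0, false)); rewrite xpair_eqE andbF.
rewrite /attracting; case: eqP => [ei|/eqP ni0].
  have -> : i = i0 by exact: val_inj.
  by apply/esym/norm_Some => //; rewrite subrr !mul0r.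
case: eqP => [ei|/eqP ni1].
  have -> : i = i1 by exact: val_inj.
  by apply/esym/norm_Some => //; rewrite mul1r mulrC.
apply/esym/norm_Some => //.
by rewrite divfK// mulf_neq0.
Qed.

Lemma repellingE i : repelling koebe i z = mobius (norm_mx z) (Some (rep i z)).
Proof.
rewrite /repelling; case: eqP => [ei|/eqP ni0].
  have -> : i = i0 by exact: val_inj.
  by rewrite norm_None.
have ii0 : i != i0 by [].
have bi0 : rep i z - rep i0 z != 0.
  by apply: (@pt (i, false) (i0, false)); apply: contra ii0 => /eqP[->].
by apply/esym/norm_Some => //; rewrite divfK// mulf_neq0.
Qed.

Lemma fixed_pointE e : fixed_point koebe e z = mobius (norm_mx z) (Some (point e z)).
Proof. by case: e => i [|]; rewrite /fixed_point /point /= ?attractingE ?repellingE. Qed.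

Lemma gamma_koebe i (M : 'M[C]_2) :
  M = mx2 (mA c k i z) (mB c k i z) (mC c k i z) (mD c k i z) -> M \in unitmx ->
  koebe_coordinates M (Some (attr i z)) (Some (rep i z)) (multiplier i z).
Proof.
move=> -> Mu; split => //; have [H _ _] := reg; have [l0 C0 co0 d0 sl] := H i.
exists (eigL c k i z), (eigS c k i z).
have eig (x t : C) : mA c k i z * x + mB c k i z = t * x -> mC c k i z * x + mD c k i z = t ->
    mx2 (mA c k i z) (mB c k i z) (mC c k i z) (mD c k i z) *m hvec (Some x) = t *: hvec (Some x).
  have [e1 e2 e3 e4] := mx2E (mA c k i z) (mB c k i z) (mC c k i z) (mD c k i z).
  move=> h0 h1; apply: cV2P; rewrite mulmx2E [RHS]mxE (hvecE _).1 (hvecE _).2 /= mulr1.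
  - by rewrite e1 e2 h0.
  - by rewrite e3 e4 h1 mulr1.
split.
- by have [h0 h1] := attr_eigen c1 l0 C0; apply: eig.
- by have [h0 h1] := rep_eigen c1 l0 C0 co0; apply: eig.
- by rewrite sl andbT normc_gt0 mulf_neq0// invr_eq0.
- exact: multiplierE.
Qed.

End Normalization.

Lemma order_cross i e e' : e.1 != i -> e'.1 != i ->
  order_gt0_at0 (fun z => kmult koebe i z *
    cross_ratio (fixed_point koebe e z) (fixed_point koebe e' z)
                (attracting koebe i z) (repelling koebe i z)).
Proof.
move=> ei ei'; right.
pose od e : int := if ~~ e.2 && ~~ false then (2 * k o)%N%:Z else 0.
have d1 (e1 : 'I_g * bool) b : e1.1 != i -> e1 != (i, b).
  by case: e1 => i' b' /=; apply: contra => /eqP[->].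
have oa e1 : e1.1 != i -> order_at0 (fun z => point e1 z - attr i z) 0.
  by move=> /(d1 _ true)/order_point; rewrite andbF.
have ob e1 : e1.1 != i -> order_at0 (fun z => point e1 z - rep i z) (od e1).
  by move=> /(d1 _ false)/order_point.
(* Cross-ratios are invariant, so the order is computed on the original points. The worst case, [e]
   repelling and [e'] attracting, loses [2 k o] and still leaves [2 k (w i) > 0]. *)
exists ((2 * k (w i))%N%:Z + (2 * k o)%N%:Z + ((0 + od e') - (od e + 0))).
  have od_bounds e1 : 0 <= od e1 <= (2 * k o)%N%:Z by rewrite /od; case: ifP; rewrite ?lexx.
  have /andP[h1 _] := od_bounds e'; have /andP[_ h2] := od_bounds e.
  have : (0 : int) < (2 * k (w i))%N%:Z by rewrite ltz_nat muln_gt0 k1.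
  by move: h1 h2; move: (od e) (od e') (2 * k (w i))%N%:Z (2 * k o)%N%:Z => a b m n; lra.
apply: (order_near _ (orderM (order_kmult i)
  (order_div (orderM (oa _ ei) (ob _ ei')) (orderM (ob _ ei) (oa _ ei'))))).
apply: filterS near_regular => z reg.
rewrite !(fixed_pointE reg) (attractingE reg) (repellingE reg).
by rewrite (cross_ratio_mobius _ _ _ _ (norm_mx_unit reg)) cross_ratio_Some.
Qed.

Theorem koebe_admissible : admissible koebe.
Proof.
have /near0_normcP[r r0 Hr] := near_regular.
have e0 : 0 < (expR 1 : R)^-1 by rewrite invr_gt0 expR_gt0.
(* Halving [r] keeps the closed punctured disk of radius [r'] inside the regular range. *)
pose r' := Num.min (r / 2) (expR 1)^-1.
have r'0 : 0 < r' by rewrite lt_min e0 divr_gt0.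
have r'r : r' < r by rewrite gt_min; apply/orP; left; lra.
exists r'; first by rewrite r'0 ge_min lexx orbT.
move=> D'; have regD z : 0 < normc z <= r' -> regular z.
  by move=> /andP[z0 zr]; apply: Hr; rewrite z0 (le_lt_trans zr).
have regD' z : D' z -> regular z.
  by move=> /andP[z0 zr]; apply: regD; rewrite z0 ltW.
have half_in (q : R) : 0 < q -> q <= r' -> D' (real_complex R (q / 2)).
  move=> q0 qr; rewrite /D' /mkset normc_real gtr0_norm ?divr_gt0//.
  by apply/andP; split; lra.
split.
  move=> f cf.
  have [m fm] : exists m, order_at0 f m.
    case: cf => i [[i2 ->]|[i2 ->]|->]; eexists.
    - exact: order_kalpha.
    - exact: order_kbeta.
    - exact: order_kmult.
  have fd z : regular z -> cderivable f z.
    by case: cf => i [[i2 ->]|[i2 ->]|->] [_ _ /(_ i)[a b d]]; [exact: a|exact: b|exact: d].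
  split; last exact: order_meromorphic fm.
  - apply/subspace_continuousP => z zr; apply: cvg_within_filter.
    exact (cderivable_continuous (fd z (regD z zr))).
  - move=> z zD; apply/near_normcP; have /andP[z0 zr] := zD.
    exists (Num.min (normc z) (r' - normc z)); first by rewrite lt_min z0 subr_gt0.
    move=> v; rewrite lt_min => /andP[v1 v2]; apply: (fd v); apply: regD'; apply/andP; split.
      rewrite normc_gt0; apply: contraTneq v1 => ->.
      by rewrite sub0r normcN ltxx.
    by have := normc_triangle v z 0; rewrite !subr0; lra.
split.
- move=> i; have om := order_kmult i.
  have mp : (0 : int) < (2 * k (w i))%N%:Z + (2 * k o)%N%:Z.
    by rewrite -PoszD ltz_nat addn_gt0 muln_gt0 k1.
  have k0 : kmult koebe i 0 = 0.
    by rewrite /= /multiplier mdet0// mul0r.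
  split; [|exact: k0|].
    (* Non-constancy: the value at [z1] is non-zero, and the value at some [z2] closer to 0 has
       smaller modulus. *)
    pose z1 := real_complex R (r' / 2); have z1D : D' z1 by exact: half_in.
    have y1 : kmult koebe i z1 != 0.
      have [H _ _] := regD' _ z1D; have [l0 _ _ d0 _] := H i.
      by rewrite /= /multiplier mulf_neq0// invr_eq0 expf_neq0.
    have y10 : 0 < normc (kmult koebe i z1) by rewrite normc_gt0.
    have /near0_normcP[q q0 Hq] := order_gt0_small mp om y10.
    pose t := Num.min q r'; have t0 : 0 < t by rewrite lt_min q0.
    pose z2 := real_complex R (t / 2).
    have tq : t <= q by rewrite ge_min lexx.
    have tr : t <= r' by rewrite ge_min lexx orbT.
    have z2D : D' z2 by exact: half_in.
    have z2q : 0 < normc z2 < q.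
      have [z20 _] := andP z2D; rewrite z20 /z2 normc_real gtr0_norm ?divr_gt0//.
      by lra.
    have small := Hq z2 z2q.
    exists z1, z2; split; [exact: z1D|exact: z2D|].
    by move=> E; move: small; rewrite E ltxx.
  have hm : holomorphic_at (kmult koebe i) 0.
    exact (holomorphic_div (@holomorphic_mdet R g k i)
      (@holomorphicX R _ 2 (holomorphic_eigL c1 c_inj k1 i))
      (expf_neq0 2 (eigL0_neq0 c1 c_inj k1 i))).
  by have := cderivable_continuous (holomorphic_derivable hm); rewrite k0.
- exact: order_cross.
- move=> e e' ee'; exists (real_complex R (r' / 2)); first exact: half_in.
  have reg := regD' _ (half_in _ r'0 (lexx _)).
  rewrite !(fixed_pointE reg) => /(can_inj (mobiusK (norm_mx_unit reg)))[].
  by apply/eqP; case: reg => _ + _; apply.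
Qed.

Theorem koebe_conjugate : \forall z \near (0 : R)^',
  exists M : 'I_g -> 'M[R[i]]_2,
    [/\ forall i, koebe_coordinates (M i)
          (attracting koebe i (real_complex R z))
          (repelling koebe i (real_complex R z))
          (kmult koebe i (real_complex R z)),
        schottky_generators (fun i => mobius (M i)) &
        exists phi : 'M[R[i]]_2,
        [/\ phi \in unitmx,
            forall i, mobius phi \o gamma c k z i \o mobius (invmx phi) = mobius (M i) &
            [set mobius phi \o f \o mobius (invmx phi) | f in Gamma c k z]
            = generated (range (fun i => mobius (M i)))]].
Proof.
have [delta [d02 sep]] := center_separation c_inj; have [d0 _] := andP d02.
have nd : \forall z \near (0 : R)^', z != 0 /\ `|z| < delta by exact: (near_dnbhs0 d0).
have nr := near_real near_regular.
apply: filterS2 nd nr => z [z0 zd] reg.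
have pu := norm_mx_unit reg; set phi := norm_mx _ in pu.
pose G i := gamma_mx c k z i.
have Gu i : G i \in unitmx by exact: (gamma_mx_unit c1 k1 d02 z0 zd).
have Gm i : gamma c k z i = mobius (G i) by exact: (gamma_mobius c1 k1 d02 z0 zd).
have conjE i : mobius phi \o gamma c k z i \o mobius (invmx phi) =
    mobius (phi *m G i *m invmx phi).
  have pGu : phi *m G i \in unitmx by rewrite unitmx_mul pu Gu.
  have piu : invmx phi \in unitmx by rewrite unitmx_inv.
  apply/funext => x; rewrite (mobius_comp x pGu piu) (mobius_comp _ pu (Gu i)).
  by rewrite -(Gm i).
exists (fun i => phi *m G i *m invmx phi); split.
- move=> i; rewrite (attractingE reg) (repellingE reg).
  by apply: koebe_conj => //; exact: gamma_koebe.
- have := schottky_conj pu (schottky_gamma c1 k1 d02 sep z0 zd).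
  by under eq_fun do rewrite conjE.
- exists phi; split => //; rewrite /Gamma (generated_conj _ (mobiusK pu) (mobiusKV pu)).
  congr generated; apply/seteqP; split => [_ [_ [i _ <-] <-]|_ [i _ <-]].
    by exists i; rewrite ?conjE.
  by exists (gamma c k z i); [exists i|rewrite conjE].
Qed.

End AdmissibleFamily.

Theorem theorem6p3 (R : realType) (g : nat) (hg : (2 <= g)%N)
    (c : 'I_g.+1 -> R[i]) (hc : forall j, `|c j| = 1)
    (hc_inj : injective c)
    (k : 'I_g.+1 -> nat) (hk : forall j, (1 <= k j)%N) :
  let s (z : R) : R := fine (hausdorff_dim (@sdist R) (limit_set (Gamma c k z))) in
  [/\
    exists2 p : koebe_family R g, admissible p &
      \forall z \near (0 : R)^',
        exists M : 'I_g -> 'M[R[i]]_2,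
        [/\ forall i, koebe_coordinates (M i)
              (attracting p i (real_complex R z))
              (repelling p i (real_complex R z))
              (kmult p i (real_complex R z)),
            schottky_generators (fun i => mobius (M i)) &
            exists phi : 'M[R[i]]_2,
            [/\ phi \in unitmx,
                forall i, mobius phi \o gamma c k z i \o mobius (invmx phi)
                          = mobius (M i) &
                [set mobius phi \o f \o mobius (invmx phi) | f in Gamma c k z]
                = generated (range (fun i => mobius (M i)))]],
    forall (kk : nat) (u : R),
      (forall i : 'I_g, k (widen_ord (leqnSn g) i) = kk) ->
      let P : {poly R} := 'X^(kk + k ord_max) + (1 - g%:R^-1) *: 'X^kk
                          - (g%:R^-1)%:P in
      root P u -> (forall v, root P v -> v <= u) ->
      s ~_((0 : R)^') (fun z : R => (- ln u / (2 * ln `|z^-1|))%R) &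
    (forall j, k j = 1%N) ->
      s ~_((0 : R)^') (fun z : R => (ln g%:R / (2 * ln `|z^-1|))%R)].
Proof.
have c1 j : normc (c j) = 1 by apply: (@complexI R); rewrite -norm_normc hc rmorph1.
have g2 : 2 <= g%:R :> R by rewrite ler_nat.
have g0 : 0 < g%:R :> R by lra.
move=> s; split.
- exists (koebe hg c k); first exact: koebe_admissible.
  exact: koebe_conjugate.
- move=> kk u kE P Pu uP.
  have kk1 : (1 <= kk)%N by rewrite -(kE (Ordinal hg)).
  have [u01 uE] := largest_root hg kk1 Pu uP.
  apply: dim_equiv => //; apply: etrans uE.
  rewrite /fraction_sum big_ord_recr /=; congr (_ + _).
  under eq_bigr do rewrite kE.
  by rewrite sumr_const card_ord mulr_natl.
(* When all exponents are 1 the eigenvalue equation is [(g + 1) u / (1 + u) = 1], so [u = 1 / g]. *)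
- move=> k1; rewrite -[ln g%:R]opprK -lnV ?posrE//.
  apply: dim_equiv => //.
    by rewrite invr_gt0 g0/= invf_lt1//; lra.
  rewrite /fraction_sum; under eq_bigr do rewrite k1 expr1.
  rewrite sumr_const card_ord -[LHS]mulr_natl -natr1; field.
  by rewrite !gt_eqF//; lra.
Qed.
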